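(* Let $m>0$ and $H=D_m+V$, where $V$ is a self-adjoint $2\times2$ matrix-valued potential with continuous entries satisfying $|V(x)|\lesssim\langle x\rangle^{-3-}$. If the threshold energies $\pm m$ are regular, then $$\sup_{|\lambda|>m}\ \big\|\langle x\rangle^{-\sigma}(H-(\lambda+i0))^{-1}\langle x\rangle^{-\sigma}\big\|_{L^2\to L^2}\lesssim1\qquad\text{provided } \sigma>1 .$$
   Context: $D_m=i\alpha\partial_x+m\beta$ with $\alpha=\begin{pmatrix}-1&0\\0&1\end{pmatrix}$, $\beta=\begin{pmatrix}0&1\\1&0\end{pmatrix}$, acting on $\mathbb C^2$-valued functions on $\mathbb R$. $\langle x\rangle=(1+|x|^2)^{1/2}$; $|V(x)|\lesssim\langle x\rangle^{-3-}$ means that for some $\epsilon>0$ each entry is bounded by a constant times $\langle x\rangle^{-3-\epsilon}$. $(H-(\lambda+i0))^{-1}=\lim_{\epsilon\searrow0}(H-(\lambda+i\epsilon))^{-1}$, as operators between weighted $L^2$ spaces. The supremum is over real $\lambda$. The threshold energies $\pm m$ are regular if there are no nonzero distributional solutions $\psi\in L^\infty(\mathbb R;\mathbb C^2)$ of $H\psi=m\psi$ or of $H\psi=-m\psi$. *)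

(* Defs.v *)
From HB Require Import structures.
From mathcomp Require Import all_boot all_order all_algebra.
From mathcomp Require Import complex.
From mathcomp Require Import all_classical all_reals all_analysis.

Set Implicit Arguments.
Unset Strict Implicit.
Unset Printing Implicit Defensive.

Import Order.TTheory GRing.Theory Num.Theory.
Import numFieldNormedType.Exports.

Local Open Scope classical_set_scope.
Local Open Scope complex_scope.
Local Open Scope ring_scope.

Section Dirac.
Context {R : realType}.

Local Notation C := R[i].
Local Notation Re := complex.Re.
Local Notation Im := complex.Im.
Local Notation I := (0 +i* 1 : C).
Local Notation mu := (@lebesgue_measure R).

Definition spinor := 'cV[C]_2.
Definition spinor_field := R -> spinor.

Implicit Types (u f g h psi : spinor_field) (x s : R) (z : C).

Definition spinor_norm (v : spinor) : R :=
  Num.sqrt (\sum_(i < 2) (Re (v i 0) ^+ 2 + Im (v i 0) ^+ 2)).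

(* No sigma-algebra is available on C: measurability is that of the real and
   imaginary parts of the components. *)
Definition spinor_measurable f : Prop :=
  forall i : 'I_2, measurable_fun [set: R] (fun x => Re (f x i 0)) /\
                   measurable_fun [set: R] (fun x => Im (f x i 0)).

Definition LpN (p : \bar R) f : \bar R :=
  Lnorm mu p (fun x => (spinor_norm (f x))%:E).

(* Elements of the Lebesgue spaces are represented by functions, two of which
   are identified when they are equal almost everywhere. *)
Definition L2 f : Prop := spinor_measurable f /\ (LpN 2%:E f < +oo)%E.
Definition Linfty f : Prop := spinor_measurable f /\ (LpN +oo%E f < +oo)%E.

Definition Cintegral (F : R -> C) : C :=
  (\int[mu]_x Re (F x)) +i* (\int[mu]_x Im (F x)).
Definition spinor_integral f : spinor := \col_i Cintegral (fun x => f x i 0).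

(* Real-valued test functions determine a distribution, by linearity. *)
Definition test_function (phi : R -> R) : Prop :=
  (forall n x, derivable (derive1n n phi) x 1) /\
  (exists M, forall x, M < `|x| -> phi x = 0).

(* int phi f, the value at phi of the distribution defined by f *)
Definition distr f (phi : R -> R) : spinor :=
  spinor_integral (fun x => (phi x)%:C *: f x).

Definition weak_derivative u g : Prop :=
  forall phi, test_function phi -> distr g phi = - distr u (derive1 phi).

Definition H1 u : Prop := L2 u /\ exists2 g, L2 g & weak_derivative u g.

Definition alpha : 'M[C]_2 := (block_mx (-1)%:M 0 0 1%:M : 'M[C]_(1 + 1)).
Definition beta : 'M[C]_2 := (block_mx 0 1%:M 1%:M 0 : 'M[C]_(1 + 1)).

Section Operator.
Variables (m : R) (V : R -> 'M[C]_2).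

(* The graph of H = D_m + V as an operator in L^2 with domain H^1:
   u is in the domain of H, and H u = h. *)
Definition dirac_graph u h : Prop :=
  [/\ H1 u, L2 h &
    exists g, [/\ L2 g, weak_derivative u g &
      h = (fun x => I *: (alpha *m g x) + m%:C *: (beta *m u x) + V x *m u x)
        %[ae mu]]].

(* H psi = E psi in the sense of distributions, where the derivative in D_m
   is transposed onto the test function. *)
Definition distributional_solution (E : R) psi : Prop :=
  forall phi, test_function phi ->
    - (I *: (alpha *m distr psi (derive1 phi))) + m%:C *: (beta *m distr psi phi)
      + distr (fun x => V x *m psi x) phi
    = E%:C *: distr psi phi.

Definition regular_energy (E : R) : Prop :=
  forall psi, Linfty psi -> distributional_solution E psi ->
    psi = (fun=> 0) %[ae mu].

Definition thresholds_regular : Prop :=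
  regular_energy m /\ regular_energy (- m).

End Operator.

Definition japanese x : R := Num.sqrt (1 + x ^+ 2).

Definition self_adjoint (V : R -> 'M[C]_2) : Prop :=
  forall x, map_mx conjc (V x)^T = V x.

Definition continuous_entries (V : R -> 'M[C]_2) : Prop :=
  forall i j, continuous (fun x => Re (V x i j)) /\
              continuous (fun x => Im (V x i j)).

(* |V(x)| <~ <x>^(-a-) *)
Definition decay (a : R) (V : R -> 'M[C]_2) : Prop :=
  exists eps K : R, 0 < eps /\
    forall i j x, `|V x i j| <= (K * japanese x `^ (- a - eps))%:C.

Definition operator := spinor_field -> spinor_field.

Implicit Types A B T : operator.

(* The L^2 -> L^2 norm, +oo if A is unbounded *)
Definition opnorm A : \bar R :=
  ereal_inf [set K%:E | K in [set K : R | 0 <= K /\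
    forall f, L2 f -> (LpN 2%:E (A f) <= K%:E * LpN 2%:E f)%E]].

Definition bounded_operator A : Prop :=
  [/\ forall f, L2 f -> L2 (A f),
      forall z f g, L2 f -> L2 g ->
        A (fun x => z *: f x + g x) = (fun x => z *: A f x + A g x) %[ae mu]
    & (opnorm A < +oo)%E].

Definition weight s : operator := fun f x => (japanese x `^ s)%:C *: f x.

Definition sandwich s A : operator :=
  fun f => weight (- s) (A (weight (- s) f)).

(* B = (H - z)^-1 as a bounded operator on L^2; the equation (H - z) u = f
   is written H u = f + z u. *)
Definition is_resolvent m V z B : Prop :=
  bounded_operator B /\
  forall f, L2 f ->
    dirac_graph m V (B f) (fun x => f x + z *: B f x) /\
    forall u, dirac_graph m V u (fun x => f x + z *: u x) ->
      u = B f %[ae mu].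

(* T = (H - (lambda + i0))^-1, the limit in the operator norm from
   <x>^-s L^2 to <x>^s L^2. *)
Definition is_limiting_resolvent m V s (lambda : R) T : Prop :=
  bounded_operator (sandwich s T) /\
  exists B : R -> operator,
    (forall eps, 0 < eps -> is_resolvent m V (lambda +i* eps) (B eps)) /\
    opnorm (sandwich s (fun f x => T f x - B eps f x)) @[eps --> 0^'+] --> 0%E.

End Dirac.

(* Main.v *)
Require Import Defs.
From HB Require Import structures.
From mathcomp Require Import all_boot all_order all_algebra.
From mathcomp Require Import complex.
From mathcomp Require Import all_classical all_reals all_analysis.
From mathcomp Require Import measurable_realfun ess_sup_inf.
From mathcomp Require Import ring lra.

Set Implicit Arguments.
Unset Strict Implicit.
Unset Printing Implicit Defensive.

Import Order.TTheory GRing.Theory Num.Theory.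
Import numFieldNormedType.Exports.

Local Open Scope classical_set_scope.
Local Open Scope ring_scope.

(** A solution of [(H - z) u = 0] solves a 2x2 first-order system, and the
    Joukowski variable [zeta], with [z = m (zeta + 1/zeta) / 2] and momentum
    [k = m (1/zeta - zeta) / 2], makes energy and momentum single-valued: the
    spectrum [|lambda| > m] is the punctured interval [0 < |zeta| < 1], the
    thresholds are [zeta = 1, -1], and [Im z > 0] is the lower half disc. On
    the closed half disc the Volterra equation for the Jost solution
    [e^{ikx} g(x)] is solved uniformly by iteration, because the free propagator
    grows at most linearly and [<x>^2 V] is integrable; [g] has linear growth
    on the left and is Hoelder continuous in [zeta]. The reflection [x -> -x],
    conjugated by [beta], gives the solution that decays at [-oo].

    The Wronskian of the two has constant modulus. For real [zeta] in (-1, 1)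
    the conserved current [|u_1|^2 - |u_0|^2] bounds it below by
    [1 - zeta^2]; at [zeta = 1, -1] its vanishing would produce a bounded
    threshold solution. Regularity and continuity thus bound it below on the
    whole spectrum, uniformly up to high energy. The Green kernel is then at
    most [C ((1 + |x|) (1 + |y|))^{1/2}], which the weights turn into a rank-one
    Hilbert-Schmidt bound, and Hoelder continuity in [zeta] gives the
    limit [z -> lambda + i0]. For [Im z > 0] the kernel decays off the diagonal,
    so that Schur's test bounds the resolvent; uniqueness holds because the
    current of a solution is monotone and integrable. *)

(** The difficulty is uniformity at both ends of the spectrum. At high energy [zeta] tends to 0 and
    the free generator grows like 1/|zeta|, but in the propagator it is multiplied by a factor of
    size at most 1/|k|, which restores a uniform bound; there the current estimate 1 - zeta^2 is
    close to 1, so no compactness at infinity is involved and regularity matters only near two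
    points. At these points k = 0, and the linear growth of the propagator costs two powers of <x>
    on V. A Lipschitz estimate in [zeta] would cost two more in the same argument; interpolating it
    with the crude bound gives a Hoelder exponent [theta] for only 2 theta more powers. So [theta]
    is a small budget, paid from the surplus decay of V and from the surplus of [sigma] over 1.

    V may have a nonzero trace against alpha, so the Wronskian rotates; its phase rotates at the
    same rate for all energies, and differences of Wronskians can still be read off at x = 0.

    The norm bound is uniform in [lambda]. The rate of convergence to the limit is not, because the
    inverse Joukowski map is singular at the thresholds. *)

Lemma eq_ler (R : realType) (a b : R) : a = b -> a <= b.
Proof. by move=> ->. Qed.

(** * Absolutely continuous functions, Fubini and integration by parts *)

Section Primitive.
Context {R : realType}.
Local Notation mu := (@lebesgue_measure R).
Implicit Types (J h : R -> R) (a b x y : R).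

(** Absolute continuity on compact intervals, expressed without derivatives: a square-integrable
    source gives a solution that is differentiable only almost everywhere. For a continuous density
    the notion is the classical one ([primitive_is_derive], [primitive_derive]). *)
Definition primitive J h :=
  (forall a b, mu.-integrable `[a, b] (EFin \o h)) /\
  (forall x y, x <= y -> J y - J x = \int[mu]_(t in `[x, y]) h t).

Lemma continuous_itv_integrable h a b :
  continuous h -> mu.-integrable `[a, b] (EFin \o h).
Proof.
move=> ch; apply: continuous_compact_integrable; first exact: segment_compact.
exact: continuous_subspaceT.
Qed.

Lemma primitive_is_derive J h x :
  primitive J h -> {for x, continuous h} -> is_derive x 1 J (h x).
Proof.
move=> [ih JE] ch.
have x1 : x < x + 1 by lra.
have x0 : x - 1 < x by lra.
have [dF FE] := continuous_FTC1_closed x1 (ih _ _) x0 ch.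
pose F y := J (x - 1) + \int[mu]_(t in `[x - 1, y]) h t.
have HF : is_derive x 1 F (h x).
  have H : is_derive x 1 (fun y => \int[mu]_(t in `[x - 1, y]) h t) (h x).
    by apply: DeriveDef; [exact: dF|rewrite -derive1E; exact: FE].
  by rewrite -[h x]add0r; apply: is_deriveD.
apply: (near_eq_is_derive _ HF); near=> y.
rewrite /F -JE; first by rewrite addrC subrK.
near: y; exists 1 => //= y /=; rewrite ltr_norml => /andP[? ?]; lra.
Unshelve. all: by end_near. Qed.

Lemma primitive_continuous J h : primitive J h -> continuous J.
Proof.
move=> [ih JE] x.
have xx : x - 1 <= x + 1 by lra.
have := parameterized_integral_continuous xx (ih (x - 1) (x + 1)).
have lt : x - 1 < x + 1 by lra.
move=> /(continuous_within_itvP _ lt) [+ _ _].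
move=> /(_ x); rewrite in_itv /= => /(_ ltac:(lra)) H.
pose F y := J (x - 1) + parameterized_integral mu (x - 1) y h.
have HF : {for x, continuous F} by apply: cvgD; [exact: cvg_cst|exact: H].
have FJ : \forall y \near x, F y = J y.
  near=> y; rewrite /F /parameterized_integral -JE; first by rewrite addrC subrK.
  near: y; exists 1 => //= y /=; rewrite ltr_norml => /andP[? ?]; lra.
rewrite /continuous_at -(nbhs_singleton FJ).
by apply: cvg_trans HF; apply: near_eq_cvg.
Unshelve. all: by end_near. Qed.

Lemma is_derive_continuous J h :
  (forall x, is_derive x 1 J (h x)) -> continuous J.
Proof.
move=> dJ x; apply: differentiable_continuous; apply/derivable1_diffP.
by have [] := dJ x.
Qed.

Lemma primitive_derive J h :
  continuous h -> (forall x, is_derive x 1 J (h x)) -> primitive J h.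
Proof.
move=> ch dJ; split=> [a b|x y]; first exact: continuous_itv_integrable.
rewrite le_eqVlt => /predU1P[->|xy].
  by rewrite subrr set_itv1 Rintegral_set1.
rewrite /Rintegral (@continuous_FTC2 _ h J)//.
- exact: continuous_subspaceT.
- have cJ := is_derive_continuous dJ.
  split; first by move=> z _; have [] := dJ z.
  + exact/cvg_at_right_filter/cJ.
  + exact/cvg_at_left_filter/cJ.
- by move=> z _; rewrite derive1E; have [_ ->] := dJ z.
Qed.

Lemma primitive_right h :
  (forall a, mu.-integrable `[a, +oo[ (EFin \o h)) ->
  primitive (fun x => - \int[mu]_(t in `[x, +oo[) h t) h.
Proof.
move=> ih; split=> [a b|x y xy].
  by apply: integrableS (ih a) => //; apply: subset_itvl.
rewrite -Rintegral_itv_obnd_cbnd; last first.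
  by apply: integrableS (ih y) => //; apply: subset_itvr; rewrite bnd_simp.
rewrite -(@Rintegral_itvB R h (BLeft x) _ y) ?bnd_simp//; lra.
Qed.

Lemma primitive_left h :
  (forall b, mu.-integrable `]-oo, b] (EFin \o h)) ->
  primitive (fun x => \int[mu]_(t in `]-oo, x]) h t) h.
Proof.
move=> ih; split=> [a b|x y xy].
  by apply: integrableS (ih b) => //; apply: subset_itvr.
rewrite (@Rintegral_itvB R h -oo%O _ x) ?bnd_simp//.
rewrite Rintegral_itv_obnd_cbnd//.
by apply: integrableS (ih y) => //; apply: subset_itvr.
Qed.

Lemma primitiveN J h : primitive J h -> primitive (fun x => - J x) (fun x => - h x).
Proof.
move=> [ih JE]; split=> [a b|x y xy].
  rewrite (_ : EFin \o _ = -%E \o (EFin \o h)); last by apply/funext.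
  exact: integrableN.
rewrite -opprD JE//; under [RHS]eq_Rintegral do rewrite -mulN1r.
by rewrite RintegralZl// mulN1r.
Qed.

Lemma primitiveD J h J' h' : primitive J h -> primitive J' h' ->
  primitive (fun x => J x + J' x) (fun x => h x + h' x).
Proof.
move=> [ih JE] [ih' JE'].
have mI a b : measurable (`[a, b]%classic : set (measurableTypeR R)) by exact: measurable_itv.
split=> [a b|x y xy]; first exact: (integrableD (mI a b) (ih a b) (ih' a b)).
by rewrite (RintegralD (mI x y) (ih x y) (ih' x y)) -JE// -JE'//; ring.
Qed.

Lemma dominated_integrable (f g : R -> R) (D : set (measurableTypeR R)) :
  measurable D -> measurable_fun D f -> (forall x, D x -> `|f x| <= g x) ->
  mu.-integrable D (EFin \o g) -> mu.-integrable D (EFin \o f).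
Proof.
move=> mD mf fg ig; apply: le_integrable ig => //; first exact/measurable_EFinP.
by move=> x Dx; rewrite lee_fin (le_trans (fg x Dx))// ler_norm.
Qed.

Lemma integrable_patch (p : R -> R) (D : set (measurableTypeR R)) :
  measurable D -> mu.-integrable D (EFin \o p) ->
  mu.-integrable setT (EFin \o (p \_ D)).
Proof.
by move=> mD ip; rewrite -restrict_EFin; exact/(iffLR (integrable_mkcond _ mD)).
Qed.

(** Both sides integrate f(x) g(y) over the half-plane y <= x. This is integration by parts for
    densities that are merely integrable. *)
Lemma triangle_Fubini (f g : R -> R) :
  mu.-integrable setT (EFin \o f) -> mu.-integrable setT (EFin \o g) ->
  \int[mu]_x (f x * \int[mu]_(y in `]-oo, x]) g y) =
  \int[mu]_y (g y * \int[mu]_(x in `[y, +oo[) f x).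
Proof.
move=> fi gi.
have mf : measurable_fun setT f by move: fi => /integrableP[/measurable_EFinP].
have mg : measurable_fun setT g by move: gi => /integrableP[/measurable_EFinP].
pose T := [set z : R * R | z.2 <= z.1].
have mT : measurable T.
  rewrite (_ : T = (fun z : R * R => z.1 - z.2) @^-1` `[0, +oo[); last first.
    by apply/seteqP; split => z /=; rewrite in_itv /= andbT subr_ge0.
  rewrite -[_ @^-1` _]setTI.
  by apply: measurable_funB => //.
pose F (z : R * R) := f z.1 * (g z.2 * \1_T z).
have mF : measurable_fun setT F.
  apply: measurable_funM; first exact: measurableT_comp.
  by apply: measurable_funM; [exact: measurableT_comp|exact: measurable_indic].
have T1 x y : \1_T (x, y) = \1_(`]-oo, x]%classic : set R) y :> R.
  by rewrite !indicE !mem_setE.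
have T2 x y : \1_T (x, y) = \1_(`[y, +oo[%classic : set R) x :> R.
  by rewrite !indicE !mem_setE !in_itv /= andbT.
have F1 x y : F (x, y) = f x * (g y * \1_(`]-oo, x]%classic : set R) y).
  by rewrite /F T1.
have F2 x y : F (x, y) = g y * (f x * \1_(`[y, +oo[%classic : set R) x).
  by rewrite /F T2 mulrCA.
have Fle z : `|F z| <= `|f z.1| * `|g z.2|.
  rewrite /F !normrM ler_wpM2l// -[leRHS]mulr1 ler_wpM2l// indicE.
  by case: (_ \in _); rewrite ?normr1 ?normr0.
have iF : (mu \x mu)%E.-integrable setT (EFin \o F).
  apply/integrable12ltyP; first exact/measurable_EFinP.
  apply: (@le_lt_trans _ _ (\int[mu]_x ((`|f x|)%:E * \int[mu]_y (`|g y|)%:E))%E).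
    apply: ge0_le_integral => //.
    - by move=> x _; apply: integral_ge0.
    - have mF' : measurable_fun setT (fun z => (`|F z|)%:E).
        by apply/measurable_EFinP; exact: measurableT_comp.
      have H := @measurable_fun_fubini_tonelli_F _ _ _ _ _ mu _ mF' (fun z => normr_ge0 (F z)). exact: H.
    - apply: emeasurable_funM => //.
      by apply/measurable_EFinP; exact: measurableT_comp.
    move=> x _; rewrite -ge0_integralZl//; last first.
      by apply/measurable_EFinP; exact: measurableT_comp.
    apply: ge0_le_integral => //.
    - apply/measurable_EFinP/measurableT_comp => //.
      by apply: measurableT_comp mF _; exact: measurable_pair1.
    - by apply/measurable_EFinP; apply: measurable_funM => //; exact: measurableT_comp.
    by move=> y _; rewrite lee_fin Fle.
  have -> : (\int[mu]_x ((`|f x|)%:E * \int[mu]_y (`|g y|)%:E) =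
     (\int[mu]_x (`|f x|)%:E) * \int[mu]_y (`|g y|)%:E)%E.
    have [gi1 gi2] := integrableP _ _ _ gi.
    have gfin : (\int[mu]_y `|(g y)%:E| \is a fin_num)%E.
      by rewrite ge0_fin_numE// integral_ge0.
    rewrite -(fineK gfin) ge0_integralZr//.
      by apply/measurable_EFinP; exact: measurableT_comp.
    by rewrite lee_fin fine_ge0// integral_ge0.
  have [_ Hf] := integrableP _ _ _ fi.
  have [_ Hg] := integrableP _ _ _ gi.
  rewrite lte_mul_pinfty//; first exact: integral_ge0.
  by rewrite ge0_fin_numE// integral_ge0.
have sl (a : R) (p : R -> R) D : measurable D -> mu.-integrable setT (EFin \o p) ->
    ((a * \int[mu]_(t in D) p t)%:E = \int[mu]_t (a * (p t * \1_D t))%:E)%E.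
  move=> mD ip.
  have ipD : mu.-integrable setT (EFin \o (p \_ D)).
    by apply: integrable_patch => //; exact: integrableS ip.
  rewrite Rintegral_mkcond -RintegralZl// /Rintegral fineK.
    apply: eq_integral => y _; congr EFin; rewrite patchE indicE.
    by case: (_ \in _); rewrite ?mulr1 ?mulr0.
  apply: integrable_fin_num => //.
  exact: (@integrableZl _ _ _ _ _ _ a (EFin \o (p \_ D))).
rewrite /Rintegral; congr fine.
transitivity (\int[mu]_x \int[mu]_y (EFin \o F) (x, y))%E.
  apply: eq_integral => x _; rewrite [LHS]sl//.
rewrite Fubini//.
apply: eq_integral => y _; rewrite [RHS]sl//.
by apply: eq_integral => x _; rewrite -[LHS]/((F (x, y))%:E) F2.
Qed.

Lemma itv_notinP (L x : R) : x \notin `[- L, L]%classic -> L < `|x|.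
Proof. by rewrite mem_setE in_itv /= -ler_norml -ltNge. Qed.

Lemma Rint_left_patch J h (a b x : R) : primitive J h -> a <= x -> x <= b ->
  \int[mu]_(y in `]-oo, x]) (h \_ `[a, b]) y = J x - J a.
Proof.
move=> [_ JE] ax xb; rewrite (JE _ _ ax) -Rintegral_mkcondr; congr Rintegral.
apply/seteqP; split => y; rewrite /= !in_itv /=.
  by move=> [-> /andP[-> _]].
by move=> /andP[-> yx]; rewrite yx (le_trans yx xb).
Qed.

Lemma Rint_right_patch J h (a b x : R) : primitive J h -> a <= x -> x <= b ->
  \int[mu]_(y in `[x, +oo[) (h \_ `[a, b]) y = J b - J x.
Proof.
move=> [_ JE] ax xb; rewrite (JE _ _ xb) -Rintegral_mkcondr; congr Rintegral.
apply/seteqP; split => y; rewrite /= !in_itv /=.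
  by move=> [/andP[-> _] /andP[_ ->]].
by move=> /andP[yx ->]; rewrite yx (le_trans ax yx).
Qed.

Lemma continuous_itv_bounded (f : R -> R) a b : a <= b -> continuous f ->
  exists K, forall x, a <= x -> x <= b -> `|f x| <= K.
Proof.
move=> ab cf.
have cn : {within `[a, b], continuous (fun x => `|f x|)}.
  by apply: continuous_subspaceT => x; exact: (cvg_norm (cf x)).
have [c cI Hc] := EVT_max ab cn.
by exists `|f c| => x ax xb; apply: Hc; rewrite in_itv /= ax.
Qed.

Lemma integrable_itv_mul (c h : R -> R) a b : continuous c ->
  mu.-integrable `[a, b] (EFin \o h) -> mu.-integrable `[a, b] (EFin \o (fun x => c x * h x)).
Proof.
move=> cc ih; have [ab|ba] := leP a b; last first.
  by rewrite set_itv_ge ?bnd_simp -?ltNge//; exact: integrable_set0.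
have [K HK] := continuous_itv_bounded ab cc.
have mI : measurable (`[a, b]%classic : set (measurableTypeR R)) by exact: measurable_itv.
have [/measurable_EFinP mh _] := integrableP _ _ _ ih.
apply: (@dominated_integrable _ (fun x => K * `|h x|) _ mI).
- apply: measurable_funM; last exact: mh.
  by apply: measurable_funTS; exact: continuous_measurable_fun.
- move=> x /=; rewrite in_itv /= => /andP[ax xb].
  by rewrite normrM ler_wpM2r// HK.
- exact: (integrableZl mI K (integrable_norm ih)).
Qed.

(** [J] has no pointwise derivative to put into a product rule, so the increment of [c * J] is
    computed from [triangle_Fubini]. *)
Lemma primitive_mul J h (c c' : R -> R) :
  primitive J h -> continuous c' -> (forall x, is_derive x 1 c (c' x)) ->
  primitive (fun x => c x * J x) (fun x => c' x * J x + c x * h x).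
Proof.
move=> pJ cc' dc.
have cc := is_derive_continuous dc; have cJ := primitive_continuous pJ.
have pc := primitive_derive cc' dc.
have [ih JE] := pJ; have [ic' cE] := pc.
have mI a b : measurable (`[a, b]%classic : set (measurableTypeR R)) by exact: measurable_itv.
have i1 a b : mu.-integrable `[a, b] (EFin \o (fun x => c' x * J x)).
  by apply: continuous_itv_integrable => x; apply: cvgM; [exact: cc'|exact: cJ].
have i2 a b : mu.-integrable `[a, b] (EFin \o (fun x => c x * h x)).
  exact: integrable_itv_mul.
have i12 a b := integrableD (mI a b) (i1 a b) (i2 a b).
split=> [a b|x y xy]; first exact: i12.
have iP p : mu.-integrable `[x, y] (EFin \o p) ->
    mu.-integrable setT (EFin \o (p \_ `[x, y])).
  by move=> ip; apply: integrable_patch; [exact: measurable_itv|].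
(* With both densities cut off to [[x, y]], the inner integrals become the increments [J t - J x]
   and [c y - c t]. *)
have H := triangle_Fubini (iP _ (ic' x y)) (iP _ (ih x y)).
have E1 : \int[mu]_t ((c' \_ `[x, y]) t * \int[mu]_(s in `]-oo, t]) (h \_ `[x, y]) s) =
    \int[mu]_(t in `[x, y]) (c' t * (J t - J x)).
  rewrite [RHS]Rintegral_mkcond; apply: eq_Rintegral => t _.
  rewrite !patchE; case: ifPn => [|_]; last by rewrite mul0r.
  by rewrite mem_setE in_itv /= => /andP[xt ty]; rewrite (Rint_left_patch pJ xt ty).
have E2 : \int[mu]_s ((h \_ `[x, y]) s * \int[mu]_(t in `[s, +oo[) (c' \_ `[x, y]) t) =
    \int[mu]_(t in `[x, y]) (c y * h t - c t * h t).
  rewrite [RHS]Rintegral_mkcond; apply: eq_Rintegral => t _.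
  rewrite !patchE; case: ifPn => [|_]; last by rewrite mul0r.
  rewrite mem_setE in_itv /= => /andP[xt ty]; rewrite (Rint_right_patch pc xt ty).
  by ring.
rewrite E1 E2 in H.
have icy : mu.-integrable `[x, y] (EFin \o (fun t => c y * h t)).
  exact: (integrableZl (mI x y) (c y) (ih x y)).
have icx : mu.-integrable `[x, y] (EFin \o (fun t => c' t * J x)).
  by apply: continuous_itv_integrable => t; apply: cvgM; [exact: cc'|exact: cvg_cst].
rewrite (RintegralB (mI x y) icy (i2 x y)) (RintegralZl _ (mI x y) (ih x y)) in H.
have E3 : \int[mu]_(t in `[x, y]) (c' t * (J t - J x)) =
    \int[mu]_(t in `[x, y]) (c' t * J t) - \int[mu]_(t in `[x, y]) c' t * J x.
  rewrite -(RintegralZr _ (mI x y) (ic' x y)) -(RintegralB (mI x y) (i1 x y) icx).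
  by apply: eq_Rintegral => t _; rewrite mulrBr.
rewrite E3 -(JE _ _ xy) -(cE _ _ xy) in H.
rewrite (RintegralD (mI x y) (i1 x y) (i2 x y)).
move: H; move: (\int[mu]_(t in `[x, y]) (c' t * J t)) => A.
move: (\int[mu]_(t in `[x, y]) (c t * h t)) => B.
move: (c x) (c y) (J x) (J y) => a b d e H.
have -> : A = b * (e - d) - B + (b - a) * d by rewrite -H subrK.
by ring.
Qed.

Lemma primitive_ibp J h (psi psi' : R -> R) (L : R) :
  0 < L -> primitive J h ->
  continuous psi' -> (forall x, is_derive x 1 psi (psi' x)) ->
  (forall x, L <= `|x| -> psi x = 0) ->
  [/\ mu.-integrable setT (EFin \o (fun x => psi' x * J x)),
      mu.-integrable setT (EFin \o (fun x => psi x * h x)) &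
      \int[mu]_x (psi' x * J x) = - \int[mu]_x (psi x * h x)].
Proof.
move=> L0 pJ cpsi' dpsi psi0.
have cpsi := is_derive_continuous dpsi; have cJ := primitive_continuous pJ.
have [_ pE] := primitive_mul pJ cpsi' dpsi; have [ih _] := pJ.
have psi'0 x : L < `|x| -> psi' x = 0.
  move=> Lx; have [_ <-] := dpsi x.
  have H : is_derive x 1 psi 0.
    apply: (@near_eq_is_derive _ _ _ (cst 0)); near=> y; rewrite psi0//.
    near: y; exists (`|x| - L) => /=; first by rewrite subr_gt0.
    move=> y /= xy; have := ler_distD y x 0; rewrite !subr0; lra.
  by have [_ ->] := H.
have mI : measurable (`[- L, L]%classic : set (measurableTypeR R)) by exact: measurable_itv.
have E1 : (fun x => psi' x * J x) = (fun x => psi' x * J x) \_ `[- L, L].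
  apply/funext => x; rewrite patchE; case: ifPn => [//|/itv_notinP Lx].
  by rewrite (psi'0 _ Lx) mul0r.
have E2 : (fun x => psi x * h x) = (fun x => psi x * h x) \_ `[- L, L].
  apply/funext => x; rewrite patchE; case: ifPn => [//|/itv_notinP/ltW Lx].
  by rewrite (psi0 _ Lx) mul0r.
have i1 : mu.-integrable `[- L, L] (EFin \o (fun x => psi' x * J x)).
  by apply: continuous_itv_integrable => x; apply: cvgM; [exact: cpsi'|exact: cJ].
have i2 : mu.-integrable `[- L, L] (EFin \o (fun x => psi x * h x)).
  exact: integrable_itv_mul (ih _ _).
split; first by rewrite E1; exact: (integrable_patch mI i1).
  by rewrite E2; exact: (integrable_patch mI i2).
rewrite E1 E2 -!Rintegral_mkcond; apply/eqP; rewrite -addr_eq0; apply/eqP.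
rewrite -(RintegralD mI i1 i2) -pE; last lra.
by rewrite !psi0 ?mul0r ?subrr// ?normrN; exact: ler_norm.
Unshelve. all: by end_near. Qed.

End Primitive.

(** * Complex numbers through real and imaginary parts, with a real-valued modulus *)

Section ComplexModulus.
Context {R : realType}.
Local Notation C := R[i].
Local Notation Re := complex.Re.
Local Notation Im := complex.Im.
Implicit Types z w : C.

Definition cabs z : R := Normc.normc z.

Lemma ReD z w : Re (z + w) = Re z + Re w. Proof. by case: z; case: w. Qed.
Lemma ImD z w : Im (z + w) = Im z + Im w. Proof. by case: z; case: w. Qed.
Lemma ReN z : Re (- z) = - Re z. Proof. by case: z. Qed.
Lemma ImN z : Im (- z) = - Im z. Proof. by case: z. Qed.
Lemma ReM z w : Re (z * w) = Re z * Re w - Im z * Im w.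
Proof. by case: z; case: w. Qed.
Lemma ImM z w : Im (z * w) = Re z * Im w + Im z * Re w.
Proof. by case: z; case: w. Qed.

Lemma complexP z w : Re z = Re w -> Im z = Im w -> z = w.
Proof. by case: z; case: w => /= a b c d -> ->. Qed.

Lemma cabsE z : cabs z = Num.sqrt (Re z ^+ 2 + Im z ^+ 2).
Proof. by case: z. Qed.
Lemma sqr_cabs z : cabs z ^+ 2 = Re z ^+ 2 + Im z ^+ 2.
Proof. by rewrite cabsE sqr_sqrtr// addr_ge0// sqr_ge0. Qed.
Lemma cabs_ge0 z : 0 <= cabs z. Proof. by rewrite cabsE sqrtr_ge0. Qed.
Lemma cabs0 : cabs 0 = 0. Proof. exact: Normc.normc0. Qed.
Lemma cabs1 : cabs 1 = 1. Proof. exact: Normc.normc1. Qed.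
Lemma cabsM z w : cabs (z * w) = cabs z * cabs w. Proof. exact: Normc.normcM. Qed.
Lemma cabsV z : cabs z^-1 = (cabs z)^-1. Proof. exact: Normc.normcV. Qed.
Lemma cabsD z w : cabs (z + w) <= cabs z + cabs w. Proof. exact: le_normcD. Qed.
Lemma cabsN z : cabs (- z) = cabs z. Proof. exact: normcN. Qed.
Lemma cabsB z w : cabs (z - w) <= cabs z + cabs w.
Proof. by rewrite -(cabsN w) cabsD. Qed.
Lemma cabs_distC z w : cabs (z - w) = cabs (w - z).
Proof. by rewrite -cabsN opprB. Qed.
Lemma cabs_eq0 z : (cabs z == 0) = (z == 0).
Proof.
by apply/eqP/eqP => [/Normc.eq0_normc//|->]; exact: cabs0.
Qed.
Lemma cabs_gt0 z : (0 < cabs z) = (z != 0).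
Proof. by rewrite lt_def cabs_eq0 cabs_ge0 andbT. Qed.
Lemma cabs_real (x : R) : cabs (x%:C)%C = `|x|.
Proof. by rewrite cabsE /= expr0n addr0 sqrtr_sqr. Qed.
Lemma cabs_conj z : cabs (conjc z) = cabs z.
Proof. by rewrite !cabsE; case: z => a b /=; rewrite sqrrN. Qed.
Lemma conjcM_cabs z : conjc z * z = ((cabs z ^+ 2)%:C)%C.
Proof.
by apply: complexP; rewrite ?ReM ?ImM sqr_cabs; case: z => a b /=; ring.
Qed.
Lemma cabsi : cabs (0 +i* 1)%C = 1.
Proof. by rewrite cabsE /= expr0n expr1n add0r sqrtr1. Qed.

Lemma Re_le_cabs z : `|Re z| <= cabs z.
Proof. by rewrite cabsE -sqrtr_sqr ler_wsqrtr// lerDl sqr_ge0. Qed.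
Lemma Im_le_cabs z : `|Im z| <= cabs z.
Proof. by rewrite cabsE -sqrtr_sqr ler_wsqrtr// lerDr sqr_ge0. Qed.
Lemma cabs_le z : cabs z <= `|Re z| + `|Im z|.
Proof.
rewrite -(@ler_pXn2r _ 2)// ?nnegrE ?cabs_ge0 ?addr_ge0//.
rewrite sqr_cabs sqrrD !real_normK ?num_real//.
by rewrite lerD2r lerDl mulrn_wge0 ?mulr_ge0.
Qed.

Lemma cabs_normE z (r : R) : (`|z| <= (r%:C)%C) = (cabs z <= r).
Proof. by rewrite normc_def cabsE lecR. Qed.

End ComplexModulus.
Arguments cabs : simpl never.

(** * Differentiation rules and monotonicity for real functions *)

Section RealDerivatives.
Context {R : realType}.
Implicit Types (f g : R -> R) (x a b : R).

Lemma is_derive_mul f g x a b : is_derive x 1 f a -> is_derive x 1 g b ->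
  is_derive x 1 (fun x => f x * g x) (a * g x + f x * b).
Proof.
move=> df dg; apply: (is_derive_eq (is_deriveM df dg)).
by rewrite /GRing.scale /= addrC [g x * a]mulrC.
Qed.
Lemma is_derive_add f g x a b : is_derive x 1 f a -> is_derive x 1 g b ->
  is_derive x 1 (fun x => f x + g x) (a + b).
Proof. by move=> df dg; exact: (is_deriveD df dg). Qed.
Lemma is_derive_sub f g x a b : is_derive x 1 f a -> is_derive x 1 g b ->
  is_derive x 1 (fun x => f x - g x) (a - b).
Proof. by move=> df dg; exact: (is_deriveB df dg). Qed.
Lemma is_derive_opp f x a : is_derive x 1 f a -> is_derive x 1 (fun x => - f x) (- a).
Proof. by move=> df; exact: (is_deriveN df). Qed.

Lemma is_derive_scale f (c : R) x a : is_derive x 1 f a ->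
  is_derive x 1 (fun x => c * f x) (c * a).
Proof.
move=> df; have dc : is_derive x 1 (fun=> c) 0 by exact: is_derive_cst.
by apply: (is_derive_eq (is_derive_mul dc df)); rewrite mul0r add0r.
Qed.
Lemma is_derive_expR_comp f x a : is_derive x 1 f a ->
  is_derive x 1 (fun x => expR (f x)) (expR (f x) * a).
Proof. by move=> df; exact: (@is_derive1_comp _ expR f x _ _ (is_derive_expR _) df). Qed.

Lemma derive_ge0_le f (f' : R -> R) x y : x <= y -> (forall t : R, is_derive t 1 f (f' t)) ->
  (forall t, x <= t -> t <= y -> 0 <= f' t) -> f x <= f y.
Proof.
move=> xy df f0.
have cf : {within `[x, y], continuous f}.
  by apply: continuous_subspaceT; exact: is_derive_continuous df.
have [c cxy E] := MVT_segment xy (fun t _ => df t) cf.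
rewrite -subr_ge0 E mulr_ge0 ?subr_ge0//.
by move: cxy; rewrite in_itv /= => /andP[]; exact: f0.
Qed.

End RealDerivatives.

(** * Calculus of complex-valued functions of a real variable *)

Section ComplexCalculus.
Context {R : realType}.
Local Notation C := R[i].
Local Notation Re := complex.Re.
Local Notation Im := complex.Im.
Local Notation mu := (@lebesgue_measure R).
Implicit Types (F G : R -> C) (D : set (measurableTypeR R)).

Definition cmeas D F :=
  measurable_fun D (fun x => Re (F x)) /\ measurable_fun D (fun x => Im (F x)).
Definition cintegrable D F :=
  mu.-integrable D (EFin \o (fun x => Re (F x))) /\
  mu.-integrable D (EFin \o (fun x => Im (F x))).
Definition cint D F : C :=
  ((\int[mu]_(x in D) Re (F x)) +i* (\int[mu]_(x in D) Im (F x)))%C.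
Definition ccont F :=
  continuous (fun x => Re (F x)) /\ continuous (fun x => Im (F x)).
Definition cder F G := forall x : R,
  is_derive x 1 (fun x => Re (F x)) (Re (G x)) /\
  is_derive x 1 (fun x => Im (F x)) (Im (G x)).
Definition cprimitive F G :=
  primitive (fun x => Re (F x)) (fun x => Re (G x)) /\
  primitive (fun x => Im (F x)) (fun x => Im (G x)).

Lemma ccont_cst c : ccont (fun=> c).
Proof. by split=> x; exact: cvg_cst. Qed.
Lemma ccontD F G : ccont F -> ccont G -> ccont (fun x => F x + G x).
Proof.
move=> [a b] [c d]; split=> x.
  by under eq_fun do rewrite ReD; apply: cvgD; [exact: a|exact: c].
by under eq_fun do rewrite ImD; apply: cvgD; [exact: b|exact: d].
Qed.
Lemma ccontN F : ccont F -> ccont (fun x => - F x).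
Proof.
move=> [a b]; split=> x.
  by under eq_fun do rewrite ReN; apply: cvgN; exact: a.
by under eq_fun do rewrite ImN; apply: cvgN; exact: b.
Qed.
Lemma ccontB F G : ccont F -> ccont G -> ccont (fun x => F x - G x).
Proof. by move=> cF cG; apply: ccontD => //; exact: ccontN. Qed.
Lemma ccontM F G : ccont F -> ccont G -> ccont (fun x => F x * G x).
Proof.
move=> [a b] [c d]; split=> x.
  under eq_fun do rewrite ReM.
  by apply: cvgB; apply: cvgM; [exact: a|exact: c|exact: b|exact: d].
under eq_fun do rewrite ImM.
by apply: cvgD; apply: cvgM; [exact: a|exact: d|exact: b|exact: c].
Qed.
Lemma ccont_sum (I : finType) (F : I -> R -> C) :
  (forall i, ccont (F i)) -> ccont (fun x => \sum_i F i x).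
Proof.
move=> cF; elim: (index_enum I) => [|i s IH].
  by under eq_fun do rewrite big_nil; exact: ccont_cst.
by under eq_fun do rewrite big_cons; exact: ccontD.
Qed.
Lemma ccont_real (f : R -> R) : continuous f -> ccont (fun x => ((f x)%:C)%C).
Proof. by move=> cf; split=> //= x; exact: cvg_cst. Qed.
Lemma ccont_comp F (f : R -> R) : ccont F -> continuous f -> ccont (F \o f).
Proof.
move=> [a b] cf; split=> x.
  exact: (@continuous_comp _ _ _ f (fun x => Re (F x)) x (cf x) (a (f x))).
exact: (@continuous_comp _ _ _ f (fun x => Im (F x)) x (cf x) (b (f x))).
Qed.
Lemma ccont_cabs F : ccont F -> continuous (fun x => cabs (F x)).
Proof.
move=> [a b] x; under eq_fun do rewrite cabsE.
apply: (@continuous_comp _ _ _ (fun x => Re (F x) ^+ 2 + Im (F x) ^+ 2) Num.sqrt).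
  by apply: cvgD; [exact: (cvgM (a x) (a x))|exact: (cvgM (b x) (b x))].
exact: sqrt_continuous.
Qed.
Lemma ccont_meas D F : measurable D -> ccont F -> cmeas D F.
Proof.
move=> mD [a b]; split; apply: (measurable_funS measurableT) => //;
  exact: continuous_measurable_fun.
Qed.

Lemma cmeasD D F G : cmeas D F -> cmeas D G -> cmeas D (fun x => F x + G x).
Proof.
move=> [a b] [c d]; split.
  by under eq_fun do rewrite ReD; exact: measurable_funD.
by under eq_fun do rewrite ImD; exact: measurable_funD.
Qed.
Lemma cmeasB D F G : cmeas D F -> cmeas D G -> cmeas D (fun x => F x - G x).
Proof.
move=> [a b] [c d]; split.
  by under eq_fun do rewrite ReD ReN; exact: measurable_funB.
by under eq_fun do rewrite ImD ImN; exact: measurable_funB.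
Qed.
Lemma cmeasM D F G : cmeas D F -> cmeas D G -> cmeas D (fun x => F x * G x).
Proof.
move=> [a b] [c d]; split.
  by under eq_fun do rewrite ReM; apply: measurable_funB; exact: measurable_funM.
by under eq_fun do rewrite ImM; apply: measurable_funD; exact: measurable_funM.
Qed.
Lemma cmeas_cst D c : cmeas D (fun=> c).
Proof. by split; exact: measurable_cst. Qed.
Lemma cmeas_sum (I : finType) D (F : I -> R -> C) :
  (forall i, cmeas D (F i)) -> cmeas D (fun x => \sum_i F i x).
Proof.
move=> cF; elim: (index_enum I) => [|i s IH].
  by under eq_fun do rewrite big_nil; exact: cmeas_cst.
by under eq_fun do rewrite big_cons; exact: cmeasD.
Qed.
Lemma cmeas_cabs D F : measurable D -> cmeas D F ->
  measurable_fun D (fun x => cabs (F x)).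
Proof.
move=> mD [a b]; under eq_fun do rewrite cabsE.
apply: measurableT_comp; first exact: (continuous_measurable_fun (@sqrt_continuous R)).
by apply: measurable_funD; exact: measurable_funX.
Qed.

Lemma dominated_cintegrable D F (g : R -> R) : measurable D -> cmeas D F ->
  (forall x, D x -> cabs (F x) <= g x) -> mu.-integrable D (EFin \o g) ->
  cintegrable D F.
Proof.
move=> mD [a b] Fg ig; split; apply: dominated_integrable ig => // x Dx;
  apply: le_trans (Fg x Dx); [exact: Re_le_cabs|exact: Im_le_cabs].
Qed.
Lemma cintegrable_meas D F : cintegrable D F -> cmeas D F.
Proof.
by move=> [/integrableP[/measurable_EFinP a _] /integrableP[/measurable_EFinP b _]].
Qed.
Lemma cintegrable_cabs D F : measurable D -> cintegrable D F ->
  mu.-integrable D (EFin \o (fun x => cabs (F x))).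
Proof.
move=> mD iF; have [a b] := iF.
apply: (@dominated_integrable _ _ (fun x => `|Re (F x)| + `|Im (F x)|)) => //.
- by apply: cmeas_cabs => //; exact: cintegrable_meas.
- by move=> x _; rewrite ger0_norm ?cabs_ge0// cabs_le.
- exact: (integrableD mD (integrable_norm a) (integrable_norm b)).
Qed.

Lemma cintegrableD D F G : measurable D -> cintegrable D F -> cintegrable D G ->
  cintegrable D (fun x => F x + G x).
Proof.
move=> mD [a b] [c d]; split.
  by under eq_fun do rewrite ReD; exact: (integrableD mD a c).
by under eq_fun do rewrite ImD; exact: (integrableD mD b d).
Qed.
Lemma cintegrableZ D c F : measurable D -> cintegrable D F ->
  cintegrable D (fun x => c * F x).
Proof.
move=> mD iF; apply: (@dominated_cintegrable _ _ (fun x => cabs c * cabs (F x))) => //.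
- by apply: cmeasM; [exact: cmeas_cst|exact: cintegrable_meas].
- by move=> x _; rewrite cabsM.
- exact: (integrableZl mD _ (cintegrable_cabs mD iF)).
Qed.
Lemma cintegrable0 D : measurable D -> cintegrable D (fun=> 0).
Proof. by move=> mD; split; exact: integrable0. Qed.
Lemma cintegrable_sum (I : finType) D (F : I -> R -> C) : measurable D ->
  (forall i, cintegrable D (F i)) -> cintegrable D (fun x => \sum_i F i x).
Proof.
move=> mD cF; elim: (index_enum I) => [|i s IH].
  by under eq_fun do rewrite big_nil; exact: cintegrable0.
by under eq_fun do rewrite big_cons; exact: cintegrableD.
Qed.

Lemma eq_cint D F G : (forall x, D x -> F x = G x) -> cint D F = cint D G.
Proof.
by move=> FG; congr Complex; apply: eq_Rintegral => x; rewrite inE => /FG ->.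
Qed.
Lemma cintD D F G : measurable D -> cintegrable D F -> cintegrable D G ->
  cint D (fun x => F x + G x) = cint D F + cint D G.
Proof.
move=> mD [a b] [c d]; apply: complexP; rewrite ?ReD ?ImD /=.
  by under eq_Rintegral do rewrite ReD; exact: (RintegralD mD a c).
by under eq_Rintegral do rewrite ImD; exact: (RintegralD mD b d).
Qed.
Lemma cintZ D c F : measurable D -> cintegrable D F ->
  cint D (fun x => c * F x) = c * cint D F.
Proof.
move=> mD [a b].
have Z (r : R) f : mu.-integrable D (EFin \o f) ->
    mu.-integrable D (EFin \o (fun x => r * f x)).
  by move=> fi; exact: (integrableZl mD r fi).
apply: complexP; rewrite ?ReM ?ImM /=.
  under eq_Rintegral do rewrite ReM.
  by rewrite (RintegralB mD (Z _ _ a) (Z _ _ b)) !RintegralZl.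
under eq_Rintegral do rewrite ImM.
by rewrite (RintegralD mD (Z _ _ b) (Z _ _ a)) !RintegralZl.
Qed.
Lemma cintN D F : measurable D -> cintegrable D F ->
  cint D (fun x => - F x) = - cint D F.
Proof.
move=> mD iF; rewrite -mulN1r -cintZ//.
by apply: eq_cint => x _; rewrite mulN1r.
Qed.
Lemma cint0 D : cint D (fun=> 0) = 0.
Proof. by rewrite /cint /= /Rintegral integral0. Qed.
Lemma cint_sum (I : finType) D (F : I -> R -> C) : measurable D ->
  (forall i, cintegrable D (F i)) ->
  cint D (fun x => \sum_i F i x) = \sum_i cint D (F i).
Proof.
move=> mD iF; suff [] : cintegrable D (fun x => \sum_i F i x) /\
    cint D (fun x => \sum_i F i x) = \sum_i cint D (F i) by [].
elim: (index_enum I) => [|i s [IH1 IH2]].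
  under eq_fun do rewrite big_nil; rewrite big_nil cint0; split=> //.
  exact: cintegrable0.
under eq_fun do rewrite big_cons; rewrite big_cons; split.
  exact: cintegrableD.
by rewrite cintD// IH2.
Qed.

Lemma cabs_cint_le D F : measurable D -> cintegrable D F ->
  cabs (cint D F) <= \int[mu]_(x in D) cabs (F x).
Proof.
move=> mD iF; have [I0|I0] := eqVneq (cint D F) 0.
  by rewrite I0 cabs0 Rintegral_ge0// => x _; exact: cabs_ge0.
(* The unit factor that rotates the integral onto the positive real axis, where its modulus is its
   real part and monotonicity of the real integral applies. *)
pose u := conjc (cint D F) / ((cabs (cint D F))%:C)%C.
have cI0 : cabs (cint D F) != 0 by rewrite cabs_eq0.
have u1 : cabs u = 1.
  by rewrite /u cabsM cabsV cabs_conj cabs_real ger0_norm ?cabs_ge0// divff.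
have E : cabs (cint D F) = Re (u * cint D F).
  by rewrite /u mulrAC conjcM_cabs -fmorphV -rmorphM expr2 mulfK.
have iuF := cintegrableZ u mD iF.
rewrite E -cintZ//= le_Rintegral//; first by case: iuF.
  exact: cintegrable_cabs.
move=> x _; rewrite (le_trans (ler_norm _))// (le_trans (Re_le_cabs _))//.
by rewrite cabsM u1 mul1r.
Qed.

Lemma cder_cont F G : cder F G -> ccont F.
Proof.
move=> dF; split.
  by apply: (@is_derive_continuous _ _ (fun x => Re (G x))) => x; have [] := dF x.
by apply: (@is_derive_continuous _ _ (fun x => Im (G x))) => x; have [] := dF x.
Qed.
Lemma cder_primitive F G : ccont G -> cder F G -> cprimitive F G.
Proof. by move=> [a b] dF; split; apply: primitive_derive => // x; have [] := dF x. Qed.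
Lemma cprimitive_cder F G : ccont G -> cprimitive F G -> cder F G.
Proof.
by move=> [a b] [pF1 pF2] x; split;
  [exact: primitive_is_derive pF1 (a x)|exact: primitive_is_derive pF2 (b x)].
Qed.
Lemma cprimitive_cont F G : cprimitive F G -> ccont F.
Proof. by move=> [a b]; split; [exact: primitive_continuous a|exact: primitive_continuous b]. Qed.

Lemma eq_cder F G G' : (forall x, G x = G' x) -> cder F G -> cder F G'.
Proof. by move=> /funext ->. Qed.
Lemma cder_cst c : cder (fun=> c) (fun=> 0).
Proof. by move=> x; split; exact: is_derive_cst. Qed.
Lemma cderD F F' G G' : cder F F' -> cder G G' ->
  cder (fun x => F x + G x) (fun x => F' x + G' x).
Proof.
move=> dF dG x; have [a b] := dF x; have [c d] := dG x; rewrite ReD ImD.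
by split; [under eq_fun do rewrite ReD|under eq_fun do rewrite ImD]; exact: is_deriveD.
Qed.
Lemma cderN F F' : cder F F' -> cder (fun x => - F x) (fun x => - F' x).
Proof.
move=> dF x; have [a b] := dF x; rewrite ReN ImN.
by split; [under eq_fun do rewrite ReN|under eq_fun do rewrite ImN]; exact: is_deriveN.
Qed.
Lemma cderB F F' G G' : cder F F' -> cder G G' ->
  cder (fun x => F x - G x) (fun x => F' x - G' x).
Proof. by move=> dF dG; apply: cderD => //; exact: cderN. Qed.
Lemma cderM F F' G G' : cder F F' -> cder G G' ->
  cder (fun x => F x * G x) (fun x => F' x * G x + F x * G' x).
Proof.
move=> dF dG x; have [a b] := dF x; have [c d] := dG x; split.
  under eq_fun do rewrite ReM.
  apply: (is_derive_eq (is_derive_sub (is_derive_mul a c) (is_derive_mul b d))).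
  by rewrite ReD !ReM; ring.
under eq_fun do rewrite ImM.
apply: (is_derive_eq (is_derive_add (is_derive_mul a d) (is_derive_mul b c))).
by rewrite ImD !ImM; ring.
Qed.
Lemma cderZ c F F' : cder F F' -> cder (fun x => c * F x) (fun x => c * F' x).
Proof.
move=> dF; apply: eq_cder (cderM (cder_cst c) dF) => x.
by rewrite mul0r add0r.
Qed.
Lemma cder_sum (I : finType) (F F' : I -> R -> C) : (forall i, cder (F i) (F' i)) ->
  cder (fun x => \sum_i F i x) (fun x => \sum_i F' i x).
Proof.
move=> dF; elim: (index_enum I) => [|i s IH].
  under eq_fun do rewrite big_nil.
  by apply: eq_cder (cder_cst 0) => x; rewrite big_nil.
under eq_fun do rewrite big_cons.
by apply: eq_cder (cderD (dF i) IH) => x; rewrite big_cons.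
Qed.
Lemma cder_opp F F' : cder F F' -> cder (fun x => F (- x)) (fun x => - F' (- x)).
Proof.
move=> dF x; have [a b] := dF (- x); rewrite ReN ImN.
have dN : is_derive x 1 (fun x : R => - x) (-1) by apply: is_deriveNid.
split.
- apply: (is_derive_eq (@is_derive1_comp _ (fun x => Re (F x)) (fun x => - x) _ _ _ a dN)).
  by rewrite mulrN1.
- apply: (is_derive_eq (@is_derive1_comp _ (fun x => Im (F x)) (fun x => - x) _ _ _ b dN)).
  by rewrite mulrN1.
Qed.

Lemma cprimitive_cst c : cprimitive (fun=> c) (fun=> 0).
Proof. by apply: cder_primitive; [exact: ccont_cst|exact: cder_cst]. Qed.
Lemma cprimitiveD F F' G G' : cprimitive F F' -> cprimitive G G' ->
  cprimitive (fun x => F x + G x) (fun x => F' x + G' x).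
Proof.
move=> [a b] [c d]; split.
  by under eq_fun do rewrite ReD; under [X in primitive _ X]eq_fun do rewrite ReD;
    exact: primitiveD.
by under eq_fun do rewrite ImD; under [X in primitive _ X]eq_fun do rewrite ImD;
  exact: primitiveD.
Qed.
Lemma cprimitiveM F F' G G' : ccont F' -> cder F F' -> cprimitive G G' ->
  cprimitive (fun x => F x * G x) (fun x => F' x * G x + F x * G' x).
Proof.
move=> [c1 c2] dF [p1 p2].
have d1 x := (dF x).1; have d2 x := (dF x).2.
have P11 := primitive_mul p1 c1 d1; have P22 := primitive_mul p2 c2 d2.
have P12 := primitive_mul p2 c1 d1; have P21 := primitive_mul p1 c2 d2.
split.
  have := primitiveD P11 (primitiveN P22); congr primitive; apply/funext => x.
    by rewrite ReM.
  by rewrite ReD !ReM; ring.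
have := primitiveD P12 P21; congr primitive; apply/funext => x.
  by rewrite ImM.
by rewrite ImD !ImM; ring.
Qed.
Lemma cprimitive_sum (I : finType) (F F' : I -> R -> C) :
  (forall i, cprimitive (F i) (F' i)) ->
  cprimitive (fun x => \sum_i F i x) (fun x => \sum_i F' i x).
Proof.
move=> pF; elim: (index_enum I) => [|i s IH].
  by have := cprimitive_cst 0; congr cprimitive; apply/funext => x; rewrite big_nil.
by have := cprimitiveD (pF i) IH; congr cprimitive; apply/funext => x; rewrite big_cons.
Qed.
Lemma cprimitive_right F : (forall a, cintegrable `[a, +oo[ F) ->
  cprimitive (fun x => - cint `[x, +oo[ F) F.
Proof. by move=> iF; split; apply: primitive_right => a; case: (iF a). Qed.
Lemma cprimitive_left F : (forall b, cintegrable `]-oo, b] F) ->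
  cprimitive (fun x => cint `]-oo, x] F) F.
Proof. by move=> iF; split; apply: primitive_left => a; case: (iF a). Qed.

Lemma cabs_primitive_le F G (g : R -> R) x y : x <= y -> cprimitive F G ->
  continuous g -> (forall t, x <= t -> t <= y -> cabs (G t) <= g t) ->
  cabs (F y - F x) <= \int[mu]_(t in `[x, y]) g t.
Proof.
move=> xy [[i1 E1] [i2 E2]] cg Gg.
have -> : F y - F x = cint `[x, y] G.
  by apply: complexP; rewrite ?ReD ?ReN ?ImD ?ImN /= ?E1 ?E2.
have iG : cintegrable `[x, y] G by split; [exact: i1|exact: i2].
apply: le_trans (cabs_cint_le _ iG) _; first exact: measurable_itv.
apply: le_Rintegral; first exact: measurable_itv.
- by apply: cintegrable_cabs => //; exact: measurable_itv.
- exact: continuous_itv_integrable.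
- by move=> t /=; rewrite in_itv /= => /andP[]; exact: Gg.
Qed.

End ComplexCalculus.

(** * Matrix-valued functions and their integrals *)

Section MatrixCalculus.
Context {R : realType}.
Local Notation C := R[i].
Local Notation mu := (@lebesgue_measure R).

(** The entrywise l^1 norm: submultiplicative, exactly multiplicative on a column times a row
    ([mnorm_outer]), and a sum over entries, so that integral inequalities reduce to scalar ones.
    Against the Euclidean norm of a spinor it loses a factor of at most 2. *)
Definition mnorm p q (A : 'M[C]_(p, q)) : R := \sum_i \sum_j cabs (A i j).

Lemma mnorm_ge0 p q (A : 'M[C]_(p, q)) : 0 <= mnorm A.
Proof. by apply: sumr_ge0 => i _; apply: sumr_ge0 => j _; exact: cabs_ge0. Qed.
Lemma mnormD p q (A B : 'M[C]_(p, q)) : mnorm (A + B) <= mnorm A + mnorm B.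
Proof.
rewrite /mnorm -big_split ler_sum//= => i _; rewrite -big_split ler_sum//= => j _.
by rewrite mxE cabsD.
Qed.
Lemma mnormN p q (A : 'M[C]_(p, q)) : mnorm (- A) = mnorm A.
Proof. by apply: eq_bigr => i _; apply: eq_bigr => j _; rewrite mxE cabsN. Qed.
Lemma mnormB p q (A B : 'M[C]_(p, q)) : mnorm (A - B) <= mnorm A + mnorm B.
Proof. by rewrite -(mnormN B) mnormD. Qed.
Lemma mnormZ p q a (A : 'M[C]_(p, q)) : mnorm (a *: A) = cabs a * mnorm A.
Proof.
rewrite /mnorm mulr_sumr; apply: eq_bigr => i _.
by rewrite mulr_sumr; apply: eq_bigr => j _; rewrite mxE cabsM.
Qed.
Lemma mnorm0 p q : mnorm (0 : 'M[C]_(p, q)) = 0.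
Proof. by rewrite /mnorm big1// => i _; rewrite big1// => j _; rewrite mxE cabs0. Qed.
Lemma cabs_le_mnorm p q (A : 'M[C]_(p, q)) i j : cabs (A i j) <= mnorm A.
Proof.
rewrite /mnorm (bigD1 i)//= (bigD1 j)//= -addrA lerDl addr_ge0//.
  by apply: sumr_ge0 => k _; exact: cabs_ge0.
by apply: sumr_ge0 => k _; apply: sumr_ge0 => l _; exact: cabs_ge0.
Qed.
Lemma mnorm_eq0 p q (A : 'M[C]_(p, q)) : mnorm A = 0 -> A = 0.
Proof.
move=> A0; apply/matrixP => i j; rewrite mxE; apply/eqP.
by rewrite -cabs_eq0 eq_le cabs_ge0 andbT -A0 cabs_le_mnorm.
Qed.
Lemma cabs_sum (I : finType) (F : I -> C) : cabs (\sum_i F i) <= \sum_i cabs (F i).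
Proof.
elim: (index_enum I) => [|i s IH]; first by rewrite !big_nil cabs0.
by rewrite !big_cons (le_trans (cabsD _ _))// lerD2l.
Qed.
Lemma mnormM p q r (A : 'M[C]_(p, q)) (B : 'M[C]_(q, r)) :
  mnorm (A *m B) <= mnorm A * mnorm B.
Proof.
rewrite /mnorm mulr_suml ler_sum// => i _.
apply: (@le_trans _ _ (\sum_k \sum_j cabs (A i j) * cabs (B j k))).
  by apply: ler_sum => k _; rewrite mxE (le_trans (cabs_sum _))// ler_sum// => j _; rewrite cabsM.
rewrite exchange_big mulr_suml ler_sum//= => j _; rewrite -mulr_sumr.
rewrite ler_wpM2l ?cabs_ge0// [leRHS](bigD1 j)//= lerDl.
by apply: sumr_ge0 => l _; apply: sumr_ge0 => k _; exact: cabs_ge0.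
Qed.

Lemma continuous_sumr (I : finType) (f : I -> R -> R) :
  (forall i, continuous (f i)) -> continuous (fun x => \sum_i f i x).
Proof.
move=> cf; elim: (index_enum I) => [|i s IH] x.
  by under eq_fun do rewrite big_nil; exact: cvg_cst.
by under eq_fun do rewrite big_cons; apply: cvgD; [exact: cf|exact: IH].
Qed.

Section Families.
Variables p q : nat.
Implicit Types (F G : R -> 'M[C]_(p, q)) (D : set (measurableTypeR R)).

Definition mcont F := forall i j, ccont (fun x => F x i j).
Definition mder F G := forall i j, cder (fun x => F x i j) (fun x => G x i j).
Definition mprimitive F G :=
  forall i j, cprimitive (fun x => F x i j) (fun x => G x i j).
Definition mmeas D F := forall i j, cmeas D (fun x => F x i j).
Definition mintegrable D F := forall i j, cintegrable D (fun x => F x i j).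
Definition mint D F : 'M[C]_(p, q) := \matrix_(i, j) cint D (fun x => F x i j).

Lemma mcont_cst A : mcont (fun=> A).
Proof. by move=> i j; exact: ccont_cst. Qed.
Lemma mcontB F G : mcont F -> mcont G -> mcont (fun x => F x - G x).
Proof. by move=> cF cG i j; under eq_fun do rewrite !mxE; exact: ccontB. Qed.
Lemma mcontZ (a : R -> C) F : ccont a -> mcont F -> mcont (fun x => a x *: F x).
Proof. by move=> ca cF i j; under eq_fun do rewrite mxE; exact: ccontM. Qed.
Lemma mcont_comp F (f : R -> R) : mcont F -> continuous f -> mcont (F \o f).
Proof. by move=> cF cf i j; exact: (ccont_comp (cF i j) cf). Qed.
Lemma mcont_mnorm F : mcont F -> continuous (fun x => mnorm (F x)).
Proof.
by move=> cF; apply: continuous_sumr => i; apply: continuous_sumr => j; exact: ccont_cabs.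
Qed.
Lemma mcont_meas D F : measurable D -> mcont F -> mmeas D F.
Proof. by move=> mD cF i j; exact: ccont_meas. Qed.

Lemma mmeasD D F G : mmeas D F -> mmeas D G -> mmeas D (fun x => F x + G x).
Proof. by move=> mF mG i j; under eq_fun do rewrite !mxE; exact: cmeasD. Qed.
Lemma mmeasB D F G : mmeas D F -> mmeas D G -> mmeas D (fun x => F x - G x).
Proof. by move=> mF mG i j; under eq_fun do rewrite !mxE; exact: cmeasB. Qed.
Lemma mmeas_mnorm D F : measurable D -> mmeas D F ->
  measurable_fun D (fun x => mnorm (F x)).
Proof.
move=> mD mF; apply: measurable_sum => i; apply: measurable_sum => j.
exact: cmeas_cabs.
Qed.

Lemma dominated_mintegrable D F (g : R -> R) : measurable D -> mmeas D F ->
  (forall x, D x -> mnorm (F x) <= g x) -> mu.-integrable D (EFin \o g) ->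
  mintegrable D F.
Proof.
move=> mD mF Fg ig i j; apply: dominated_cintegrable ig => // x Dx.
exact: le_trans (cabs_le_mnorm _ _ _) (Fg x Dx).
Qed.

Lemma mintD D F G : measurable D -> mintegrable D F -> mintegrable D G ->
  mint D (fun x => F x + G x) = mint D F + mint D G.
Proof.
move=> mD iF iG; apply/matrixP => i j; rewrite !mxE.
by rewrite -(cintD mD (iF i j) (iG i j)); apply: eq_cint => x _; rewrite mxE.
Qed.
Lemma mintB D F G : measurable D -> mintegrable D F -> mintegrable D G ->
  mint D (fun x => F x - G x) = mint D F - mint D G.
Proof.
move=> mD iF iG; apply/matrixP => i j; rewrite !mxE -(cintN mD (iG i j)) -cintD//.
  by apply: eq_cint => x _; rewrite !mxE.
have := cintegrableZ (-1) mD (iG i j); congr cintegrable.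
by apply/funext => x; rewrite mulN1r.
Qed.
Lemma eq_mint D F G : (forall x, D x -> F x = G x) -> mint D F = mint D G.
Proof. by move=> FG; apply/matrixP => i j; rewrite !mxE; apply: eq_cint => x /FG ->. Qed.

Lemma mintegrable_mnorm D F : measurable D -> mintegrable D F ->
  mu.-integrable D (EFin \o (fun x => mnorm (F x))).
Proof.
move=> mD iF.
have S (I : finType) (f : I -> R -> R) :
    (forall i, mu.-integrable D (EFin \o f i)) ->
    mu.-integrable D (EFin \o (fun x => \sum_i f i x)).
  move=> fi; rewrite (_ : EFin \o _ = fun x => (\sum_i (EFin \o f i) x)%E).
    exact: integrable_sum.
  by apply/funext => x /=; rewrite sumEFin.
by apply: (S) => i; apply: (S) => j; exact: cintegrable_cabs.
Qed.

Lemma mnorm_mint_le D F : measurable D -> mintegrable D F ->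
  mnorm (mint D F) <= \int[mu]_(x in D) mnorm (F x).
Proof.
move=> mD iF.
have ic i j := cintegrable_cabs mD (iF i j).
have S (I : finType) (f : I -> R -> R) :
    (forall i, mu.-integrable D (EFin \o f i)) ->
    mu.-integrable D (EFin \o (fun x => \sum_i f i x)) /\
    \int[mu]_(x in D) (\sum_i f i x) = \sum_i \int[mu]_(x in D) f i x.
  move=> fi; elim: (index_enum I) => [|i s [IH1 IH2]].
    under eq_fun do rewrite big_nil; split; first exact: integrable0.
    by rewrite big_nil /Rintegral integral0.
  under eq_fun do rewrite big_cons; split; first exact: (integrableD mD (fi i) IH1).
  by rewrite big_cons (RintegralD mD (fi i) IH1) IH2.
have S1 i := S _ _ (ic i).
have [_ ->] := S _ _ (fun i => (S1 i).1).
apply: ler_sum => i _; have [_ ->] := S1 i.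
by apply: ler_sum => j _; rewrite mxE; exact: cabs_cint_le.
Qed.

Lemma mder_cont F G : mder F G -> mcont F.
Proof. by move=> dF i j; exact: cder_cont (dF i j). Qed.
Lemma eq_mder F G G' : (forall x, G x = G' x) -> mder F G -> mder F G'.
Proof. by move=> /funext ->. Qed.
Lemma mder_cst A : mder (fun=> A) (fun=> 0).
Proof. by move=> i j; apply: eq_cder (cder_cst _) => x; rewrite mxE. Qed.
Lemma mderD F F' G G' : mder F F' -> mder G G' ->
  mder (fun x => F x + G x) (fun x => F' x + G' x).
Proof.
move=> dF dG i j; under eq_fun do rewrite mxE.
by apply: eq_cder (cderD (dF i j) (dG i j)) => x; rewrite mxE.
Qed.
Lemma mderN F F' : mder F F' -> mder (fun x => - F x) (fun x => - F' x).
Proof.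
move=> dF i j; under eq_fun do rewrite mxE.
by apply: eq_cder (cderN (dF i j)) => x; rewrite mxE.
Qed.
Lemma mderB F F' G G' : mder F F' -> mder G G' ->
  mder (fun x => F x - G x) (fun x => F' x - G' x).
Proof. by move=> dF dG; exact: mderD dF (mderN dG). Qed.
Lemma mderZ (a a' : R -> C) F F' : cder a a' -> mder F F' ->
  mder (fun x => a x *: F x) (fun x => a' x *: F x + a x *: F' x).
Proof.
move=> da dF i j; under eq_fun do rewrite mxE.
by apply: eq_cder (cderM da (dF i j)) => x; rewrite !mxE.
Qed.
Lemma mder_opp F F' : mder F F' -> mder (fun x => F (- x)) (fun x => - F' (- x)).
Proof. by move=> dF i j; apply: eq_cder (cder_opp (dF i j)) => x; rewrite mxE. Qed.
Lemma mprimitive_mder F G : mcont G -> mprimitive F G -> mder F G.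
Proof. by move=> cG pF i j; exact: cprimitive_cder. Qed.
Lemma mder_mprimitive F G : mcont G -> mder F G -> mprimitive F G.
Proof. by move=> cG pF i j; exact: cder_primitive. Qed.
Lemma mprimitive_cont F G : mprimitive F G -> mcont F.
Proof. by move=> pF i j; exact: cprimitive_cont (pF i j). Qed.
Lemma mprimitiveD F F' G G' : mprimitive F F' -> mprimitive G G' ->
  mprimitive (fun x => F x + G x) (fun x => F' x + G' x).
Proof.
move=> pF pG i j; have := cprimitiveD (pF i j) (pG i j).
by congr cprimitive; apply/funext => x; rewrite mxE.
Qed.
Lemma mprimitive_right F : (forall a, mintegrable `[a, +oo[ F) ->
  mprimitive (fun x => - mint `[x, +oo[ F) F.
Proof.
move=> iF i j; under [X in cprimitive X]eq_fun do rewrite !mxE.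
exact: (cprimitive_right (fun a => iF a i j)).
Qed.
Lemma mprimitive_left F : (forall a, mintegrable `]-oo, a] F) ->
  mprimitive (fun x => mint `]-oo, x] F) F.
Proof.
move=> iF i j; under [X in cprimitive X]eq_fun do rewrite !mxE.
exact: (cprimitive_left (fun a => iF a i j)).
Qed.

End Families.

Section Products.
Variables p q r : nat.
Implicit Types (F : R -> 'M[C]_(p, q)) (G : R -> 'M[C]_(q, r)).

Lemma mcontM F G : mcont F -> mcont G -> mcont (fun x => F x *m G x).
Proof.
move=> cF cG i j; under eq_fun do rewrite mxE.
by apply: ccont_sum => k; apply: ccontM.
Qed.
Lemma mmeasM D F G : mmeas D F -> mmeas D G -> mmeas D (fun x => F x *m G x).
Proof.
move=> cF cG i j; under eq_fun do rewrite mxE.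
by apply: cmeas_sum => k; apply: cmeasM.
Qed.
Lemma mderM F F' G G' : mder F F' -> mder G G' ->
  mder (fun x => F x *m G x) (fun x => F' x *m G x + F x *m G' x).
Proof.
move=> dF dG i j; under eq_fun do rewrite mxE.
apply: eq_cder (cder_sum (fun k => cderM (dF i k) (dG k j))) => x.
by rewrite !mxE big_split.
Qed.
Lemma mprimitiveM F F' G G' : mcont F' -> mder F F' -> mprimitive G G' ->
  mprimitive (fun x => F x *m G x) (fun x => F' x *m G x + F x *m G' x).
Proof.
move=> cF dF pG i j.
have := cprimitive_sum (fun k => cprimitiveM (cF i k) (dF i k) (pG k j)).
by congr cprimitive; apply/funext => x; rewrite !mxE// big_split.
Qed.
Lemma mintegrable_mulmx D A G : measurable D -> mintegrable D G ->
  mintegrable D (fun x => (A : 'M[C]_(p, q)) *m G x).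
Proof.
move=> mD iG i j; under eq_fun do rewrite mxE.
by apply: cintegrable_sum => // k; exact: cintegrableZ.
Qed.
Lemma mint_mulmx D A G : measurable D -> mintegrable D G ->
  mint D (fun x => (A : 'M[C]_(p, q)) *m G x) = A *m mint D G.
Proof.
move=> mD iG; apply/matrixP => i j; rewrite !mxE.
under eq_cint do rewrite mxE.
rewrite cint_sum//; last by move=> k; exact: cintegrableZ.
by apply: eq_bigr => k _; rewrite mxE cintZ.
Qed.

End Products.

End MatrixCalculus.

(** * Gronwall estimates on right half-lines *)

Section Gronwall.
Context {R : realType}.
Local Notation mu := (@lebesgue_measure R).
Implicit Types (q h : R -> R) (a b c x y : R).

Lemma cvg_geometric0 c : (fun n => c * (2^-1) ^+ n) @ \oo --> (0 : R).
Proof.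
rewrite -[X in _ --> X](mulr0 c); apply: cvgM; first exact: cvg_cst.
by apply: cvg_expr; rewrite ger0_norm; lra.
Qed.

Lemma geometric_le a b c : (forall n : nat, a <= b + c * (2^-1) ^+ n) -> a <= b.
Proof.
move=> H; have cv : (fun n => b + c * (2^-1) ^+ n) @ \oo --> b.
  rewrite -[X in _ --> X]addr0; apply: cvgD; first exact: cvg_cst.
  exact: cvg_geometric0.
rewrite -(cvg_lim (@Rhausdorff R) cv).
by apply: limr_ge; [apply/cvg_ex; exists b|apply: nearW].
Qed.

(** The limit comes with its rate, so that the Picard iteration can be carried out pointwise,
    without completeness of a function space. *)
Lemma geometric_cauchy (u : nat -> R) c :
  (forall n, `|u n.+1 - u n| <= c * (2^-1) ^+ n) ->
  exists l, forall n, `|l - u n| <= 2 * c * (2^-1) ^+ n.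
Proof.
move=> H.
have c0 : 0 <= c by have := le_trans (normr_ge0 _) (H 0%N); rewrite expr0 mulr1.
(* The subtracted term is the exact tail of the geometric series, which makes the induction on [k]
   close. *)
have Hk n k : `|u (n + k)%N - u n| <= 2 * c * (2^-1) ^+ n - 2 * c * (2^-1) ^+ (n + k).
  elim: k => [|k IH]; first by rewrite addn0 !subrr normr0.
  rewrite addnS -(subrK (u (n + k)%N) (u _)) -addrA (le_trans (ler_normD _ _))//.
  apply: le_trans (lerD (H _) IH) _.
  by rewrite exprS; set e := (2^-1) ^+ (n + k); lra.
have e0 n : 0 <= (2^-1) ^+ n :> R by rewrite exprn_ge0//; lra.
have Hn n k : `|u (n + k)%N - u n| <= 2 * c * (2^-1) ^+ n.
  by apply: le_trans (Hk n k) _; rewrite gerBl mulr_ge0// mulr_ge0.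
(* Every lower barrier u_k - 2 c 2^-k lies below every upper barrier u_n + 2 c 2^-n; the supremum of
   the lower ones is the limit. *)
pose S := range (fun n => u n - 2 * c * (2^-1) ^+ n).
have SU n k : u k - 2 * c * (2^-1) ^+ k <= u n + 2 * c * (2^-1) ^+ n.
  have [nk|/ltnW kn] := leqP n k.
    have := Hn n (k - n)%N; rewrite subnKC// ler_norml => /andP[_ ?].
    have : 0 <= 2 * c * (2^-1) ^+ k by rewrite mulr_ge0// mulr_ge0.
    lra.
  have := Hn k (n - k)%N; rewrite subnKC// ler_norml => /andP[? _].
  have : 0 <= 2 * c * (2^-1) ^+ n by rewrite mulr_ge0// mulr_ge0.
  lra.
have hS : has_sup S.
  split; first by exists (u 0%N - 2 * c * (2^-1) ^+ 0), 0%N.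
  by exists (u 0%N + 2 * c * (2^-1) ^+ 0) => _ [k _ <-].
exists (sup S) => n; rewrite ler_distl; apply/andP; split.
  by apply: sup_upper_bound => //; exists n.
by apply: sup_le_ub; [case: hS|move=> _ [k _ <-]].
Qed.

Lemma tail_lt h (e : R) : mu.-integrable setT (EFin \o h) -> (forall x, 0 <= h x) ->
  0 < e -> exists M, forall x, M <= x -> \int[mu]_(y in `[x, +oo[) h y < e.
Proof.
move=> ih h0 e0.
have [/measurable_EFinP mh _] := integrableP _ _ _ ih.
pose f n := EFin \o (h \_ `[n%:R, +oo[).
have mf n : measurable_fun setT (f n).
  apply/measurable_EFinP/(measurable_restrictT _ _).1; first exact: measurable_itv.
  exact: measurable_funTS.
have cvf : \forall x \ae mu, setT x -> f ^~ x @ \oo --> (cst 0 : R -> \bar R) x.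
  apply: aeW => x _ /=; apply: cvg_near_cst; near=> n.
  rewrite /f /= patchE; case: ifPn => //; rewrite mem_setE in_itv /= andbT => nx.
  have : x < n%:R by near: n; exact: nbhs_infty_gtr.
  by rewrite ltNge nx.
have bf : \forall x \ae mu, forall n, setT x -> (`|f n x| <= (EFin \o h) x)%E.
  apply: aeW => x n _; rewrite /f /= patchE; case: ifPn => _.
    by rewrite ger0_norm.
  by rewrite normr0 lee_fin.
have mc : measurable_fun setT (cst 0 : measurableTypeR R -> \bar R) by exact: measurable_cst.
have [_ _ cv] := @dominated_convergence _ _ _ mu setT measurableT f (cst 0) (EFin \o h)
  mf mc cvf ih bf.
rewrite integral0 in cv.
have e0' : (0 < e%:E)%E by rewrite lte_fin.
have [n _ Hn] := cv _ (open_ereal_lt' e0').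
exists n%:R => x nx.
have := Hn n (leqnn n); rewrite /= /f => Hlt.
have ihx : mu.-integrable `[x, +oo[ (EFin \o h).
  by apply: integrableS ih => //; exact: measurable_itv.
rewrite -lte_fin /Rintegral fineK; last first.
  by apply: integrable_fin_num ihx; exact: measurable_itv.
apply: le_lt_trans Hlt.
have -> : (\int[mu]_x0 (EFin \o (h \_ `[n%:R, +oo[)) x0 =
   \int[mu]_(y in `[n%:R, +oo[) (h y)%:E)%E.
  rewrite [RHS]integral_mkcond; apply: eq_integral => y _.
  by rewrite restrict_EFin.
apply: ge0_subset_integral => //; try exact: measurable_itv.
- by apply/measurable_EFinP; exact: measurable_funTS.
- by move=> y _; rewrite lee_fin.
- by apply: subset_itvr; rewrite bnd_simp.
Unshelve. all: by end_near. Qed.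

Variable q : R -> R.
Hypotheses (cq : continuous q) (q0 : forall x, 0 <= q x)
  (iq : mu.-integrable setT (EFin \o q)).

(** An integrating factor Z with Z' = - 2 q Z, so that the integral of q Z over [x, +oo[ is at most
    Z(x)/2. Measured against Z, a Volterra operator with kernel bounded by q is a contraction with
    factor 1/2, however large q is; the 2 in the exponent is what yields that factor. *)
Definition gweight x := expR (2 * \int[mu]_(y in `[x, +oo[) q y).

Let tailq a : mu.-integrable `[a, +oo[ (EFin \o q).
Proof. by apply: integrableS iq => //; exact: measurable_itv. Qed.

Let Q0 x : 0 <= \int[mu]_(y in `[x, +oo[) q y.
Proof. by apply: Rintegral_ge0. Qed.

Lemma Rintegral_ray_le x : \int[mu]_(y in `[x, +oo[) q y <= \int[mu]_y q y.
Proof.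
rewrite /Rintegral fine_le//.
- by apply: integrable_fin_num (tailq x); exact: measurable_itv.
- by apply: integrable_fin_num iq.
- apply: ge0_subset_integral => //; try exact: measurable_itv.
    by case/integrableP: iq.
  by move=> y _; rewrite lee_fin.
Qed.

Lemma gweight_ge1 x : 1 <= gweight x.
Proof. by rewrite /gweight -expR0 ler_expR mulr_ge0. Qed.

Lemma gweight_le x : gweight x <= expR (2 * \int[mu]_y q y).
Proof. by rewrite ler_expR ler_wpM2l// Rintegral_ray_le. Qed.

Let dZ x : is_derive x 1 gweight (- (2 * q x) * gweight x).
Proof.
have dQ : is_derive x 1 (fun x => - \int[mu]_(y in `[x, +oo[) q y) (q x).
  have H := primitive_is_derive (primitive_right tailq) (@cq x).
  exact: H.
have d2 : is_derive x 1 (fun x => 2 * \int[mu]_(y in `[x, +oo[) q y) (- (2 * q x)).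
  have := is_derive_scale (-2) dQ; rewrite mulNr; congr (is_derive _ _ _ _).
  by apply/funext => y /=; rewrite mulrNN.
by apply: (is_derive_eq (is_derive_expR_comp d2)); rewrite mulrC.
Qed.

Lemma gweight_continuous : continuous gweight.
Proof. exact: is_derive_continuous dZ. Qed.

Lemma gweight_primitive :
  primitive (fun x => - (2^-1 * gweight x)) (fun x => q x * gweight x).
Proof.
apply: primitive_derive => x.
  by apply: cvgM; [exact: cq|exact: gweight_continuous].
apply: (is_derive_eq (is_derive_opp (is_derive_scale (2^-1) (dZ x)))).
by rewrite mulNr mulrN opprK !mulrA mulVf// mul1r.
Qed.

Lemma gweight_integrable x :
  mu.-integrable `[x, +oo[ (EFin \o (fun y => q y * gweight y)).
Proof.
have mI : measurable (`[x, +oo[%classic : set (measurableTypeR R)) by exact: measurable_itv.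
apply: (@dominated_integrable _ _ (fun y => expR (2 * \int[mu]_y q y) * q y) _ mI).
- apply: measurable_funTS; apply: continuous_measurable_fun => y.
  by apply: cvgM; [exact: cq|exact: gweight_continuous].
- move=> y _; rewrite ger0_norm ?mulr_ge0 ?expR_ge0// mulrC ler_wpM2r//.
  exact: gweight_le.
- exact: (integrableZl mI _ (tailq x)).
Qed.

Lemma gweight_integrableZ c x :
  mu.-integrable `[x, +oo[ (EFin \o (fun y => q y * (c * gweight y))).
Proof.
have mI : measurable (`[x, +oo[%classic : set (measurableTypeR R)) by exact: measurable_itv.
have := integrableZl mI c (gweight_integrable x).
by congr (integrable _ _ _); apply/funext => y /=; rewrite -EFinM mulrCA.
Qed.

(** Two primitives of q Z have the same increment from [x] to a far point [y]. The tail beyond [y]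
    is made smaller than [e], and the value of Z at [y] is dropped because it is nonnegative. *)
Lemma gweight_int x :
  \int[mu]_(y in `[x, +oo[) (q y * gweight y) <= 2^-1 * gweight x.
Proof.
apply/ler_addgt0Pr => e e0.
set Zm := expR (2 * \int[mu]_y q y).
have Zm0 : 0 < Zm by exact: expR_gt0.
have aux (i j zx zy : R) : - j - - i = - zy - - zx -> j <= e -> 0 <= zy -> i <= zx + e.
  by move=> *; lra.
have [M HM] := tail_lt iq q0 (divr_gt0 e0 Zm0).
pose y := Num.max x M.
have xy : x <= y by rewrite le_max lexx.
have My : M <= y by rewrite le_max lexx orbT.
have [_ JE] := gweight_primitive.
have [_ JE'] := primitive_right gweight_integrable.
have E := JE' _ _ xy; rewrite -JE// in E.
apply: (aux _ _ _ _ E); last by rewrite mulr_ge0// expR_ge0.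
have mI : measurable (`[y, +oo[%classic : set (measurableTypeR R)) by exact: measurable_itv.
apply: (@le_trans _ _ (Zm * \int[mu]_(t in `[y, +oo[) q t)).
  rewrite -(RintegralZl _ mI (tailq y)); apply: (le_Rintegral mI).
  - exact: gweight_integrable.
  - exact: (integrableZl mI _ (tailq y)).
  - by move=> t _; rewrite mulrC ler_wpM2r//; exact: gweight_le.
by rewrite mulrC -ler_pdivlMr// ltW// HM.
Qed.

Lemma gronwall h a b :
  0 <= a -> measurable_fun setT h ->
  (forall x, 0 <= h x) -> (forall x, h x <= b) ->
  (forall x, h x <= a + \int[mu]_(y in `[x, +oo[) (q y * h y)) ->
  forall x, h x <= 2 * a * expR (2 * \int[mu]_y q y).
Proof.
move=> a0 mh h0 hb ha x.
have b0 : 0 <= b := le_trans (h0 0) (hb 0).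
have iqh y : mu.-integrable `[y, +oo[ (EFin \o (fun t => q t * h t)).
  have mI : measurable (`[y, +oo[%classic : set (measurableTypeR R)) by exact: measurable_itv.
  apply: (@dominated_integrable _ _ (fun t => b * q t) _ mI).
  - apply: measurable_funTS; apply: measurable_funM => //.
    exact: continuous_measurable_fun.
  - by move=> t _; rewrite ger0_norm ?mulr_ge0// mulrC ler_wpM2r.
  - exact: (integrableZl mI _ (tailq y)).
(* Each pass through the integral inequality halves the coefficient of Z and adds [a], which is at
   most [a] times Z because Z >= 1; [2 * a] is the fixed point and the error contributed by [b] is
   halved. *)
have H n : forall y, h y <= (2 * a + b * (2^-1) ^+ n) * gweight y.
  elim: n => [|n IH] y; last first.
    have mI : measurable (`[y, +oo[%classic : set (measurableTypeR R)) by exact: measurable_itv.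
    apply: (le_trans (ha y)).
    set c := 2 * a + _ in IH.
    have step : \int[mu]_(t in `[y, +oo[) (q t * h t) <= c * (2^-1 * gweight y).
      apply: (@le_trans _ _ (c * \int[mu]_(t in `[y, +oo[) (q t * gweight t))).
        rewrite -(RintegralZl _ mI (gweight_integrable y)); apply: (le_Rintegral mI).
        - exact: iqh.
        - exact: (integrableZl mI _ (gweight_integrable y)).
        - by move=> t _; rewrite mulrCA ler_wpM2l.
      rewrite ler_wpM2l ?gweight_int//.
      have := le_trans (h0 y) (IH y).
      by rewrite pmulr_lge0// (lt_le_trans ltr01 (gweight_ge1 y)).
    apply: (le_trans (lerD (lexx a) step)).
    have : a * 1 <= a * gweight y by rewrite ler_wpM2l// gweight_ge1.
    by rewrite exprS /c; set u := (2^-1) ^+ n; set g := gweight y; nra.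
  rewrite expr0 mulr1 (le_trans (hb y))//.
  apply: (@le_trans _ _ ((2 * a + b) * 1)); first by rewrite mulr1; lra.
  by rewrite ler_wpM2l ?gweight_ge1//; lra.
apply: (@le_trans _ _ (2 * a * gweight x)); last first.
  by rewrite ler_wpM2l ?gweight_le//; lra.
apply: (@geometric_le _ _ (b * gweight x)) => n.
by apply: (le_trans (H n x)); rewrite mulrDl [b * _ * _]mulrAC.
Qed.

(** Jost solutions are bounded on right half-lines only. Setting [h] to zero on the left of [c]
    preserves the inequality, since the integral looks only to the right, and reduces to the bounded
    case with a constant independent of [c]. *)
Lemma gronwall_local h a : 0 <= a -> measurable_fun setT h -> (forall x, 0 <= h x) ->
  (forall c, exists b, forall x, c <= x -> h x <= b) ->
  (forall x, h x <= a + \int[mu]_(y in `[x, +oo[) (q y * h y)) ->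
  forall x, h x <= 2 * a * expR (2 * \int[mu]_y q y).
Proof.
move=> a0 mh h0 hb ha c.
have [b Hb] := hb c.
pose hc := h \_ `[c, +oo[.
have hcE x : c <= x -> hc x = h x.
  by move=> cx; rewrite /hc patchE mem_set//= in_itv /= cx.
have hc0 x : ~~ (c <= x) -> hc x = 0.
  move=> cx; rewrite /hc patchE memNset//= in_itv /= andbT; exact/negP.
rewrite -hcE//; apply: (@gronwall _ _ `|b|) => //.
- apply/(measurable_restrictT _ _).1; first exact: measurable_itv.
  exact: measurable_funTS.
- by move=> x; have [/hcE->|/hc0->] := boolP (c <= x).
- move=> x; have [cx|/hc0->//] := boolP (c <= x).
  by rewrite hcE// (le_trans (Hb _ cx))// ler_norm.
move=> x; have [cx|/hc0->] := boolP (c <= x); last first.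
  rewrite addr_ge0// Rintegral_ge0// => y _; rewrite mulr_ge0//.
  by have [/hcE->|/hc0->] := boolP (c <= y).
rewrite hcE// (le_trans (ha x))// lerD2l; apply: eq_ler.
apply: eq_Rintegral => y; rewrite mem_setE in_itv /= andbT => xy.
by rewrite hcE// (le_trans cx).
Qed.

End Gronwall.

(** * Volterra equations on right half-lines *)

Section Volterra.
Context {R : realType}.
Local Notation C := R[i].
Local Notation mu := (@lebesgue_measure R).
Variables (N U : R -> 'M[C]_2) (w q : R -> R).
Hypotheses (cN : mcont N) (ND : forall s t, N (s + t) = N s *m N t) (N0 : N 0 = 1%:M).
Hypotheses (cU : mcont U).
Hypotheses (q0 : forall x, 0 <= q x) (w0 : forall x, 0 < w x).
Hypothesis NU : forall x y, x <= y -> mnorm (N (y - x) *m U y) * w y <= w x * q y.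
Implicit Types (g : R -> 'cV[C]_2) (h : R -> R).

(** By [NU], the size relative to [w] is propagated by a scalar kernel bounded by [q y], whatever
    [x]; a growing weight [w] thus leaves room for solutions that grow on the left. *)
Definition vint g x := mint `[x, +oo[ (fun y => N (y - x) *m U y *m g y).

Let mray x : measurable (`[x, +oo[%classic : set (measurableTypeR R)).
Proof. exact: measurable_itv. Qed.

Lemma vint_le g h x : mmeas setT g -> (forall y, mnorm (g y) <= w y * h y) ->
  mu.-integrable `[x, +oo[ (EFin \o (fun y => q y * h y)) ->
  mintegrable `[x, +oo[ (fun y => N (y - x) *m U y *m g y) /\
  mnorm (vint g x) <= w x * \int[mu]_(y in `[x, +oo[) (q y * h y).
Proof.
move=> mg gh iqh.
have iw := integrableZl (mray x) (w x) iqh.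
have le y : `[x, +oo[%classic y ->
    mnorm (N (y - x) *m U y *m g y) <= w x * (q y * h y).
  rewrite /= in_itv /= andbT => xy.
  have h0 : 0 <= h y by rewrite -(pmulr_rge0 _ (w0 y)) (le_trans (mnorm_ge0 (g y))).
  apply: (le_trans (mnormM _ _)).
  apply: (@le_trans _ _ (mnorm (N (y - x) *m U y) * (w y * h y))).
    by rewrite ler_wpM2l ?mnorm_ge0.
  by rewrite !mulrA ler_wpM2r// NU.
have ii : mintegrable `[x, +oo[ (fun y => N (y - x) *m U y *m g y).
  apply: (dominated_mintegrable (mray x) _ le iw).
  apply: mmeasM; last by move=> i j; have [a b] := mg i j; split; exact: measurable_funTS.
  apply: mcont_meas => //; apply: mcontM => //.
  apply: (@mcont_comp _ _ _ N (fun y => y - x)) => // y.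
  by apply: cvgB; [exact: cvg_id|exact: cvg_cst].
split=> //; apply: (le_trans (mnorm_mint_le (mray x) ii)).
rewrite -(RintegralZl _ (mray x) iqh); apply: (le_Rintegral (mray x)) => //.
exact: mintegrable_mnorm.
Qed.

(** The group law N (y - x) = N (- x) N (y) takes [x] out of the integrand, so that continuity and
    differentiability of [vint g] follow from those of a primitive. *)
Lemma vint_factor g h : mmeas setT g -> (forall y, mnorm (g y) <= w y * h y) ->
  (forall x, mu.-integrable `[x, +oo[ (EFin \o (fun y => q y * h y))) ->
  (forall x, mintegrable `[x, +oo[ (fun y => N y *m U y *m g y)) /\
  (forall x, vint g x = N (- x) *m mint `[x, +oo[ (fun y => N y *m U y *m g y)).
Proof.
move=> mg gh iqh.
have E x y : N y *m U y *m g y = N x *m (N (y - x) *m U y *m g y).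
  by rewrite !mulmxA -ND addrC subrK.
have ii x : mintegrable `[x, +oo[ (fun y => N y *m U y *m g y).
  rewrite (funext (E x)); apply: mintegrable_mulmx => //.
  by have [] := vint_le mg gh (iqh x).
split=> // x; rewrite /vint -mint_mulmx//; apply: eq_mint => y _.
by rewrite !mulmxA -ND addrC.
Qed.

Lemma mcontN_opp : mcont (fun x => N (- x)).
Proof. by apply: (@mcont_comp _ _ _ N (fun y => - y)) => // y; exact: cvgN. Qed.

Lemma vint_cont g h : mmeas setT g -> (forall y, mnorm (g y) <= w y * h y) ->
  (forall x, mu.-integrable `[x, +oo[ (EFin \o (fun y => q y * h y))) ->
  mcont (vint g).
Proof.
move=> mg gh iqh; have [ii E] := vint_factor mg gh iqh.
rewrite (funext E); apply: mcontM; first exact: mcontN_opp.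
have := mcontB (mcont_cst 0) (mprimitive_cont (mprimitive_right ii)).
by congr mcont; apply/funext => x; rewrite sub0r opprK.
Qed.

Lemma vint_mder g h P : mder (fun x => N (- x)) (fun x => P *m N (- x)) ->
  mcont g -> (forall y, mnorm (g y) <= w y * h y) ->
  (forall x, mu.-integrable `[x, +oo[ (EFin \o (fun y => q y * h y))) ->
  mder (vint g) (fun x => P *m vint g x - U x *m g x).
Proof.
move=> dN cg gh iqh.
have mg : mmeas setT g by exact: mcont_meas.
have [ii E] := vint_factor mg gh iqh.
have cF : mcont (fun y => N y *m U y *m g y) by apply: mcontM => //; exact: mcontM.
have dT := mderN (mprimitive_mder cF (mprimitive_right ii)).
have := mderM dN dT.
have -> : (fun x => N (- x) *m - - mint `[x, +oo[ (fun y => N y *m U y *m g y)) = vint g.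
  by apply/funext => x; rewrite opprK E.
apply: eq_mder => x; rewrite opprK -mulmxA -E mulmxN !mulmxA -ND addNr N0.
by rewrite mul1mx.
Qed.

Hypotheses (cq : continuous q) (iq : mu.-integrable setT (EFin \o q)).
Local Notation Z := (gweight q).

Let iqZ := gweight_integrableZ cq q0 iq.

Lemma vint_contract g c x : mmeas setT g ->
  (forall y, mnorm (g y) <= w y * (c * Z y)) ->
  mnorm (vint g x) <= w x * (c * 2^-1 * Z x).
Proof.
move=> mg gh; have [_ H] := vint_le mg gh (@iqZ c x).
apply: (le_trans H); rewrite ler_wpM2l ?(ltW (w0 x))//.
have -> : \int[mu]_(y in `[x, +oo[) (q y * (c * Z y)) =
    c * \int[mu]_(y in `[x, +oo[) (q y * Z y).
  rewrite -(RintegralZl _ (mray x) (gweight_integrable cq q0 iq x)).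
  by apply: eq_Rintegral => y _; rewrite mulrCA.
rewrite -[leRHS]mulrA ler_wpM2l ?gweight_int//.
have := le_trans (mnorm_ge0 _) (gh x).
by rewrite pmulr_rge0// pmulr_lge0// expR_gt0.
Qed.

Lemma vintB g1 g2 c1 c2 x : mmeas setT g1 -> mmeas setT g2 ->
  (forall y, mnorm (g1 y) <= w y * (c1 * Z y)) ->
  (forall y, mnorm (g2 y) <= w y * (c2 * Z y)) ->
  vint (fun y => g1 y - g2 y) x = vint g1 x - vint g2 x.
Proof.
move=> m1 m2 h1 h2; rewrite /vint -mintB//.
- by apply: eq_mint => y _; rewrite mulmxBr.
- by have [] := vint_le m1 h1 (@iqZ c1 x).
- by have [] := vint_le m2 h2 (@iqZ c2 x).
Qed.

(** An a priori bound for any solution, with a source [F] that may depend on the point and only a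
    crude bound on right half-lines assumed. It serves twice: for global boundedness of Jost
    solutions away from the thresholds, and for the difference of two Jost solutions. *)
Lemma volterra_bound g (F : R -> 'cV[C]_2) a : 0 <= a -> continuous w -> mcont g ->
  (forall c, exists b, forall x, c <= x -> mnorm (g x) <= w x * b) ->
  (forall x, mnorm (F x) <= w x * a) -> (forall x, g x = F x - vint g x) ->
  forall x, mnorm (g x) <= w x * (2 * a * expR (2 * \int[mu]_y q y)).
Proof.
move=> a0 cw cg gb Fa gE x.
pose h y := mnorm (g y) / w y.
have wh y : w y * h y = mnorm (g y) by rewrite /h mulrC divfK ?gt_eqF.
have h0 y : 0 <= h y by rewrite divr_ge0 ?mnorm_ge0// ltW.
have ch : continuous h.
  move=> y; apply: cvgM; first exact: mcont_mnorm.
  by apply: cvgV; [rewrite gt_eqF|exact: cw].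
have hb c : exists b, forall y, c <= y -> h y <= b.
  by have [b Hb] := gb c; exists b => y /Hb; rewrite -wh ler_pM2l.
have mh : measurable_fun setT h by exact: continuous_measurable_fun.
have iqh y : mu.-integrable `[y, +oo[ (EFin \o (fun t => q t * h t)).
  have [b Hb] := hb y.
  apply: (@dominated_integrable _ _ (fun t => b * q t) _ (mray y)).
  - apply: measurable_funTS; apply: measurable_funM => //.
    exact: continuous_measurable_fun.
  - move=> t /=; rewrite in_itv /= andbT => yt.
    by rewrite (ger0_norm (mulr_ge0 (q0 t) (h0 t))) mulrC (ler_wpM2r (q0 t) (Hb t yt)).
  - have iqy : mu.-integrable `[y, +oo[ (EFin \o q).
      by apply: integrableS iq => //; exact: mray.
    exact: (integrableZl (mray y) b iqy).
have mg : mmeas setT g by exact: mcont_meas.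
have gh y : mnorm (g y) <= w y * h y by rewrite wh.
rewrite -wh ler_wpM2l ?(ltW (w0 x))//.
apply: (gronwall_local cq q0 iq a0 mh h0 hb) => y.
rewrite -(ler_pM2l (w0 y)) wh gE mulrDr (le_trans (mnormB _ _))// lerD//.
by have [] := vint_le mg gh (iqh y).
Qed.

Variables (v : 'cV[C]_2) (A : R).
Hypotheses (vA : forall x, mnorm v <= w x * A).

Let A0 : 0 <= A.
Proof. by have := le_trans (mnorm_ge0 v) (vA 0); rewrite pmulr_rge0. Qed.

Fixpoint picard (n : nat) : R -> 'cV[C]_2 :=
  if n is n.+1 then fun x => v - vint (picard n) x else fun=> 0.

Let Z0 x : 0 <= Z x. Proof. exact: expR_ge0. Qed.

Let picard_spec n : mcont (picard n) /\
  (forall x, mnorm (picard n x) <= w x * (2 * A * Z x)).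
Proof.
elim: n => [|n [cg hg]] /=.
  split=> [|x]; first exact: mcont_cst.
  by rewrite mnorm0 mulr_ge0 ?(ltW (w0 x))// mulr_ge0// mulr_ge0.
have mg : mmeas setT (picard n) by exact: mcont_meas.
split=> [|x].
  apply: mcontB; first exact: mcont_cst.
  exact: (vint_cont mg hg (@iqZ _)).
apply: (le_trans (mnormB _ _)).
apply: (le_trans (lerD (vA x) (vint_contract x mg hg))).
rewrite -mulrDr ler_wpM2l ?(ltW (w0 x))//.
have : A * 1 <= A * Z x by rewrite ler_wpM2l// gweight_ge1.
by move: (Z x) => z; lra.
Qed.

Let picard_step n x :
  mnorm (picard n.+1 x - picard n x) <= w x * (A * (2^-1) ^+ n * Z x).
Proof.
elim: n x => [|n IH] x.
  have -> : picard 1 x - picard 0 x = v.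
    rewrite /= subr0 /vint.
    rewrite (_ : mint _ _ = 0) ?subr0//.
    apply/matrixP => i j; rewrite !mxE -[RHS](cint0 `[x, +oo[).
    by apply: eq_cint => y _; rewrite mulmx0 mxE.
  rewrite expr0 mulr1 (le_trans (vA x))// ler_wpM2l ?(ltW (w0 x))//.
  by rewrite -[leLHS]mulr1 ler_wpM2l// gweight_ge1.
have [c1 h1] := picard_spec n.+1; have [c0 h0] := picard_spec n.
have m1 : mmeas setT (picard n.+1) by exact: mcont_meas.
have m0 : mmeas setT (picard n) by exact: mcont_meas.
have -> : picard n.+2 x - picard n.+1 x = - vint (fun y => picard n.+1 y - picard n y) x.
  rewrite (vintB _ m1 m0 h1 h0) -[picard n.+2 x]/(v - vint (picard n.+1) x).
  rewrite -[X in _ - X = _]/(v - vint (picard n) x).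
  by apply/matrixP => i j; rewrite !mxE; ring.
rewrite mnormN exprSr [A * (_ * _)]mulrA; apply: vint_contract => //.
by apply: mcont_meas => //; exact: mcontB.
Qed.

Let picard_lim : exists g, forall n x,
  mnorm (g x - picard n x) <= w x * (8 * A * (2^-1) ^+ n * Z x).
Proof.
(* Stated for an additive [f] dominated by the modulus, so as to cover real and imaginary parts at
   once. *)
have L x i (f : C -> R) : (forall a b, f (a + b) = f a + f b) ->
    (forall a, f (- a) = - f a) -> (forall a, `|f a| <= cabs a) ->
  exists l, forall n, `|l - f (picard n x i 0)| <=
    2 * (w x * (A * Z x)) * (2^-1) ^+ n.
  move=> fD fN fle; apply: geometric_cauchy => n.
  rewrite -fN -fD (le_trans (fle _))// -[X in _ - X]/(picard n x i 0).
  apply: (@le_trans _ _ (mnorm (picard n.+1 x - picard n x))).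
    have := cabs_le_mnorm (picard n.+1 x - picard n x) i 0.
    by rewrite !mxE.
  apply: (le_trans (picard_step n x)).
  by apply: eq_ler; ring.
have [lr Hr] := choice (fun z : R * 'I_2 =>
   L z.1 z.2 (@complex.Re R) (@ReD R) (@ReN R) (@Re_le_cabs R)).
have [li Hi] := choice (fun z : R * 'I_2 =>
   L z.1 z.2 (@complex.Im R) (@ImD R) (@ImN R) (@Im_le_cabs R)).
exists (fun x => \col_i (Complex (lr (x, i)) (li (x, i)))) => n x.
(* The constant 8: real and imaginary part each contribute 2, and there are two components. *)
apply: (@le_trans _ _ (\sum_(i < 2) \sum_(j < 1) 4 * (w x * (A * Z x)) * (2^-1) ^+ n)).
  apply: ler_sum => i _; apply: ler_sum => j _; rewrite !mxE.
  apply: (le_trans (cabs_le _)); rewrite ReD ImD ReN ImN /= (ord1 j).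
  have := lerD (Hr (x, i) n) (Hi (x, i) n).
  by move=> /le_trans; apply => /=; rewrite -!mulrDl; apply: eq_ler; ring.
by rewrite !big_ord_recl !big_ord0 /=; apply: eq_ler; ring.
Qed.

Lemma volterra : exists g, [/\ mcont g,
  forall x, mnorm (g x) <= w x * (8 * A * Z x) &
  forall x, g x = v - vint g x].
Proof.
have [g Hg] := picard_lim.
have gb x : mnorm (g x) <= w x * (8 * A * Z x).
  by have := Hg 0%N x; rewrite subr0 expr0 mulr1.
have mg : mmeas setT g.
  have cvx x i (f : C -> R) : (forall a b, f (a + b) = f a + f b) ->
    (forall a, f (- a) = - f a) -> (forall a, `|f a| <= cabs a) ->
    f (picard n x i 0) @[n --> \oo] --> f (g x i 0).
    move=> fD fN fle; apply/cvgrPdist_le => e e0.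
    have c0 := cvg_geometric0 (w x * (8 * A * Z x)).
    move/cvgrPdist_le : c0 => /(_ e e0); apply: filterS => n Hn.
    rewrite -fN -fD (le_trans (fle _))//.
    apply: (@le_trans _ _ (mnorm (g x - picard n x))).
      by have := cabs_le_mnorm (g x - picard n x) i 0; rewrite !mxE.
    apply: (le_trans (Hg n x)); apply: le_trans Hn.
    by rewrite sub0r normrN; apply: le_trans (ler_norm _); apply: eq_ler; ring.
  move=> i j; rewrite (ord1 j); split.
    apply: (@measurable_fun_cvg _ _ _ _ (fun n x => complex.Re (picard n x i 0))).
      by move=> n; have [/(mcont_meas measurableT) H _] := picard_spec n; case: (H i 0).
    by move=> x _; apply: cvx; [exact: ReD|exact: ReN|exact: Re_le_cabs].
  apply: (@measurable_fun_cvg _ _ _ _ (fun n x => complex.Im (picard n x i 0))).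
    by move=> n; have [/(mcont_meas measurableT) H _] := picard_spec n; case: (H i 0).
  by move=> x _; apply: cvx; [exact: ImD|exact: ImN|exact: Im_le_cabs].
have Eg x : g x = v - vint g x.
  apply/eqP; rewrite -subr_eq0; apply/eqP/mnorm_eq0/eqP.
  rewrite eq_le mnorm_ge0 andbT.
  apply: (@geometric_le _ _ _ (w x * (8 * A * Z x))) => n.
  have [cp hp] := picard_spec n.
  have mp : mmeas setT (picard n) by exact: mcont_meas.
  (* The defect of the limit is the error of one iterate plus [vint] applied to the error of the
     preceding one; both are of order 2^-n. *)
  have -> : g x - (v - vint g x) = (g x - picard n.+1 x) + vint (fun y => g y - picard n y) x.
    rewrite (vintB _ mg mp gb hp) -[picard n.+1 x]/(v - vint (picard n) x).
    by apply/matrixP => i j; rewrite !mxE; ring.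
  apply: (le_trans (mnormD _ _)).
  have mgp : mmeas setT (fun y => g y - picard n y).
    exact: mmeasB.
  apply: (le_trans (lerD (Hg n.+1 x) (vint_contract x mgp (Hg n)))).
  by rewrite add0r exprSr; apply: eq_ler; field.
exists g; split; [|exact: gb|exact: Eg].
rewrite (funext Eg); apply: mcontB; first exact: mcont_cst.
exact: (vint_cont mg gb (@iqZ _)).
Qed.

End Volterra.

(** * Complex exponentials and the Joukowski variable *)

Section FreeEvolution.
Context {R : realType}.
Local Notation C := R[i].
Local Notation Re := complex.Re.
Local Notation Im := complex.Im.
Local Notation mu := (@lebesgue_measure R).
Implicit Types (k z : C) (x t s : R).

Definition ci : C := (0 +i* 1)%C.

Lemma ciM : ci * ci = -1.
Proof. by apply: complexP; rewrite ?ReM ?ImM /=; ring. Qed.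
Lemma ci_neq0 : ci != 0.
Proof. by rewrite -cabs_eq0 cabsi oner_eq0. Qed.

(* cexp k x is e^{ikx} *)
Definition cexp k x : C :=
  ((expR (- Im k * x) * cos (Re k * x)) +i* (expR (- Im k * x) * sin (Re k * x)))%C.

Lemma cexp0 k : cexp k 0 = 1.
Proof. by rewrite /cexp !mulr0 expR0 cos0 sin0 mulr1 mulr0. Qed.
Lemma cexp0l x : cexp 0 x = 1.
Proof. by rewrite /cexp /= oppr0 !mul0r expR0 cos0 sin0 mulr1 mulr0. Qed.
Lemma cexpD k x t : cexp k (x + t) = cexp k x * cexp k t.
Proof.
apply: complexP; rewrite ?ReM ?ImM /= !mulrDr expRD ?cosD ?sinD; ring.
Qed.
Lemma cabs_cexp k x : cabs (cexp k x) = expR (- Im k * x).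
Proof.
rewrite cabsE /= !exprMn -mulrDr cos2Dsin2 mulr1 sqrtr_sqr.
by rewrite ger0_norm// expR_ge0.
Qed.
Lemma cabs_cexp_le1 k x : 0 <= Im k -> 0 <= x -> cabs (cexp k x) <= 1.
Proof. by move=> k0 x0; rewrite cabs_cexp -expR0 ler_expR mulNr oppr_le0 mulr_ge0. Qed.
Lemma cexp_neq0 k x : cexp k x != 0.
Proof. by rewrite -cabs_eq0 cabs_cexp gt_eqF// expR_gt0. Qed.

Lemma cder_cexp k : cder (cexp k) (fun x => ci * k * cexp k x).
Proof.
move=> x.
have lin (a : R) : is_derive x 1 (fun x => a * x) a.
  by apply: (is_derive_eq (is_derive_scale a (is_derive_id x 1))); rewrite mulr1.
have de := is_derive_expR_comp (lin (- Im k)).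
have dc : is_derive x 1 (fun x => cos (Re k * x)) (- sin (Re k * x) * Re k).
  exact: (@is_derive1_comp _ cos _ x _ _ (is_derive_cos _) (lin (Re k))).
have ds : is_derive x 1 (fun x => sin (Re k * x)) (cos (Re k * x) * Re k).
  exact: (@is_derive1_comp _ sin _ x _ _ (is_derive_sin _) (lin (Re k))).
split.
  apply: (is_derive_eq (is_derive_mul de dc)).
  by rewrite -[RHS]/(Re (ci * k * cexp k x)) !(ReM, ImM) /=; ring.
apply: (is_derive_eq (is_derive_mul de ds)).
by rewrite -[RHS]/(Im (ci * k * cexp k x)) !(ReM, ImM) /=; ring.
Qed.
Lemma ccont_cexp k : ccont (cexp k).
Proof. exact: cder_cont (cder_cexp k). Qed.

Lemma cder_cabs_le F G (K : R) x t : x <= t -> cder F G -> ccont G ->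
  (forall s, x <= s -> s <= t -> cabs (G s) <= K) ->
  cabs (F t - F x) <= K * (t - x).
Proof.
move=> xt dF cG GK.
apply: (le_trans (cabs_primitive_le xt (cder_primitive cG dF) (@cst_continuous _ _ K) GK)).
have E : (lebesgue_measure (`[x, t]%classic : set R) = (t - x)%:E)%E.
  rewrite lebesgue_measure_itv /= lte_fin.
  by move: xt; rewrite le_eqVlt => /predU1P[->|->]; rewrite ?ltxx ?subrr.
rewrite Rintegral_cst; last exact: measurable_itv.
by rewrite [X in fine X]E.
Qed.

(** The path s -> e^{iks} e^{iz(x-s)} joins e^{izx} to e^{ikx}, and its derivative is i (k - z)
    times a number of modulus at most 1. *)
Lemma cexp_lipschitz k z x : 0 <= Im k -> 0 <= Im z -> 0 <= x ->
  cabs (cexp k x - cexp z x) <= cabs (k - z) * x.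
Proof.
move=> k0 z0 x0.
pose F s := cexp k s * cexp z (x - s).
have dF : cder F (fun s => ci * (k - z) * F s).
  have d1 : cder (fun s => cexp z (x - s)) (fun s => - (ci * z) * cexp z (x - s)).
    have H := cderZ (cexp z x) (cder_opp (cder_cexp z)).
    have := H; under [X in cder X _]eq_fun do rewrite -cexpD.
    by apply: eq_cder => s; rewrite mulrN mulrCA -cexpD mulNr.
  by apply: eq_cder (cderM (cder_cexp k) d1) => s; rewrite /F; ring.
have cF : ccont (fun s => ci * (k - z) * F s).
  by apply: ccontM; [exact: ccont_cst|exact: cder_cont dF].
have := @cder_cabs_le F _ (cabs (k - z)) 0 x x0 dF cF.
rewrite /F subrr subr0 !cexp0 mulr1 mul1r; apply => s s0 sx.
rewrite !cabsM cabsi mul1r -[leRHS]mulr1 ler_wpM2l ?cabs_ge0//.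
rewrite -[leRHS]mulr1 ler_pM ?cabs_ge0 ?cabs_cexp_le1// subr_ge0//.
Qed.

(** The integral of e^{2iks} over 0 <= s <= t, with its removable singularity at k = 0 filled by the
    value t. That value is the source of the linear growth at the thresholds. *)
Definition phi k t : C := if k == 0 then (t%:C)%C else (cexp (2 * k) t - 1) / (2 * ci * k).

Lemma two_neq0 : (2 : C) != 0.
Proof. by rewrite pnatr_eq0. Qed.

Lemma phiE k t : 1 + 2 * ci * k * phi k t = cexp (2 * k) t.
Proof.
rewrite /phi; case: eqVneq => [->|k0]; first by rewrite !mulr0 mul0r addr0 cexp0l.
rewrite mulrCA divff ?mulr1; first by rewrite addrC subrK.
by rewrite !mulf_neq0 ?two_neq0 ?ci_neq0.
Qed.
Lemma phi0 k : phi k 0 = 0.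
Proof. by rewrite /phi; case: eqP => // _; rewrite cexp0 subrr mul0r. Qed.
Lemma phiD k s t : phi k (s + t) = phi k s + phi k t + 2 * ci * k * phi k s * phi k t.
Proof.
rewrite /phi; case: eqVneq => [->|k0]; first by rewrite !(mulr0, mul0r) addr0 -rmorphD.
rewrite cexpD; field.
by rewrite ci_neq0 k0.
Qed.
Lemma cder_phi k : cder (phi k) (cexp (2 * k)).
Proof.
rewrite /phi; case: eqVneq => [->|k0] /=.
  move=> x; rewrite mulr0 cexp0l; split=> /=; first exact: is_derive_id.
  exact: is_derive_cst.
have H := cderZ (2 * ci * k)^-1 (cderB (cder_cexp (2 * k)) (cder_cst 1)).
have := H; under [X in cder X _]eq_fun do rewrite mulrC.
apply: eq_cder => x; rewrite subr0 mulrA mulrA; field.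
by rewrite ci_neq0 k0.
Qed.
Lemma ccont_phi k : ccont (phi k).
Proof. exact: cder_cont (cder_phi k). Qed.

Let Im2 k : Im (2 * k) = 2 * Im k.
Proof. by rewrite ImM /=; ring. Qed.

Lemma cabs2 : cabs (2 : C) = 2.
Proof. by rewrite -[2](rmorph_nat (real_complex R)) cabs_real ger0_norm. Qed.

Lemma cabs_phi_le k t : 0 <= Im k -> 0 <= t -> cabs (phi k t) <= t.
Proof.
move=> k0 t0.
have := @cder_cabs_le _ _ 1 0 t t0 (cder_phi k) (ccont_cexp _).
rewrite phi0 !subr0 mul1r; apply => s s0 st.
by apply: cabs_cexp_le1 => //; rewrite Im2 mulr_ge0.
Qed.
Lemma cabs_phi_le_inv k t : k != 0 -> 0 <= Im k -> 0 <= t ->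
  cabs (phi k t) <= (cabs k)^-1.
Proof.
move=> kn0 k0 t0; rewrite /phi (negPf kn0) cabsM cabsV !cabsM cabsi cabs2 mulr1.
rewrite invfM mulrA ler_piMl ?invr_ge0 ?cabs_ge0//.
rewrite ler_pdivrMr// mul1r (le_trans (cabsB _ _))// cabs1.
rewrite -[leRHS]/(1 + 1) lerD2r cabs_cexp_le1// Im2 mulr_ge0//.
Qed.
Lemma phi_lipschitz k z t : 0 <= Im k -> 0 <= Im z -> 0 <= t ->
  cabs (phi k t - phi z t) <= 2 * cabs (k - z) * t ^+ 2.
Proof.
move=> k0 z0 t0.
have := @cder_cabs_le _ _ (2 * cabs (k - z) * t) 0 t t0
  (cderB (cder_phi k) (cder_phi z)) (ccontB (ccont_cexp _) (ccont_cexp _)).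
rewrite !phi0 !subr0 expr2 mulrA; apply => s s0 st.
apply: (le_trans (cexp_lipschitz _ _ s0)); rewrite ?Im2 ?mulr_ge0//.
by rewrite -mulrBr cabsM cabs2 ler_wpM2l// mulr_ge0 ?cabs_ge0.
Qed.

(* Joukowski uniformisation: z = m (zeta + 1/zeta) / 2 and k = m (1/zeta - zeta) / 2
   satisfy k^2 = z^2 - m^2, and both are single-valued in zeta. *)
Variable m : R.
Hypothesis m0 : 0 < m.
Implicit Type zeta : C.

Local Notation mC := ((m%:C)%C : C).

Definition energy zeta : C := mC * (zeta + zeta^-1) / 2.
Definition momentum zeta : C := mC * (zeta^-1 - zeta) / 2.
(** By [Im_energy] and [Im_momentum], the energy and the momentum both have nonnegative imaginary
    part here, so that e^{ikt} and [phi] are controlled for t >= 0. The deleted point 0 stands for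
    infinite energy. *)
Definition half_disc zeta := [/\ zeta != 0, cabs zeta <= 1 & Im zeta <= 0].

Lemma mC_neq0 : mC != 0.
Proof. by rewrite -cabs_eq0 cabs_real normr_eq0 gt_eqF. Qed.

Lemma cabs_mC : cabs mC = m.
Proof. by rewrite cabs_real ger0_norm// ltW. Qed.

Lemma cinvE z : z^-1 = ((cabs z ^- 2)%:C)%C * conjc z.
Proof.
have [->|z0] := eqVneq z 0; first by rewrite invr0 rmorph0 mulr0.
apply: (mulfI z0); rewrite divff// mulrCA [z * _]mulrC conjcM_cabs -rmorphM mulVf//.
by rewrite expf_neq0// cabs_eq0.
Qed.

Lemma Im_momentum zeta :
  Im (momentum zeta) = m / 2 * (- Im zeta * (cabs zeta ^- 2 + 1)).
Proof.
rewrite /momentum.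
have -> : (mC * (zeta^-1 - zeta) / 2) = ((m / 2)%:C)%C * (zeta^-1 - zeta).
  by rewrite rmorphM fmorphV rmorph_nat /=; ring.
rewrite ImM /= mul0r addr0 ImD ImN cinvE ImM /= mul0r addr0.
by case: zeta => a b /=; ring.
Qed.
Lemma Im_energy zeta :
  Im (energy zeta) = m / 2 * (- Im zeta * (cabs zeta ^- 2 - 1)).
Proof.
rewrite /energy.
have -> : (mC * (zeta + zeta^-1) / 2) = ((m / 2)%:C)%C * (zeta + zeta^-1).
  by rewrite rmorphM fmorphV rmorph_nat /=; ring.
rewrite ImM /= mul0r addr0 ImD cinvE ImM /= mul0r addr0.
by case: zeta => a b /=; ring.
Qed.
Lemma Im_momentum_ge0 zeta : half_disc zeta -> 0 <= Im (momentum zeta).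
Proof.
move=> [_ _ z0]; rewrite Im_momentum mulr_ge0//; first by rewrite divr_ge0// ltW.
by rewrite mulr_ge0// ?oppr_ge0// addr_ge0// invr_ge0 exprn_ge0// cabs_ge0.
Qed.

End FreeEvolution.

(** * The free propagator, uniformly up to thresholds and infinite energy *)

Section Propagator.
Context {R : realType}.
Local Notation C := R[i].
Local Notation Re := complex.Re.
Local Notation Im := complex.Im.
Variable m : R.
Hypothesis m0 : 0 < m.
Implicit Types (z zeta : C) (x t s : R).
Local Notation mC := ((m%:C)%C : C).

Lemma I2P (i : 'I_2) : i = 0 \/ i = 1.
Proof.
by case: i => [[|[|//]] Hi]; [left|right]; apply/val_inj.
Qed.

Lemma mx2P (A B : 'M[C]_2) : A 0 0 = B 0 0 -> A 0 1 = B 0 1 ->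
  A 1 0 = B 1 0 -> A 1 1 = B 1 1 -> A = B.
Proof.
move=> *; apply/matrixP => i j.
by case: (I2P i) => ->; case: (I2P j) => ->.
Qed.
Lemma cV2P (A B : 'cV[C]_2) : A 0 0 = B 0 0 -> A 1 0 = B 1 0 -> A = B.
Proof.
by move=> *; apply/matrixP => i j; rewrite (ord1 j); case: (I2P i) => ->.
Qed.
Lemma sum2E (V : nmodType) (F : 'I_2 -> V) : \sum_i F i = F 0 + F 1.
Proof. by rewrite big_ord_recl big_ord1; congr (_ + F _); apply/val_inj. Qed.
Lemma mulmx2E p q (A : 'M[C]_(p, 2)) (B : 'M[C]_(2, q)) i j :
  (A *m B) i j = A i 0 * B 0 j + A i 1 * B 1 j.
Proof. by rewrite mxE sum2E. Qed.
Lemma mnorm_cV2 (v : 'cV[C]_2) : mnorm v = cabs (v 0 0) + cabs (v 1 0).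
Proof. by rewrite /mnorm sum2E !big_ord1. Qed.
Lemma mnorm_M2 (A : 'M[C]_2) : mnorm A =
  cabs (A 0 0) + cabs (A 0 1) + (cabs (A 1 0) + cabs (A 1 1)).
Proof. by rewrite /mnorm !sum2E. Qed.

(** The generator of the free system u' = - i alpha (z - m beta) u once the factor e^{ikx} is
    removed (see [genmxE]). Since a plane wave with that factor solves the system, the matrix is
    singular: it is - i m times the column (1, 1/zeta) times the row (- zeta, 1). Its kernel is
    spanned by [jvec], the amplitude of the plane wave, and its other eigenvalue is - 2ik. *)
Definition genmx zeta : 'M[C]_2 := \matrix_(i, j)
  (- ci * mC * ((if i == 0 then 1 else zeta^-1) * (if j == 0 then - zeta else 1))).
Definition jvec zeta : 'cV[C]_2 := \col_i (if i == 0 then 1 else zeta).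

Lemma genmx_jvec zeta : genmx zeta *m jvec zeta = 0.
Proof.
by apply/cV2P; rewrite mulmx2E !mxE /=; ring.
Qed.

Lemma mnorm_jvec zeta : mnorm (jvec zeta) = 1 + cabs zeta.
Proof. by rewrite mnorm_cV2 !mxE /= cabs1. Qed.

Lemma genmx_sqr zeta : zeta != 0 ->
  genmx zeta *m genmx zeta = (- (2 * ci * momentum m zeta)) *: genmx zeta.
Proof.
move=> z0; apply/mx2P; rewrite mulmx2E !mxE /momentum /=; field;
 by rewrite ?z0 ?two_neq0.
Qed.

(** The exponential of - t times [genmx]: the exponential series collapses because the square of
    [genmx] is - 2ik times itself. *)
Definition propag zeta t : 'M[C]_2 := 1%:M - phi (momentum m zeta) t *: genmx zeta.

Lemma propag0 zeta : propag zeta 0 = 1%:M.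
Proof. by rewrite /propag phi0 scale0r subr0. Qed.

Lemma propagD zeta s t : zeta != 0 -> propag zeta (s + t) = propag zeta s *m propag zeta t.
Proof.
move=> z0; rewrite /propag phiD mulmxBl mul1mx mulmxBr mulmx1.
rewrite -scalemxAl -scalemxAr genmx_sqr// !scalerA.
by apply/matrixP => i j; rewrite !mxE; ring.
Qed.

Lemma mcont_propag zeta : mcont (propag zeta).
Proof.
apply: mcontB; first exact: mcont_cst.
by apply: mcontZ; [exact: ccont_phi|exact: mcont_cst].
Qed.

Lemma mder_propag_opp zeta : zeta != 0 ->
  mder (fun x => propag zeta (- x)) (fun x => genmx zeta *m propag zeta (- x)).
Proof.
move=> z0.
have H := mder_opp (mderB (mder_cst (1%:M)) (mderZ (cder_phi (momentum m zeta)) (mder_cst (genmx zeta)))).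
apply: eq_mder H => x; rewrite scaler0 addr0 sub0r opprK -phiE.
rewrite /propag mulmxBr mulmx1 -scalemxAr genmx_sqr// scalerA.
by apply/matrixP => i j; rewrite !mxE; ring.
Qed.

Lemma mnorm_genmx zeta : half_disc zeta -> mnorm (genmx zeta) <= 4 * m / cabs zeta.
Proof.
move=> [z0 z1 _].
have zp : 0 < cabs zeta by rewrite cabs_gt0.
have zi : 1 <= (cabs zeta)^-1 by rewrite invf_ge1.
have -> : 4 * m / cabs zeta = m * (4 * (cabs zeta)^-1) by ring.
rewrite mnorm_M2 !mxE /= !cabsM !cabsN !cabsV cabs1 cabsi cabs_mC// !mul1r !mulr1.
rewrite mulVf ?gt_eqF//.
have : m * cabs zeta <= m * 1 by rewrite ler_pM2l.
have : m * 1 <= m * (cabs zeta)^-1 by rewrite ler_pM2l.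
lra.
Qed.

Lemma mnorm1 : mnorm (1%:M : 'M[C]_2) = 2.
Proof. by rewrite mnorm_M2 !mxE /= !mulr0n !mulr1n cabs0 cabs1; ring. Qed.

Lemma momentum_ge zeta : half_disc zeta -> cabs zeta <= 2^-1 ->
  m / 3 / cabs zeta <= cabs (momentum m zeta).
Proof.
move=> [z0 z1 _] zh.
have zp : 0 < cabs zeta by rewrite cabs_gt0.
rewrite /momentum cabsM cabsM cabs_mC// cabsV cabs2.
have H : (cabs zeta)^-1 - cabs zeta <= cabs (zeta^-1 - zeta).
  have := cabsD (zeta^-1 - zeta) zeta; rewrite subrK cabsV; lra.
have zi : cabs zeta <= 1 / 4 * (cabs zeta)^-1.
  have : 2 <= (cabs zeta)^-1 by rewrite -[2]invrK lef_pV2 ?posrE ?invr_gt0.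
  lra.
have : m * (2 / 3 * (cabs zeta)^-1) <= m * cabs (zeta^-1 - zeta).
  by rewrite ler_pM2l//; lra.
lra.
Qed.

(** The factor m/|zeta| is the size of [genmx]. For |zeta| <= 1/2 the momentum is at least
    m/(3|zeta|) and |phi| <= 1/|k| compensates the blow-up; otherwise 1/|zeta| <= 2 and |phi| <= t.
    The bound therefore holds uniformly as [zeta] tends to 0. *)
Lemma mphi_le zeta t : half_disc zeta -> 0 <= t ->
  m / cabs zeta * cabs (phi (momentum m zeta) t) <= 3 + 2 * m * t.
Proof.
move=> hz t0; have [z0 z1 _] := hz.
have k0 := Im_momentum_ge0 m0 hz.
have zp : 0 < cabs zeta by rewrite cabs_gt0.
have mz : 0 <= m / cabs zeta by rewrite divr_ge0 ?ltW.
have [zh|/ltW zh] := leP (cabs zeta) 2^-1.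
  have kge := momentum_ge hz zh.
  have kp : 0 < cabs (momentum m zeta).
    by apply: lt_le_trans kge; rewrite !divr_gt0.
  have kn0 : momentum m zeta != 0 by rewrite -cabs_gt0.
  apply: (@le_trans _ _ (m / cabs zeta * (cabs (momentum m zeta))^-1)).
    by rewrite ler_wpM2l// cabs_phi_le_inv.
  apply: (@le_trans _ _ 3); last by rewrite lerDl mulr_ge0// mulr_ge0// ltW.
  by rewrite ler_pdivrMr//; lra.
apply: (@le_trans _ _ (2 * m * t)); last by rewrite lerDr.
rewrite ler_pM ?cabs_ge0 ?cabs_phi_le// mulrC ler_wpM2r ?(ltW m0)//.
by rewrite -[2]invrK lef_pV2 // ?posrE.
Qed.

Lemma mnorm_propag zeta t : half_disc zeta -> 0 <= t ->
  mnorm (propag zeta t) <= (14 + 8 * m) * (1 + t).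
Proof.
move=> hz t0; apply: (le_trans (mnormB _ _)); rewrite mnorm1 mnormZ.
have H1 := mphi_le hz t0.
have H2 : cabs (phi (momentum m zeta) t) * mnorm (genmx zeta) <=
    4 * (m / cabs zeta * cabs (phi (momentum m zeta) t)).
  rewrite mulrC mulrA ler_wpM2r ?cabs_ge0// mulrA.
  exact: mnorm_genmx.
have m0' : 0 <= m := ltW m0.
(* The identity contributes 2 and [genmx] a factor 4 over [mphi_le]: 2 + 4 (3 + 2 m t) = 14 + 8 m t,
   whence the constant 14 + 8 m. *)
apply: (@le_trans _ _ (2 + 4 * (3 + 2 * m * t))).
  by rewrite lerD2l (le_trans H2)// ler_pM2l.
by clear -m0' t0; nra.
Qed.

Lemma mnorm_propag_bounded zeta t : half_disc zeta -> momentum m zeta != 0 -> 0 <= t ->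
  mnorm (propag zeta t) <= 2 + 4 * m / cabs zeta / cabs (momentum m zeta).
Proof.
move=> hz kn0 t0; apply: (le_trans (mnormB _ _)); rewrite mnorm1 mnormZ lerD2l.
rewrite mulrC ler_pM ?cabs_ge0 ?mnorm_ge0 ?mnorm_genmx// cabs_phi_le_inv//.
exact: Im_momentum_ge0.
Qed.

Lemma cabs_inv_sub (z w : C) (r : R) : 0 < r -> r <= cabs z -> r <= cabs w ->
  cabs (z^-1 - w^-1) <= r ^- 2 * cabs (z - w).
Proof.
move=> r0 rz rw.
have z0 : z != 0 by rewrite -cabs_gt0 (lt_le_trans r0).
have w0 : w != 0 by rewrite -cabs_gt0 (lt_le_trans r0).
have -> : z^-1 - w^-1 = - (z - w) * (z^-1 * w^-1) by field; rewrite z0 w0.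
rewrite !cabsM cabsN !cabsV mulrC ler_wpM2r ?cabs_ge0// expr2 invfM.
by rewrite ler_pM ?invr_ge0 ?cabs_ge0// lef_pV2 ?posrE// (lt_le_trans r0).
Qed.

Lemma momentum_lipschitz (z w : C) (r : R) : 0 < r -> r <= cabs z -> r <= cabs w ->
  cabs (momentum m z - momentum m w) <= m * (1 + r ^- 2) * cabs (z - w).
Proof.
move=> r0 rz rw.
have z0 : z != 0 by rewrite -cabs_gt0 (lt_le_trans r0).
have w0 : w != 0 by rewrite -cabs_gt0 (lt_le_trans r0).
have -> : momentum m z - momentum m w = mC / 2 * ((z^-1 - w^-1) - (z - w)).
  by rewrite /momentum; field; rewrite z0 w0.
rewrite cabsM cabsM cabs_mC// cabsV cabs2.
have H := cabs_inv_sub r0 rz rw.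
have H2 := cabsB (z^-1 - w^-1) (z - w).
have cz := cabs_ge0 (z - w).
have H3 : 0 <= r ^- 2 * cabs (z - w) by rewrite mulr_ge0// invr_ge0 exprn_ge0// ltW.
rewrite -!mulrA ler_pM2l//; lra.
Qed.

Lemma genmx_lipschitz (z w : C) (r : R) : 0 < r -> r <= cabs z -> r <= cabs w ->
  mnorm (genmx z - genmx w) <= m * (1 + r ^- 2) * cabs (z - w).
Proof.
move=> r0 rz rw.
have z0 : z != 0 by rewrite -cabs_gt0 (lt_le_trans r0).
have w0 : w != 0 by rewrite -cabs_gt0 (lt_le_trans r0).
rewrite mnorm_M2 !mxE /=.
have -> : - ci * mC * (1 * - z) - - ci * mC * (1 * - w) = ci * mC * (z - w) by ring.
have -> : - ci * mC * (1 * 1) - - ci * mC * (1 * 1) = 0 by ring.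
have -> : - ci * mC * (z^-1 * - z) - - ci * mC * (w^-1 * - w) = 0.
  by field; rewrite z0 w0.
have -> : - ci * mC * (z^-1 * 1) - - ci * mC * (w^-1 * 1) = - ci * mC * (z^-1 - w^-1) by ring.
rewrite !cabsM cabsN cabs0 cabsi cabs_mC// mul1r add0r addr0 -mulrDr -mulrA.
by rewrite ler_pM2l// mulrDl mul1r lerD2l cabs_inv_sub.
Qed.

(** The growth is quadratic because differentiating [phi] in k brings down another factor of t. The
    radius [r] keeps [zeta] away from 0, where 1/zeta is not Lipschitz. *)
Lemma propag_lipschitz (r : R) : 0 < r -> exists2 K, 0 <= K &
  forall z w t, half_disc z -> half_disc w -> r <= cabs z -> r <= cabs w -> 0 <= t ->
    mnorm (propag z t - propag w t) <= K * cabs (z - w) * (1 + t) ^+ 2.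
Proof.
move=> r0; pose L := m * (1 + r ^- 2).
have L0 : 0 <= L by rewrite mulr_ge0 ?(ltW m0)// addr_ge0// invr_ge0 exprn_ge0// ltW.
have mr : 0 <= 4 * m / r by rewrite divr_ge0 ?ltW// mulr_gt0.
exists (2 * L * (4 * m / r) + L) => [|z w t hz hw rz rw t0].
  by rewrite addr_ge0// mulr_ge0// mulr_ge0.
have -> : propag z t - propag w t =
    - ((phi (momentum m z) t - phi (momentum m w) t) *: genmx z) -
    phi (momentum m w) t *: (genmx z - genmx w).
  rewrite /propag; move: (genmx z) (genmx w) (phi _ t) (phi _ t) => A B a b.
  by apply/matrixP => i j; rewrite !mxE; ring.
have kz := Im_momentum_ge0 m0 hz; have kw := Im_momentum_ge0 m0 hw.
apply: (le_trans (mnormB _ _)); rewrite mnormN !mnormZ.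
have H1 := phi_lipschitz kz kw t0.
have H2 := momentum_lipschitz r0 rz rw; rewrite -/L in H2.
have H3 := genmx_lipschitz r0 rz rw; rewrite -/L in H3.
have H4 := cabs_phi_le kw t0.
have H5 : mnorm (genmx z) <= 4 * m / r.
  apply: (le_trans (mnorm_genmx hz)); rewrite ler_wpM2l ?mulr_ge0 ?(ltW m0)//.
  by rewrite lef_pV2 ?posrE// (lt_le_trans r0).
have d0 := cabs_ge0 (z - w).
set d := cabs (z - w) in H2 H3 d0 *.
have Ld : 0 <= L * d by rewrite mulr_ge0.
have A1 : cabs (phi (momentum m z) t - phi (momentum m w) t) * mnorm (genmx z) <=
    2 * (L * d) * t ^+ 2 * (4 * m / r).
  rewrite ler_pM ?cabs_ge0 ?mnorm_ge0// (le_trans H1)//.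
  by rewrite ler_wpM2r ?sqr_ge0// ler_wpM2l.
have A2 : cabs (phi (momentum m w) t) * mnorm (genmx z - genmx w) <= t * (L * d).
  by rewrite ler_pM ?cabs_ge0 ?mnorm_ge0.
apply: (le_trans (lerD A1 A2)).
have t1 : t <= (1 + t) ^+ 2 by rewrite expr2; nra.
have t2 : t ^+ 2 <= (1 + t) ^+ 2 by rewrite !expr2; nra.
have B1 : 2 * (L * d) * t ^+ 2 * (4 * m / r) <= 2 * (L * d) * (1 + t) ^+ 2 * (4 * m / r).
  by rewrite ler_wpM2r// ler_wpM2l// mulr_ge0.
have B2 : t * (L * d) <= (1 + t) ^+ 2 * (L * d) by rewrite ler_wpM2r.
apply: (le_trans (lerD B1 B2)); apply: eq_ler; ring.
Qed.

End Propagator.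

(** * One-sided and two-sided linear weights *)

Section Weights.
Context {R : realType}.
Implicit Types (x y t : R).

(** Grows on the left only: solutions normalised at +oo stay bounded on the right half-line. *)
Definition lweight x : R := 1 + Num.max (- x) 0.
Definition bweight x : R := 1 + `|x|.

Lemma lweight_ge1 x : 1 <= lweight x.
Proof. by rewrite lerDl le_max lexx orbT. Qed.
Lemma lweight_gt0 x : 0 < lweight x.
Proof. exact: lt_le_trans ltr01 (lweight_ge1 x). Qed.
Lemma bweight_ge1 x : 1 <= bweight x.
Proof. by rewrite lerDl. Qed.
Lemma bweight_gt0 x : 0 < bweight x.
Proof. exact: lt_le_trans ltr01 (bweight_ge1 x). Qed.
Lemma lweight_le x : lweight x <= bweight x.
Proof.
by rewrite lerD2l ge_max normr_ge0 andbT -normrN ler_norm.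
Qed.
Lemma lweight_nonneg x : 0 <= x -> lweight x = 1.
Proof. by move=> x0; rewrite /lweight max_r ?addr0// oppr_le0. Qed.
Lemma lweight_homo x y : x <= y -> lweight y <= lweight x.
Proof. by move=> xy; rewrite lerD2l ge_max !le_max lerN2 xy /= lexx orbT. Qed.
(** Splits the linear growth of the propagator into a factor carried by the solution at [x] and a
    factor absorbed by the potential at [y]. It is sharp enough to leave no growth in [x] on the
    right half-line. *)
Lemma shift_le_weight x y : x <= y -> 1 + (y - x) <= lweight x * bweight y.
Proof.
move=> xy; rewrite /lweight /bweight.
have h1 : - x <= Num.max (- x) 0 by rewrite le_max lexx.
have h2 : 0 <= Num.max (- x) 0 by rewrite le_max lexx orbT.
have h3 := ler_norm y; have h4 := normr_ge0 y.
move: (Num.max _ _) h1 h2 => a h1 h2; move: `|y| h3 h4 => b h3 h4.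
by nra.
Qed.
Lemma bweightN x : bweight (- x) = bweight x. Proof. by rewrite /bweight normrN. Qed.
Lemma lweight_continuous : continuous lweight.
Proof.
move=> x; apply: cvgD; first exact: cvg_cst.
by apply: continuous_max; [exact: cvgN|exact: cvg_cst].
Qed.

End Weights.

(** * Jost solutions and their Hoelder continuity in zeta *)

Section Jost.
Context {R : realType}.
Local Notation C := R[i].
Local Notation Re := complex.Re.
Local Notation Im := complex.Im.
Local Notation mu := (@lebesgue_measure R).
Variables (m theta : R) (q : R -> R).
Hypotheses (m0 : 0 < m) (theta0 : 0 < theta) (theta1 : theta <= 1).
Hypotheses (cq : continuous q) (q0 : forall x, 0 <= q x)
  (iq : mu.-integrable setT (EFin \o q)).
Variable U : R -> 'M[C]_2.
Hypotheses (cU : mcont U)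
  (Uq : forall y, mnorm (U y) * (bweight y `^ (1 + theta)) ^+ 2 <= q y).
Implicit Types (zeta : C) (g : R -> 'cV[C]_2).

Let pb y : bweight y <= bweight y `^ (1 + theta).
Proof.
rewrite -[leLHS]powRr1 ?(ltW (bweight_gt0 _))// ler_powR ?bweight_ge1// lerDl.
exact: ltW.
Qed.
Let pl y : lweight y <= lweight y `^ (1 + theta).
Proof.
rewrite -[leLHS]powRr1 ?(ltW (lweight_gt0 _))// ler_powR ?lweight_ge1// lerDl.
exact: ltW.
Qed.

Let Uq2 y : mnorm (U y) * bweight y ^+ 2 <= q y.
Proof.
apply: le_trans (Uq y); rewrite ler_wpM2l ?mnorm_ge0// ler_pXn2r ?nnegrE ?powR_ge0//.
exact/ltW/bweight_gt0.
Qed.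


Let Uq0 y : mnorm (U y) <= q y.
Proof.
apply: le_trans (Uq2 y); rewrite ler_peMr ?mnorm_ge0//.
by rewrite -[leLHS](expr1n _ 2) ler_pXn2r ?nnegrE ?bweight_ge1// ltW// bweight_gt0.
Qed.
Let cm : R := 14 + 8 * m.
Let cm0 : 0 < cm. Proof. by rewrite /cm; have := m0; lra. Qed.
Let qm x := cm * q x.
Let cqm : continuous qm.
Proof. by move=> x; apply: cvgM; [exact: cvg_cst|exact: cq]. Qed.
Let qm0 x : 0 <= qm x. Proof. by rewrite mulr_ge0// ltW. Qed.
Let iqm : mu.-integrable setT (EFin \o qm).
Proof. exact: (integrableZl measurableT cm iq). Qed.

Let NU zeta : half_disc zeta -> forall x y, x <= y ->
  mnorm (propag m zeta (y - x) *m U y) * lweight y <= lweight x * qm y.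
Proof.
move=> hz x y xy; have yx0 : 0 <= y - x by rewrite subr_ge0.
(* One factor [bweight y] comes from the propagator, the other from [lweight y <= bweight y]; the
   potential pays for both, which is the two-power cost. *)
apply: (@le_trans _ _ (cm * (lweight x * bweight y) * mnorm (U y) * bweight y)).
  apply: ler_pM; rewrite ?mnorm_ge0 ?lweight_le ?(ltW (lweight_gt0 y))//.
  apply: (le_trans (mnormM _ _)); rewrite ler_wpM2r ?mnorm_ge0//.
  apply: (le_trans (mnorm_propag m0 hz yx0)); rewrite ler_pM2l//.
  exact: shift_le_weight.
apply: (@le_trans _ _ (cm * lweight x * (mnorm (U y) * bweight y ^+ 2))).
  by apply: eq_ler; ring.
have -> : lweight x * qm y = cm * lweight x * q y by rewrite /qm; ring.
by rewrite ler_wpM2l// mulr_ge0// ltW// lweight_gt0.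
Qed.

Definition jost_eq zeta g :=
  forall x, g x = jvec zeta - vint (propag m zeta) U g x.

(** The 8 is the constant of [volterra] and the 2 bounds the norm 1 + |zeta| of [jvec]; nothing in
    it depends on [zeta]. *)
Definition jostC : R := 8 * 2 * expR (2 * \int[mu]_y qm y).

Lemma jostC_gt0 : 0 < jostC. Proof. by rewrite mulr_gt0// expR_gt0. Qed.

Lemma jost_exists zeta : half_disc zeta -> exists g,
  [/\ mder g (fun x => (genmx m zeta + U x) *m g x),
      forall x, mnorm (g x) <= jostC * lweight x & jost_eq zeta g].
Proof.
move=> hz; have [z0 z1 _] := hz.
have vA x : mnorm (jvec zeta) <= lweight x * 2.
  rewrite mnorm_jvec; have := lweight_ge1 x; lra.
have [g [cg gb ge]] := volterra (mcont_propag m zeta) (fun s t => propagD m s t z0) cU qm0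
  (@lweight_gt0 R) (NU hz) cqm iqm vA.
exists g; split=> // [|x]; last first.
  apply: (le_trans (gb x)); rewrite mulrC ler_wpM2r ?(ltW (lweight_gt0 x))//.
  rewrite /jostC ler_pM2l ?mulr_gt0//.
  exact: gweight_le.
have iqZ := gweight_integrableZ cqm qm0 iqm (8 * 2).
have d := vint_mder (mcont_propag m zeta) (fun s t => propagD m s t z0) (propag0 m zeta) cU
  (@lweight_gt0 R) (NU hz) (mder_propag_opp m z0) cg gb iqZ.
have := mderB (mder_cst (jvec zeta)) d.
rewrite -(funext ge); apply: eq_mder => x.
(* Differentiating gives [genmx] applied to minus the Volterra term, which equals [genmx] applied to
   [g] because [jvec] lies in the kernel. *)
rewrite sub0r mulmxDl opprB addrC; congr (_ + _).
by rewrite [in RHS]ge mulmxBr genmx_jvec sub0r.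
Qed.

Definition jost_sol zeta g := [/\
  mder g (fun x => (genmx m zeta + U x) *m g x),
  forall x, mnorm (g x) <= jostC * lweight x & jost_eq zeta g].

Lemma jost_cont zeta g : jost_sol zeta g -> mcont g.
Proof. by case=> dg _ _; exact: mder_cont dg. Qed.

Let mray x : measurable (`[x, +oo[%classic : set (measurableTypeR R)).
Proof. exact: measurable_itv. Qed.

Let iray c x : mu.-integrable `[x, +oo[ (EFin \o (fun y => c * q y)).
Proof.
have iqx : mu.-integrable `[x, +oo[ (EFin \o q).
  by apply: integrableS iq => //; exact: mray.
exact: (integrableZl (mray x) c iqx).
Qed.

Lemma jost_limit zeta g e : half_disc zeta -> jost_sol zeta g -> 0 < e ->
  exists M, forall x, M <= x -> mnorm (g x - jvec zeta) <= e.
Proof.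
move=> hz sg e0; have [dg gb ge] := sg.
have c0 : 0 < jostC * cm by rewrite mulr_gt0 ?jostC_gt0.
have [M HM] := tail_lt iq q0 (divr_gt0 e0 c0).
(* On the half-line x >= 0 the weight is 1, so the tail of q alone controls the error. *)
exists (Num.max M 0) => x; rewrite ge_max => /andP[Mx x0].
have -> : g x - jvec zeta = - vint (propag m zeta) U g x.
  by rewrite ge addrAC subrr sub0r.
rewrite mnormN.
have mg : mmeas setT g by apply: mcont_meas => //; exact: jost_cont sg.
have gh y : mnorm (g y) <= lweight y * jostC by rewrite mulrC.
have ih : mu.-integrable `[x, +oo[ (EFin \o (fun y => qm y * jostC)).
  have := iray (jostC * cm) x; congr (integrable _ _ (EFin \o _)).
  by apply/funext => y; rewrite /qm; ring.
have [_ H] := vint_le (mcont_propag m zeta) cU (@lweight_gt0 R) (NU hz) mg gh ih.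
apply: (le_trans H); rewrite lweight_nonneg// mul1r.
have -> : \int[mu]_(y in `[x, +oo[) (qm y * jostC) =
    (jostC * cm) * \int[mu]_(y in `[x, +oo[) q y.
  have iqx : mu.-integrable `[x, +oo[ (EFin \o q).
    by apply: integrableS iq => //; exact: mray.
  rewrite -(RintegralZl _ (mray x) iqx); apply: eq_Rintegral => y _.
  by rewrite /qm; ring.
by rewrite mulrC -ler_pdivlMr// ltW// HM.
Qed.

Lemma jost_neq0 zeta g a : jost_eq zeta g -> ~ (forall x, a <= x -> g x = 0).
Proof.
move=> ge g0; have := ge a; rewrite g0// /vint.
have -> : mint `[a, +oo[ (fun y => propag m zeta (y - a) *m U y *m g y) = 0.
  apply/matrixP => i j; rewrite !mxE -[RHS](cint0 `[a, +oo[).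
  apply: eq_cint => y /=; rewrite in_itv /= andbT => ay.
  by rewrite g0// mulmx0 mxE.
rewrite subr0 => /matrixP/(_ 0 0); rewrite !mxE /= => /esym/eqP.
by rewrite oner_eq0.
Qed.

(** For k != 0 the propagator is bounded, so the same Volterra equation can be estimated with the
    constant weight 1. The bound degenerates at the thresholds and is meant for the resolvent at a
    fixed energy. *)
Lemma jost_bounded zeta g : half_disc zeta -> momentum m zeta != 0 -> jost_sol zeta g ->
  exists2 b, 0 < b & forall x, mnorm (g x) <= b.
Proof.
move=> hz kn0 sg; have [dg gb ge] := sg; have [z0 z1 _] := hz.
pose K := 2 + 4 * m / cabs zeta / cabs (momentum m zeta).
have K0 : 0 <= K.
  by rewrite addr_ge0// divr_ge0 ?cabs_ge0// divr_ge0 ?cabs_ge0// mulr_ge0// ltW.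
have cq' : continuous (fun x => K * q x).
  by move=> x; apply: cvgM; [exact: cvg_cst|exact: cq].
have q0' x : 0 <= K * q x by rewrite mulr_ge0.
have iq' : mu.-integrable setT (EFin \o (fun x => K * q x)).
  exact: (integrableZl measurableT K iq).
have NU' x y : x <= y -> mnorm (propag m zeta (y - x) *m U y) * 1 <= 1 * (K * q y).
  move=> xy; rewrite mulr1 mul1r (le_trans (mnormM _ _))// ler_pM ?mnorm_ge0//.
  by apply: mnorm_propag_bounded; rewrite ?subr_ge0.
have gl c : exists b, forall x, c <= x -> mnorm (g x) <= 1 * b.
  exists (jostC * lweight c) => x cx; rewrite mul1r (le_trans (gb x))//.
  by rewrite ler_wpM2l ?lweight_homo// ltW// jostC_gt0.
have Fb (x : R) : mnorm (jvec zeta) <= 1 * 2.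
  by rewrite mul1r mnorm_jvec; lra.
exists (2 * 2 * expR (2 * \int[mu]_y (K * q y))) => [|x].
  by rewrite !mulr_gt0// expR_gt0.
have two0 : 0 <= 2 :> R by [].
have cw1 : continuous (fun _ : R => 1 : R) by move=> y; exact: cvg_cst.
have w1 (y : R) : 0 < 1 :> R by [].
have := volterra_bound (mcont_propag m zeta) cU q0' w1 NU' cq' iq'
  two0 cw1 (jost_cont sg) gl Fb ge x.
by rewrite mul1r.
Qed.

Let powR_min (s : R) : 0 <= s -> Num.min 1 s <= s `^ theta.
Proof.
move=> s0; have [s1|s1] := leP 1 s.
  by rewrite -(powRr0 s) ler_powR// ltW.
move: s0; rewrite le_eqVlt => /predU1P[<-|s0]; first exact: powR_ge0.
by rewrite ger1_powR// s0 ltW.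
Qed.

(** Uses min(1, ds) <= (ds)^theta. A small power of the distance [d] is gained while the growth in
    [s] stays barely above linear instead of quadratic. *)
Let interpolate (X a b d s : R) : 0 <= a -> 0 <= b -> 0 <= d -> 1 <= s ->
  X <= a * s -> X <= b * d * s ^+ 2 -> X <= (a + b) * d `^ theta * s `^ (1 + theta).
Proof.
move=> a0 b0 d0 s1 Xa Xb; have s0 : 0 < s by lra.
have -> : (a + b) * d `^ theta * s `^ (1 + theta) = (a + b) * s * (d * s) `^ theta.
  have -> : s `^ (1 + theta) = s * s `^ theta.
    by rewrite powRD ?powRr1 ?(ltW s0)// (gt_eqF s0) implybT.
  by rewrite (powRM _ d0 (ltW s0)); ring.
have ds0 : 0 <= d * s by rewrite mulr_ge0// ltW.
apply: (@le_trans _ _ ((a + b) * s * Num.min 1 (d * s))); last first.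
  by rewrite ler_wpM2l ?powR_min// mulr_ge0 ?addr_ge0// ltW.
have [ds1|ds1] := leP 1 (d * s).
  by rewrite mulr1 (le_trans Xa)// ler_wpM2r ?(ltW s0)// lerDl.
apply: (le_trans Xb); rewrite mulrDl mulrDl.
have : 0 <= a * s * (d * s) by rewrite mulr_ge0// mulr_ge0// ltW.
have -> : b * d * s ^+ 2 = b * s * (d * s) by ring.
lra.
Qed.

Let w2 x := lweight x `^ (1 + theta).
Let w2_gt0 x : 0 < w2 x. Proof. exact/powR_gt0/lweight_gt0. Qed.
Let w2_cont : continuous w2.
Proof.
move=> x; apply: (@continuous_comp _ _ _ lweight (fun y => y `^ (1 + theta))).
  exact: lweight_continuous.
apply: differentiable_continuous; apply/derivable1_diffP.
by have [] := is_derive1_powR (1 + theta) (lweight_gt0 x).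
Qed.

(** The difference of two Jost solutions solves a Volterra equation with one of the two propagators;
    the other propagator enters only through a source, small by [interpolate]. The estimate is run
    with the weight [lweight] to the power 1 + theta, and this is why [Uq] asks for the square of
    [bweight] to that power. *)
Lemma jost_holder r : 0 < r -> exists2 K, 0 <= K &
  forall z w g h, half_disc z -> half_disc w -> r <= cabs z -> r <= cabs w ->
    jost_sol z g -> jost_sol w h ->
    forall x, mnorm (g x - h x) <= K * cabs (z - w) `^ theta * lweight x `^ (1 + theta).
Proof.
move=> r0; have [L L0 HL] := propag_lipschitz m0 r0.
pose D := 2 * cm + L.
have D0 : 0 <= D by rewrite addr_ge0// mulr_ge0// ltW.
pose I := \int[mu]_y q y.
have I0 : 0 <= I by apply: Rintegral_ge0.
pose K0 := 2 + D * jostC * I.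
have K00 : 0 <= K0.
  by rewrite addr_ge0// mulr_ge0// mulr_ge0// ltW// jostC_gt0.
exists (2 * K0 * expR (2 * \int[mu]_y qm y)) => [|z w g h hz hw rz rw sg sh x].
  by rewrite mulr_ge0 ?expR_ge0// mulr_ge0.
have [dg gb ge] := sg; have [dh hb he] := sh.
have [z0 z1 _] := hz; have [w0 w1 _] := hw.
set d := cabs (z - w); have d0 : 0 <= d by exact: cabs_ge0.
(* Points of the unit disc are at distance at most 2, so a distance is dominated by twice its power
   theta. *)
have dth : d <= 2 * d `^ theta.
  have d2 : d <= 2 by apply: (le_trans (cabsB _ _)); lra.
  have := powR_min d0; case: (leP 1 d) => *; lra.
have sw x' y : x' <= y -> (1 + (y - x')) `^ (1 + theta) <= w2 x' * bweight y `^ (1 + theta).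
  move=> xy; rewrite /w2 -powRM ?(ltW (lweight_gt0 _)) ?(ltW (bweight_gt0 _))//.
  apply: ge0_ler_powR; rewrite ?nnegrE ?shift_le_weight//.
  - have := theta0; lra.
  - lra.
  - by rewrite mulr_ge0// ltW ?lweight_gt0 ?bweight_gt0.
have w2b y : w2 y <= bweight y `^ (1 + theta).
  apply: ge0_ler_powR; rewrite ?nnegrE ?lweight_le// ?(ltW (lweight_gt0 _)) ?(ltW (bweight_gt0 _))//.
  have := theta0; lra.
pose N := propag m z; pose N' := propag m w.
have NUw c (hc : half_disc c) x' y : x' <= y ->
    mnorm (propag m c (y - x') *m U y) * w2 y <= w2 x' * qm y.
  move=> xy; have yx0 : 0 <= y - x' by rewrite subr_ge0.
  have s1 : 1 <= 1 + (y - x') by lra.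
  apply: (@le_trans _ _ (cm * (w2 x' * bweight y `^ (1 + theta)) * mnorm (U y) *
      bweight y `^ (1 + theta))).
    apply: ler_pM; rewrite ?mnorm_ge0 ?(ltW (w2_gt0 _))//.
    apply: (le_trans (mnormM _ _)); rewrite ler_wpM2r ?mnorm_ge0//.
    apply: (le_trans (mnorm_propag m0 hc yx0)); rewrite ler_pM2l//.
    apply: le_trans (sw _ _ xy).
    rewrite -[leLHS]powRr1; last lra.
    by rewrite ler_powR// lerDl ltW.
  have -> : w2 x' * qm y = cm * w2 x' * q y by rewrite /qm; ring.
  apply: (@le_trans _ _ (cm * w2 x' * (mnorm (U y) * bweight y `^ (1 + theta) ^+ 2))).
    by apply: eq_ler; ring.
  by rewrite ler_wpM2l// mulr_ge0// ltW.
pose q2 y := D * d `^ theta * q y.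
have DUw x' y : x' <= y ->
    mnorm ((N (y - x') - N' (y - x')) *m U y) * w2 y <= w2 x' * q2 y.
  move=> xy; have yx0 : 0 <= y - x' by rewrite subr_ge0.
  have s1 : 1 <= 1 + (y - x') by lra.
  apply: (@le_trans _ _ (D * d `^ theta * (w2 x' * bweight y `^ (1 + theta)) * mnorm (U y) *
      bweight y `^ (1 + theta))).
    apply: ler_pM; rewrite ?mnorm_ge0 ?(ltW (w2_gt0 _))//.
    apply: (le_trans (mnormM _ _)); rewrite ler_wpM2r ?mnorm_ge0//.
    apply: (@le_trans _ _ (D * d `^ theta * (1 + (y - x')) `^ (1 + theta))).
      apply: interpolate => //; first by rewrite mulr_ge0// ltW.
        apply: (le_trans (mnormB _ _)).
        apply: (le_trans (lerD (mnorm_propag m0 hz yx0) (mnorm_propag m0 hw yx0))).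
        by rewrite -/cm -mulrDl -mulr2n mulr_natl.
      exact: HL.
    by rewrite ler_wpM2l ?sw// mulr_ge0// powR_ge0.
  have -> : w2 x' * q2 y = D * d `^ theta * w2 x' * q y by rewrite /q2; ring.
  apply: (@le_trans _ _ (D * d `^ theta * w2 x' * (mnorm (U y) * bweight y `^ (1 + theta) ^+ 2))).
    by apply: eq_ler; ring.
  by rewrite ler_wpM2l// mulr_ge0 ?(ltW (w2_gt0 _))// mulr_ge0// powR_ge0.
have q20 y : 0 <= q2 y by rewrite mulr_ge0// mulr_ge0// powR_ge0.
have cg := jost_cont sg; have ch := jost_cont sh.
have mg : mmeas setT g by exact: mcont_meas.
have mh : mmeas setT h by exact: mcont_meas.
have gw y : mnorm (g y) <= w2 y * jostC.
  by apply: (le_trans (gb y)); rewrite mulrC ler_wpM2r ?pl// ltW// jostC_gt0.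
have hw' y : mnorm (h y) <= w2 y * jostC.
  by apply: (le_trans (hb y)); rewrite mulrC ler_wpM2r ?pl// ltW// jostC_gt0.
have iqc c y : mu.-integrable `[y, +oo[ (EFin \o (fun t => qm t * c)).
  have := iray (c * cm) y; congr (integrable _ _ (EFin \o _)).
  by apply/funext => t; rewrite /qm; ring.
have iq2 y : mu.-integrable `[y, +oo[ (EFin \o (fun t => q2 t * jostC)).
  have := iray (D * d `^ theta * jostC) y; congr (integrable _ _ (EFin \o _)).
  by apply/funext => t; rewrite /q2; ring.
have cNN : mcont (fun t => N t - N' t) by apply: mcontB; exact: mcont_propag.
(* The source of the equation for g - h: the change of the amplitude at +oo and the change of the
   propagator acting on [h]. *)
pose F y := (jvec z - jvec w) - vint (fun t => N t - N' t) U h y.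
have iN1 y := (vint_le (mcont_propag m z) cU w2_gt0 (NUw _ hz) mg gw (iqc _ y)).1.
have iN2 y := (vint_le (mcont_propag m z) cU w2_gt0 (NUw _ hz) mh hw' (iqc _ y)).1.
have iD y := vint_le cNN cU w2_gt0 DUw mh hw' (iq2 y).
have dE y : g y - h y = F y - vint N U (fun t => g t - h t) y.
  have E1 : vint N U (fun t => g t - h t) y = vint N U g y - vint N U h y.
    rewrite /vint -(mintB (mray y) (iN1 y) (iN2 y)).
    by apply: eq_mint => t _; rewrite mulmxBr.
  have E2 : vint (fun t => N t - N' t) U h y = vint N U h y - vint N' U h y.
    have iN' : mintegrable `[y, +oo[ (fun t => N' (t - y) *m U t *m h t).
      by have [] := vint_le (mcont_propag m w) cU w2_gt0 (NUw _ hw) mh hw' (iqc jostC y).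
    rewrite /vint -(mintB (mray y) (iN2 y) iN').
    by apply: eq_mint => t _; rewrite !mulmxBl.
  rewrite /F E1 E2 ge he -/N -/N'.
  move: (vint N U g y) (vint N U h y) (vint N' U h y) => A B D'.
  by apply/matrixP => i j; rewrite !mxE; ring.
have Fb y : mnorm (F y) <= w2 y * (K0 * d `^ theta).
  apply: (le_trans (mnormB _ _)).
  have [_ H] := iD y.
  have H1 : mnorm (jvec z - jvec w) <= w2 y * (2 * d `^ theta).
    have -> : mnorm (jvec z - jvec w) = d.
      by rewrite mnorm_cV2 !mxE /= subrr cabs0 add0r.
    rewrite (le_trans dth)// ler_peMl ?mulr_ge0 ?powR_ge0//.
    exact: le_trans (lweight_ge1 y) (pl y).
  have H2 : \int[mu]_(t in `[y, +oo[) (q2 t * jostC) <= D * jostC * I * d `^ theta.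
    have iqx : mu.-integrable `[y, +oo[ (EFin \o q).
      by apply: integrableS iq => //; exact: mray.
    have -> : \int[mu]_(t in `[y, +oo[) (q2 t * jostC) =
        (D * d `^ theta * jostC) * \int[mu]_(t in `[y, +oo[) q t.
      rewrite -(RintegralZl _ (mray y) iqx); apply: eq_Rintegral => t _.
      by rewrite /q2; ring.
    have -> : D * jostC * I * d `^ theta = D * d `^ theta * jostC * I by ring.
    rewrite ler_wpM2l//.
      by rewrite mulr_ge0 ?(ltW jostC_gt0)// mulr_ge0// powR_ge0.
    exact: Rintegral_ray_le.
  apply: (le_trans (lerD H1 H)); rewrite -mulrDr ler_wpM2l ?(ltW (w2_gt0 _))//.
  by apply: (le_trans (lerD (lexx _) H2)); apply: eq_ler; rewrite /K0; ring.
have K0d : 0 <= K0 * d `^ theta by rewrite mulr_ge0 ?powR_ge0.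
have gl c : exists b, forall y, c <= y -> mnorm (g y - h y) <= w2 y * b.
  exists (jostC + jostC) => y _; apply: (le_trans (mnormB _ _)).
  by rewrite mulrDr lerD.
have := volterra_bound (mcont_propag m z) cU qm0 w2_gt0 (NUw _ hz) cqm iqm
  K0d w2_cont (mcontB cg ch) gl Fb dE x.
by move=> H; apply: (le_trans H); apply: eq_ler; rewrite /w2; ring.
Qed.

End Jost.

(** * The Dirac equation as a first-order system: current and Wronskian *)

Section DiracSystem.
Context {R : realType}.
Local Notation C := R[i].
Local Notation Re := complex.Re.
Local Notation Im := complex.Im.
Local Notation mu := (@lebesgue_measure R).
Implicit Types (u p r : R -> 'cV[C]_2) (x : R) (z zeta : C).

Lemma alphaE : alpha = \matrix_(i, j) (if i == j then (if i == 0 then -1 else 1) else 0) :> 'M[C]_2.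
Proof.
apply/matrixP => i j; rewrite /alpha /block_mx !mxE.
case: splitP => a; rewrite (ord1 a) => Ha; rewrite mxE; case: splitP => b;
  rewrite (ord1 b) => Hb; rewrite !mxE.
all: by case: (I2P i) Ha => -> // _; case: (I2P j) Hb => -> //= _; rewrite ?mulr1n.
Qed.

Lemma betaE : beta = \matrix_(i, j) (if i == j then 0 else 1) :> 'M[C]_2.
Proof.
apply/matrixP => i j; rewrite /beta /block_mx !mxE.
case: splitP => a; rewrite (ord1 a) => Ha; rewrite mxE; case: splitP => b;
  rewrite (ord1 b) => Hb; rewrite !mxE.
all: by case: (I2P i) Ha => -> // _; case: (I2P j) Hb => -> //= _; rewrite ?mulr1n.
Qed.

(** The Dirac current, the Hermitian form of alpha. Being indefinite, it separates waves coming from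
    the two ends. *)
Definition curr (v : 'cV[C]_2) : R := cabs (v 1 0) ^+ 2 - cabs (v 0 0) ^+ 2.

Lemma beta_sqr : beta *m beta = 1%:M :> 'M[C]_2.
Proof. by rewrite betaE; apply/mx2P; rewrite mulmx2E !mxE /=; ring. Qed.
Lemma betaM (v : 'cV[C]_2) i : (beta *m v) i 0 = if i == 0 then v 1 0 else v 0 0.
Proof. by rewrite betaE; case: (I2P i) => ->; rewrite mulmx2E !mxE /=; ring. Qed.
Lemma colBE (v w : 'cV[C]_2) i : (v - w) i 0 = v i 0 - w i 0.
Proof. by rewrite !mxE. Qed.
Lemma colZE a (v : 'cV[C]_2) i : (a *: v) i 0 = a * v i 0.
Proof. by rewrite mxE. Qed.
Lemma alphaM (v : 'cV[C]_2) i : (alpha *m v) i 0 = if i == 0 then - v 0 0 else v 1 0.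
Proof. by rewrite alphaE; case: (I2P i) => ->; rewrite mulmx2E !mxE /=; ring. Qed.
Lemma curr_beta (v : 'cV[C]_2) : curr (beta *m v) = - curr v.
Proof. by rewrite /curr !betaM /= opprB. Qed.
Lemma mnorm_beta (v : 'cV[C]_2) : mnorm (beta *m v) = mnorm v.
Proof. by rewrite !mnorm_cV2 !betaM /= addrC. Qed.
Lemma currZ a (v : 'cV[C]_2) : curr (a *: v) = cabs a ^+ 2 * curr v.
Proof. by rewrite /curr !mxE !cabsM !exprMn mulrBr. Qed.

Lemma curr_dist (v w : 'cV[C]_2) :
  `|curr v - curr w| <= mnorm (v - w) * (mnorm v + mnorm w).
Proof.
have H (a b : C) : `|cabs a ^+ 2 - cabs b ^+ 2| <= cabs (a - b) * (cabs a + cabs b).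
  rewrite subr_sqr normrM [X in _ * X]ger0_norm ?addr_ge0 ?cabs_ge0//.
  rewrite ler_wpM2r ?addr_ge0 ?cabs_ge0// ler_norml.
  have h1 := cabsD (a - b) b; have h2 := cabsD (b - a) a.
  by rewrite subrK in h1; rewrite subrK (cabs_distC b) in h2; apply/andP; split; lra.
have -> : curr v - curr w = (cabs (v 1 0) ^+ 2 - cabs (w 1 0) ^+ 2) -
    (cabs (v 0 0) ^+ 2 - cabs (w 0 0) ^+ 2) by rewrite /curr; ring.
apply: (le_trans (ler_normB _ _)); apply: (le_trans (lerD (H _ _) (H _ _))).
rewrite !mnorm_cV2 !mxE.
have := cabs_ge0 (v 0 0 - w 0 0); have := cabs_ge0 (v 1 0 - w 1 0).
have := cabs_ge0 (v 0 0); have := cabs_ge0 (w 0 0).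
have := cabs_ge0 (v 1 0); have := cabs_ge0 (w 1 0); nra.
Qed.

Definition det2 (v w : 'cV[C]_2) : C := v 0 0 * w 1 0 - v 1 0 * w 0 0.

(* The Gram determinant of the indefinite Hermitian form
   [v, w] = conj v_1 w_1 - conj v_0 w_0 is - |det (v, w)|^2. *)
Lemma det2_curr (v w : 'cV[C]_2) : - (curr v * curr w) <= cabs (det2 v w) ^+ 2.
Proof.
have -> : cabs (det2 v w) ^+ 2 = - (curr v * curr w) +
   cabs (conjc (v 1 0) * w 1 0 - conjc (v 0 0) * w 0 0) ^+ 2.
  rewrite /curr /det2 !sqr_cabs !(ReD, ImD, ReN, ImN, ReM, ImM).
  case: (v 0 0) => a b; case: (v 1 0) => c d; case: (w 0 0) => e f; case: (w 1 0) => g h /=.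
  ring.
by rewrite lerDl sqr_ge0.
Qed.

Lemma is_derive_sqr_cabs F F' x : cder F F' ->
  is_derive x 1 (fun x => cabs (F x) ^+ 2)
    (2 * (Re (F x) * Re (F' x) + Im (F x) * Im (F' x))).
Proof.
move=> dF; have [a b] := dF x; under eq_fun do rewrite sqr_cabs !expr2.
apply: (is_derive_eq (is_derive_add (is_derive_mul a a) (is_derive_mul b b))).
by ring.
Qed.

Lemma derive0_cst (f : R -> R) x : (forall y : R, is_derive y 1 f 0) -> f x = f 0.
Proof. by move=> df; apply: is_derive_0_is_cst. Qed.

Lemma cabs_phase (W : R -> C) (tau : R -> R) x :
  cder W (fun x => ci * ((tau x)%:C)%C * W x) -> cabs (W x) = cabs (W 0).
Proof.
move=> dW; apply/eqP; rewrite -(@eqrXn2 _ 2)// ?cabs_ge0//; apply/eqP.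
apply: (derive0_cst (f := fun x => cabs (W x) ^+ 2)) => y.
apply: (is_derive_eq (is_derive_sqr_cabs y dW)).
by rewrite !(ReM, ImM) /=; ring.
Qed.

Section Operator.
Variables (m : R) (V : R -> 'M[C]_2).
Hypotheses (m0 : 0 < m) (saV : self_adjoint V) (cV : continuous_entries V).
Local Notation mC := ((m%:C)%C : C).

Definition potmx x : 'M[C]_2 := ci *: (alpha *m V x).
(** The coefficient matrix of u' when H u = z u is solved for the derivative by means of alpha^2 =
    1. *)
Definition dmx z x : 'M[C]_2 := potmx x - ci *: (alpha *m (z%:M - mC *: beta)).

Lemma mcontV : mcont V.
Proof. by move=> i j; have [a b] := cV i j; split. Qed.
Lemma mcont_potmx : mcont potmx.
Proof.
apply: mcontZ; first exact: ccont_cst.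
by apply: mcontM; [exact: mcont_cst|exact: mcontV].
Qed.
Lemma mcont_dmx z : mcont (dmx z).
Proof. by apply: mcontB; [exact: mcont_potmx|exact: mcont_cst]. Qed.

Lemma mnorm_potmx x : mnorm (potmx x) = mnorm (V x).
Proof.
rewrite /potmx mnormZ cabsi mul1r alphaE !mnorm_M2 !mulmx2E !mxE /=.
by rewrite !mul0r !mulN1r !mul1r !add0r !addr0 !cabsN.
Qed.

Lemma genmxE zeta : zeta != 0 ->
  genmx m zeta = - (ci *: (alpha *m ((energy m zeta)%:M - mC *: beta)))
    - (ci * momentum m zeta)%:M.
Proof.
move=> z0; apply/mx2P; rewrite alphaE betaE !mxE !sum2E !mxE /= /energy /momentum
  ?mulr1n ?mulr0n; field; rewrite ?z0 //.
Qed.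

Lemma V_adj x : [/\ Im (V x 0 0) = 0, Im (V x 1 1) = 0,
  Re (V x 1 0) = Re (V x 0 1) & Im (V x 1 0) = - Im (V x 0 1)].
Proof.
have /matrixP H := saV x.
have := H 0 0; have := H 1 1; have := H 0 1; rewrite !mxE.
case: (V x 0 0) => a b; case: (V x 1 1) => c d; case: (V x 0 1) => e f.
case: (V x 1 0) => g h /= [<- <-] [Hd] [Hb]; split=> //=; first lra; first lra.
by rewrite opprK.
Qed.

Lemma dmx0E z x (v : 'cV[C]_2) : (dmx z x *m v) 0 0 =
  ci * (z * v 0 0 - mC * v 1 0 - (V x 0 0 * v 0 0 + V x 0 1 * v 1 0)).
Proof.
rewrite /dmx /potmx mulmxBl -!scalemxAl -!mulmxA mulmxBl mul_scalar_mx -scalemxAl.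
rewrite !(colBE, colZE, alphaM, betaM) /= !mulmx2E.
move: (v 0 0) (v 1 0) (V x 0 0) (V x 0 1) => a b c d; ring.
Qed.
Lemma dmx1E z x (v : 'cV[C]_2) : (dmx z x *m v) 1 0 =
  - ci * (z * v 1 0 - mC * v 0 0 - (V x 1 0 * v 0 0 + V x 1 1 * v 1 0)).
Proof.
rewrite /dmx /potmx mulmxBl -!scalemxAl -!mulmxA mulmxBl mul_scalar_mx -scalemxAl.
rewrite !(colBE, colZE, alphaM, betaM) /= !mulmx2E.
move: (v 0 0) (v 1 0) (V x 1 0) (V x 1 1) => a b c d; ring.
Qed.

(** Self-adjointness of V and reality of m cancel everything except the imaginary part of z: the
    current is conserved at real energies and nondecreasing in the upper half-plane. *)
Lemma curr_derive z u x : mder u (fun x => dmx z x *m u x) ->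
  is_derive x 1 (fun x => curr (u x))
    (2 * Im z * (cabs (u x 0 0) ^+ 2 + cabs (u x 1 0) ^+ 2)).
Proof.
move=> du.
have := is_derive_sub (is_derive_sqr_cabs x (du 1 0)) (is_derive_sqr_cabs x (du 0 0)).
move=> H; apply: (is_derive_eq H); rewrite dmx0E dmx1E !sqr_cabs.
have [h1 h2 h3 h4] := V_adj x.
rewrite !(ReD, ImD, ReN, ImN, ReM, ImM) h1 h2 h3 h4 /=; ring.
Qed.

(** Liouville's formula. Both alpha and alpha beta are traceless, so z and m drop out of the trace;
    the diagonal of V is real, so the trace that remains is purely imaginary. *)
Lemma det2_derive (u1 u2 : R -> 'cV[C]_2) z : mder u1 (fun x => dmx z x *m u1 x) ->
  mder u2 (fun x => dmx z x *m u2 x) ->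
  cder (fun x => det2 (u1 x) (u2 x))
    (fun x => ci * (((Re (V x 1 1) - Re (V x 0 0))%:C)%C) * det2 (u1 x) (u2 x)).
Proof.
move=> d1 d2.
have H := cderB (cderM (d1 0 0) (d2 1 0)) (cderM (d1 1 0) (d2 0 0)).
apply: eq_cder H => x; rewrite !dmx0E !dmx1E /det2.
have [h1 h2 _ _] := V_adj x.
have {1}-> : (((Re (V x 1 1) - Re (V x 0 0))%:C)%C : C) = V x 1 1 - V x 0 0.
  apply: complexP; rewrite ?ReD ?ImD ?ReN ?ImN ?h1 ?h2 //=; lra.
ring.
Qed.

Lemma jost_mder zeta (g : R -> 'cV[C]_2) : zeta != 0 -> mder g (fun x => (genmx m zeta + potmx x) *m g x) ->
  mder (fun x => cexp (momentum m zeta) x *: g x)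
    (fun x => dmx (energy m zeta) x *m (cexp (momentum m zeta) x *: g x)).
Proof.
move=> z0 dg; apply: eq_mder (mderZ (cder_cexp _) dg) => x.
rewrite (genmxE z0) -scalemxAr -[_ * cexp _ _]mulrC -scalerA -scalerDr; congr (_ *: _).
rewrite /dmx !mulmxDl !mulNmx mul_scalar_mx.
have aux (a b c : 'cV[C]_2) : a + (- b - a + c) = c - b.
  by apply/matrixP => i j; rewrite !mxE; ring.
exact: aux.
Qed.

End Operator.

End DiracSystem.

(** * Weak derivatives and spinor norms *)

Section WeakDerivatives.
Context {R : realType}.
Local Notation C := R[i].
Local Notation Re := complex.Re.
Local Notation Im := complex.Im.
Local Notation mu := (@lebesgue_measure R).
Implicit Types (phi : R -> R) (f u g : R -> 'cV[C]_2).

Lemma distrE f phi : distr f phi = mint setT (fun x => ((phi x)%:C)%C *: f x).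
Proof. by apply/matrixP => i j; rewrite (ord1 j) !mxE. Qed.

Lemma test_functionP phi : test_function phi -> [/\ continuous phi, continuous (phi^`())%classic,
  forall x : R, is_derive x 1 phi ((phi^`())%classic x) &
  exists2 L, 0 < L & forall x, L <= `|x| -> phi x = 0].
Proof.
move=> [dphi [M HM]].
have d0 (x : R) : derivable phi x 1 := dphi 0%N x.
have d1 (x : R) : derivable (phi^`())%classic x 1 := dphi 1%N x.
split.
- by move=> x; apply: differentiable_continuous; apply/derivable1_diffP; exact: d0.
- by move=> x; apply: differentiable_continuous; apply/derivable1_diffP; exact: d1.
- by move=> x; apply: DeriveDef; [exact: d0|rewrite derive1E].
- exists (`|M| + 1) => [|x Lx]; first by rewrite ltr_wpDl.
  by apply: HM; apply: lt_le_trans Lx; have := ler_norm M; lra.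
Qed.

Lemma test_integrable phi (p q : nat) (F : R -> 'M[C]_(p, q)) : test_function phi ->
  (forall a b, mintegrable `[a, b] F) -> mintegrable setT (fun x => ((phi x)%:C)%C *: F x).
Proof.
move=> /test_functionP[cphi _ _ [L L0 phi0]] iF i j.
have mI : measurable (`[- L, L]%classic : set (measurableTypeR R)) by exact: measurable_itv.
have H (f : R -> R) : mu.-integrable `[- L, L] (EFin \o f) ->
    mu.-integrable setT (EFin \o (fun x => phi x * f x)).
  move=> fi; have := integrable_patch mI (integrable_itv_mul cphi fi).
  congr (integrable _ _ (EFin \o _)); apply/funext => x.
  rewrite patchE; case: ifPn => [//|/itv_notinP/ltW Lx].
  by rewrite (phi0 _ Lx) mul0r.
have [a b] := iF (- L) L i j; split.
  have := H _ a; congr (integrable _ _ (EFin \o _)); apply/funext => x.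
  by rewrite mxE ReM /=; ring.
have := H _ b; congr (integrable _ _ (EFin \o _)); apply/funext => x.
by rewrite mxE ImM /=; ring.
Qed.

Lemma mcont_integrable p q (F : R -> 'M[C]_(p, q)) a b : mcont F -> mintegrable `[a, b] F.
Proof. by move=> cF i j; have [H1 H2] := cF i j; split; exact: continuous_itv_integrable. Qed.

Lemma mprimitive_weak u g : mprimitive u g -> weak_derivative u g.
Proof.
move=> pu phi tphi; rewrite !distrE; apply/matrixP => i j; rewrite !mxE.
have [cphi cphi' dphi [L L0 phi0]] := test_functionP tphi.
have [p1 p2] := pu i j.
have [_ _ E1] := primitive_ibp L0 p1 cphi' dphi phi0.
have [_ _ E2] := primitive_ibp L0 p2 cphi' dphi phi0.
apply: complexP; rewrite ?ReN ?ImN /=.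
  transitivity (\int[mu]_x (phi x * Re (g x i j))).
    by apply: eq_Rintegral => x _; rewrite mxE ReM /=; ring.
  rewrite -[LHS]opprK -E1; congr (- _).
  by apply: eq_Rintegral => x _; rewrite mxE ReM /=; ring.
transitivity (\int[mu]_x (phi x * Im (g x i j))).
  by apply: eq_Rintegral => x _; rewrite mxE ImM /=; ring.
rewrite -[LHS]opprK -E2; congr (- _).
by apply: eq_Rintegral => x _; rewrite mxE ImM /=; ring.
Qed.

Lemma spinor_normE (v : 'cV[C]_2) :
  spinor_norm v = Num.sqrt (cabs (v 0 0) ^+ 2 + cabs (v 1 0) ^+ 2).
Proof. by rewrite /spinor_norm sum2E !sqr_cabs. Qed.
Lemma spinor_norm_le (v : 'cV[C]_2) : spinor_norm v <= mnorm v.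
Proof.
rewrite spinor_normE mnorm_cV2 -[leRHS]ger0_norm ?addr_ge0 ?cabs_ge0//.
rewrite -sqrtr_sqr ler_wsqrtr// sqrrD -addrA lerD2l lerDr.
by rewrite mulrn_wge0// mulr_ge0 ?cabs_ge0.
Qed.
Lemma cabs_le_spinor (v : 'cV[C]_2) i : cabs (v i 0) <= spinor_norm v.
Proof.
rewrite spinor_normE -[leLHS]ger0_norm ?cabs_ge0// -sqrtr_sqr ler_wsqrtr//.
by case: (I2P i) => ->; rewrite ?lerDl ?lerDr sqr_ge0.
Qed.
Lemma mnorm_le_spinor (v : 'cV[C]_2) : mnorm v <= 2 * spinor_norm v.
Proof.
by rewrite mnorm_cV2; have := cabs_le_spinor v 0; have := cabs_le_spinor v 1; lra.
Qed.
Lemma spinor_norm_ge0 (v : 'cV[C]_2) : 0 <= spinor_norm v.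
Proof. exact: sqrtr_ge0. Qed.

Lemma spinor_measurableE f : spinor_measurable f <-> mmeas setT f.
Proof.
by split=> [mf i j|mf i]; [rewrite (ord1 j); exact: mf|exact: (mf i 0)].
Qed.

Lemma measurable_spinor_norm f : spinor_measurable f ->
  measurable_fun setT (fun x => spinor_norm (f x)).
Proof.
move=> mf; under eq_fun do rewrite spinor_normE.
apply: measurableT_comp; first exact: (continuous_measurable_fun (@sqrt_continuous R)).
by apply: measurable_funD; apply: measurable_funX; apply: cmeas_cabs => //; exact: mf.
Qed.

Lemma bounded_Linfty f b : mcont f -> (forall x, mnorm (f x) <= b) -> Linfty f.
Proof.
move=> cf fb; have sf : spinor_measurable f.
  by apply/spinor_measurableE; exact: mcont_meas.
split=> //; rewrite /LpN.
rewrite unlock; case: ifPn => _; last by rewrite ltry.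
apply: (@le_lt_trans _ _ b%:E); last exact: ltry.
apply/ess_supP; apply: aeW => x /=.
by rewrite lee_fin ger0_norm ?spinor_norm_ge0// (le_trans (spinor_norm_le _)).
Qed.

End WeakDerivatives.

(** * Classical solutions as distributional ones; uniqueness for the linear system *)

Section Threshold.
Context {R : realType}.
Local Notation C := R[i].
Local Notation Re := complex.Re.
Local Notation Im := complex.Im.
Local Notation mu := (@lebesgue_measure R).
Variables (m : R) (V : R -> 'M[C]_2).
Hypotheses (m0 : 0 < m) (saV : self_adjoint V) (cV : continuous_entries V).
Local Notation mC := ((m%:C)%C : C).
Implicit Types (psi u : R -> 'cV[C]_2).

Lemma alpha_sqr : alpha *m alpha = 1%:M :> 'M[C]_2.
Proof. by rewrite alphaE; apply/mx2P; rewrite mulmx2E !mxE /=; ring. Qed.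

Lemma distr_linear (A B : 'M[C]_2) (f g : R -> 'cV[C]_2) phi : test_function phi ->
  (forall a b, mintegrable `[a, b] f) -> (forall a b, mintegrable `[a, b] g) ->
  distr (fun x => A *m (f x - B *m g x)) phi = A *m (distr f phi - B *m distr g phi).
Proof.
move=> tphi fi gi; have mT : measurable [set: measurableTypeR R] by [].
have i1 := test_integrable tphi fi; have i2 := test_integrable tphi gi.
rewrite !distrE; set F := fun x => _ *: f x in i1 *; set G := fun x => _ *: g x in i2 *.
have i3 := mintegrable_mulmx B mT i2.
rewrite -(mint_mulmx B mT i2) -(mintB mT i1 i3).
have i13 : mintegrable setT (fun x => F x - B *m G x).
  move=> i j; have := cintegrableD mT (i1 i j) (cintegrableZ (-1) mT (i3 i j)).
  by congr cintegrable; apply/funext => x; rewrite !mxE mulN1r.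
rewrite -(mint_mulmx A mT i13); apply: eq_mint => x _; rewrite /F /G.
by rewrite [RHS]mulmxBr -!scalemxAr -scalerBr -mulmxBr.
Qed.

Lemma dmxE z x (v : 'cV[C]_2) : dmx m V z x *m v =
  (ci *: alpha) *m (V x *m v - (z%:M - mC *: beta) *m v).
Proof.
rewrite /dmx /potmx; move: (z%:M - _) => B.
by rewrite mulmxBl mulmxBr -!scalemxAl !mulmxA.
Qed.

Lemma ci_alphaK (Y : 'cV[C]_2) : ci *: (alpha *m ((ci *: alpha) *m Y)) = - Y.
Proof. by rewrite -scalemxAl -scalemxAr scalerA ciM mulmxA alpha_sqr mul1mx scaleN1r. Qed.

Lemma classical_distributional (E : R) psi :
  mder psi (fun x => dmx m V ((E%:C)%C) x *m psi x) -> distributional_solution m V E psi.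
Proof.
move=> dpsi phi tphi.
have cpsi := mder_cont dpsi.
have cVpsi : mcont (fun x => V x *m psi x) by apply: mcontM => //; exact: mcontV.
have cM : mcont (fun x => dmx m V ((E%:C)%C) x *m psi x).
  by apply: mcontM => //; exact: mcont_dmx.
have W := mprimitive_weak (mder_mprimitive cM dpsi) tphi.
have i1 a b := mcont_integrable a b cVpsi.
have i2 a b := mcont_integrable a b cpsi.
have E1 : distr psi (phi^`())%classic = - ((ci *: alpha) *m
    (distr (fun x => V x *m psi x) phi - (((E%:C)%C)%:M - mC *: beta) *m distr psi phi)).
  rewrite -(distr_linear _ _ tphi i1 i2) -[LHS]opprK -W; congr (- distr _ phi).
  by apply/funext => x; exact: dmxE.
rewrite E1; move: (distr (fun x => V x *m psi x) phi) (distr psi phi) => DV D.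
rewrite -[(0 +i* 1)%C]/ci mulmxN scalerN ci_alphaK opprK mulmxBl mul_scalar_mx -scalemxAl.
move: (beta *m D) => BD.
by apply/matrixP => i j; rewrite !mxE; ring.
Qed.

(** Energy method: the square norm [n] satisfies |n'| <= K n, so e^{-Kx} n decreases on the right of
    0 and e^{Kx} n increases on the left of 0. *)
Lemma ode_zero (z : C) (b : R) u : (forall x, mnorm (dmx m V z x) <= b) ->
  mder u (fun x => dmx m V z x *m u x) -> u 0 = 0 -> forall x, u x = 0.
Proof.
move=> Mb du u0.
have b0 : 0 <= b := le_trans (mnorm_ge0 _) (Mb 0).
pose n x := cabs (u x 0 0) ^+ 2 + cabs (u x 1 0) ^+ 2.
pose n' x := 2 * (Re (u x 0 0) * Re ((dmx m V z x *m u x) 0 0) +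
    Im (u x 0 0) * Im ((dmx m V z x *m u x) 0 0)) +
  2 * (Re (u x 1 0) * Re ((dmx m V z x *m u x) 1 0) +
    Im (u x 1 0) * Im ((dmx m V z x *m u x) 1 0)).
have dn (x : R) : is_derive x 1 n (n' x).
  exact: (is_derive_add (is_derive_sqr_cabs x (du 0 0)) (is_derive_sqr_cabs x (du 1 0))).
have n0 x : 0 <= n x by rewrite addr_ge0// sqr_ge0.
(* With entries of moduli a and c, |n'| is at most 4 b (a + c)^2, hence at most 8 b (a^2 + c^2). *)
pose K := 8 * b.
have n'le x : `|n' x| <= K * n x.
  have ReIm (F G : C) : `|2 * (Re F * Re G + Im F * Im G)| <= 4 * (cabs F * cabs G).
    rewrite normrM ger0_norm// (le_trans (ler_wpM2l _ (ler_normD _ _)))// !normrM.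
    have h1 := ler_pM (normr_ge0 _) (normr_ge0 _) (Re_le_cabs F) (Re_le_cabs G).
    have h2 := ler_pM (normr_ge0 _) (normr_ge0 _) (Im_le_cabs F) (Im_le_cabs G).
    lra.
  have H := le_trans (mnormM (dmx m V z x) (u x)) (ler_wpM2r (mnorm_ge0 _) (Mb x)).
  have H0 := le_trans (cabs_le_mnorm _ 0 0) H.
  have H1 := le_trans (cabs_le_mnorm _ 1 0) H.
  apply: (le_trans (ler_normD _ _)); apply: (le_trans (lerD (ReIm _ _) (ReIm _ _))).
  move: H0 H1; rewrite mnorm_cV2 /n /K.
  set d0 := cabs ((dmx m V z x *m u x) 0 0); set d1 := cabs ((dmx m V z x *m u x) 1 0).
  have := cabs_ge0 (u x 0 0); have := cabs_ge0 (u x 1 0).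
  move: (cabs (u x 0 0)) (cabs (u x 1 0)) d0 d1 => a c d0 d1 c0 a0 H0 H1.
  have h1 : a * d0 <= a * (b * (a + c)) by rewrite ler_wpM2l.
  have h2 : c * d1 <= c * (b * (a + c)) by rewrite ler_wpM2l.
  have h3 : 0 <= b * (a - c) ^+ 2 by rewrite mulr_ge0// sqr_ge0.
  have -> : 8 * b * (a ^+ 2 + c ^+ 2) = 4 * (a * (b * (a + c))) + 4 * (c * (b * (a + c)))
      + 4 * (b * (a - c) ^+ 2) by ring.
  lra.
have nE : n 0 = 0 by rewrite /n u0 !mxE cabs0 expr0n addr0.
have lin (a x : R) : is_derive x 1 (fun x => a * x) a.
  by apply: (is_derive_eq (is_derive_scale a (is_derive_id x 1))); rewrite mulr1.
have mono (s : R) (x : R) : is_derive x 1 (fun x => expR (s * x) * n x)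
    (expR (s * x) * (s * n x + n' x)).
  apply: (is_derive_eq (is_derive_mul (is_derive_expR_comp (lin s x)) (dn x))).
  by ring.
suff nx0 x : n x = 0.
  move=> x; have := nx0 x; rewrite /n => /eqP; rewrite paddr_eq0 ?sqr_ge0//.
  rewrite !sqrf_eq0 !cabs_eq0 => /andP[/eqP a0 /eqP a1].
  by apply/cV2P; rewrite mxE.
apply/eqP; rewrite eq_le n0 andbT.
have [x0|/ltW x0] := leP 0 x.
  have : expR (- K * x) * n x <= expR (- K * 0) * n 0.
    have dN (t : R) := is_derive_opp (mono (- K) t).
    rewrite -lerN2; apply: (derive_ge0_le x0 dN) => t _ _.
    rewrite oppr_ge0 pmulr_rle0 ?expR_gt0//.
    by have := n'le t; rewrite ler_norml => /andP[_ ?]; lra.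
  by rewrite nE mulr0 pmulr_rle0// expR_gt0.
have : expR (K * x) * n x <= expR (K * 0) * n 0.
  apply: (derive_ge0_le x0 (mono K)) => t _ _.
  rewrite mulr_ge0 ?expR_ge0//.
  by have := n'le t; rewrite ler_norml => /andP[? _]; lra.
by rewrite nE mulr0 pmulr_rle0// expR_gt0.
Qed.

End Threshold.

(** * Reflection and the lower bound for the Wronskian *)

Section Scattering.
Context {R : realType}.
Local Notation C := R[i].
Local Notation Re := complex.Re.
Local Notation Im := complex.Im.
Local Notation mu := (@lebesgue_measure R).

(** The reflection x -> -x changes the sign of the derivative, and conjugation by beta changes the
    sign of alpha, since the two anticommute. Together they turn solutions for the reflected
    potential into solutions for V at the same energy ([reflect_mder]). *)
Definition reflect (V : R -> 'M[C]_2) x : 'M[C]_2 := beta *m V (- x) *m beta.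

Lemma betaMr (A : 'M[C]_2) i j : (beta *m A *m beta) i j =
  A (if i == 0 then 1 else 0) (if j == 0 then 1 else 0).
Proof.
by rewrite betaE; case: (I2P i) => ->; case: (I2P j) => ->; rewrite !mulmx2E !mxE /=; ring.
Qed.

Lemma mnorm_reflect V x : mnorm (reflect V x) = mnorm (V (- x)).
Proof. by rewrite /reflect !mnorm_M2 !betaMr /= addrC; congr (_ + _); rewrite addrC. Qed.

Lemma reflect_self_adjoint V : self_adjoint V -> self_adjoint (reflect V).
Proof.
move=> sa x; apply/matrixP => i j; rewrite /reflect mxE [_^T _ _]mxE !betaMr.
have /matrixP H := sa (- x).
have := H (if i == 0 then 1 else 0) (if j == 0 then 1 else 0); rewrite mxE [_^T _ _]mxE.
exact.
Qed.

Lemma reflect_continuous V : continuous_entries V -> continuous_entries (reflect V).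
Proof.
move=> cV i j.
have [a b] := cV (if i == 0 then 1 else 0) (if j == 0 then 1 else 0).
have cN : continuous (fun x : R => - x) by move=> x; exact: cvgN.
split=> x; under eq_fun do rewrite betaMr.
  exact: (@continuous_comp _ _ _ (fun x => - x)
    (fun y => Re (V y (if i == 0 then 1 else 0) (if j == 0 then 1 else 0))) x (cN x) (a (- x))).
exact: (@continuous_comp _ _ _ (fun x => - x)
    (fun y => Im (V y (if i == 0 then 1 else 0) (if j == 0 then 1 else 0))) x (cN x) (b (- x))).
Qed.

Lemma beta_alpha : beta *m alpha = - (alpha *m beta) :> 'M[C]_2.
Proof.
by rewrite alphaE betaE; apply/mx2P; rewrite [RHS]mxE !mulmx2E !mxE /=; ring.
Qed.

Lemma dmx_reflect (m : R) V z x : - (beta *m dmx m (reflect V) z (- x)) = dmx m V z x *m beta.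
Proof.
rewrite /dmx /potmx /reflect opprK mulmxBr mulmxBl -!scalemxAr -!scalemxAl !mulmxA beta_alpha.
rewrite opprB !mulNmx !scalerN opprK -[alpha *m beta *m beta]mulmxA beta_sqr mulmx1.
rewrite addrC; congr (_ - _); congr (_ *: _).
rewrite -!mulmxA; congr (alpha *m _); rewrite mulmxBr mulmxBl.
by rewrite scalar_mxC -scalemxAr -scalemxAl.
Qed.

Lemma reflect_mder (m : R) V z (F : R -> 'cV[C]_2) :
  mder F (fun x => dmx m (reflect V) z x *m F x) ->
  mder (fun x => beta *m F (- x)) (fun x => dmx m V z x *m (beta *m F (- x))).
Proof.
move=> dF; apply: eq_mder (mderM (mder_cst beta) (mder_opp dF)) => x.
by rewrite mul0mx add0r [RHS]mulmxA -dmx_reflect mulNmx mulmxN !mulmxA.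
Qed.

Variables (m theta : R) (q : R -> R) (qb : R).
Hypotheses (m0 : 0 < m) (theta0 : 0 < theta) (theta1 : theta <= 1).
Hypotheses (cq : continuous q) (q0 : forall x, 0 <= q x) (qN : forall x, q (- x) = q x)
  (qle : forall x, q x <= qb) (iq : mu.-integrable setT (EFin \o q)).

(** The majorant [q] is shared by a whole class of potentials which, q being even, is stable under
    reflection; left and right Jost solutions then obey the same constants. *)
Definition admissible (V : R -> 'M[C]_2) := [/\ self_adjoint V, continuous_entries V &
  forall y, mnorm (V y) * (bweight y `^ (1 + theta)) ^+ 2 <= q y].

Lemma admissible_reflect V : admissible V -> admissible (reflect V).
Proof.
move=> [sa cV Vq]; split; [exact: reflect_self_adjoint|exact: reflect_continuous|].
by move=> y; rewrite mnorm_reflect -(bweightN y) -(qN y).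
Qed.

Definition jost V := jost_sol m q (potmx V).

Let pq V : admissible V ->
  forall y, mnorm (potmx V y) * (bweight y `^ (1 + theta)) ^+ 2 <= q y.
Proof. by move=> [_ _ Vq] y; rewrite mnorm_potmx. Qed.

Let pc V : admissible V -> mcont (potmx V).
Proof. by move=> [_ cV _]; exact: mcont_potmx. Qed.

Definition wave zeta (g : R -> 'cV[C]_2) x := cexp (momentum m zeta) x *: g x.

Lemma wave_mder V zeta g : half_disc zeta -> jost V zeta g ->
  mder (wave zeta g) (fun x => dmx m V (energy m zeta) x *m wave zeta g x).
Proof. by move=> [z0 _ _] [dg _ _]; exact: jost_mder. Qed.

Lemma curr_jvec zeta : curr (jvec zeta) = cabs zeta ^+ 2 - 1 :> R.
Proof. by rewrite /curr !mxE /= cabs1 expr1n. Qed.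

(** For real [zeta] the energy and the momentum are real: the current is conserved and the factor
    e^{ikx} has modulus 1. The value is read off at +oo, where [g] tends to [jvec]. *)
Lemma jost_curr_real V zeta g : admissible V -> half_disc zeta -> Im zeta = 0 ->
  jost V zeta g -> forall x, curr (g x) = cabs zeta ^+ 2 - 1.
Proof.
move=> aV hz Iz sg; have [saV cV Vq] := aV; have [z0 z1 _] := hz.
have Ik : Im (momentum m zeta) = 0 by rewrite Im_momentum Iz oppr0 mul0r mulr0.
have Ie : Im (energy m zeta) = 0 by rewrite Im_energy Iz oppr0 mul0r mulr0.
have cE x : curr (wave zeta g x) = curr (g x).
  by rewrite currZ cabs_cexp Ik oppr0 mul0r expR0 expr1n mul1r.
have cst x : curr (g x) = curr (g 0).
  rewrite -!cE; apply: (derive0_cst (f := fun x => curr (wave zeta g x))) => y.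
  apply: (is_derive_eq (curr_derive saV y (wave_mder hz sg))).
  by rewrite Ie mulr0 mul0r.
move=> x; rewrite cst -curr_jvec; apply/eqP; rewrite -subr_eq0 -normr_eq0 eq_le normr_ge0 andbT.
apply/ler_addgt0Pr => e e0; rewrite add0r.
(* The 5 bounds mnorm (g M) + mnorm (jvec zeta), at most (1 + 2) + 2. *)
pose d := Num.min 1 (e / 5).
have d0 : 0 < d by rewrite lt_min ltr01 divr_gt0.
have d1 : d <= 1 by rewrite ge_min lexx.
have de : d <= e / 5 by rewrite ge_min lexx orbT.
have [M HM] := jost_limit m0 theta0 q0 iq (pc aV) (pq aV) hz sg d0.
have H := HM M (lexx M); rewrite -(cst M).
apply: (le_trans (curr_dist _ _)).
have H2 : mnorm (g M) <= d + mnorm (jvec zeta).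
  have := mnormD (g M - jvec zeta) (jvec zeta); rewrite subrK; lra.
have H3 : mnorm (jvec zeta) <= 2 by rewrite mnorm_jvec; lra.
apply: (@le_trans _ _ (d * 5)); last lra.
apply: ler_pM => //; rewrite ?mnorm_ge0 ?addr_ge0 ?mnorm_ge0//; lra.
Qed.

(** The current is nondecreasing, and it cannot become positive because the wave decays at +oo. Were
    it zero at 0, it would vanish on the whole right half-line, its derivative would force [g] to
    vanish there, and this contradicts the normalisation at +oo. *)
Lemma jost_curr_neg V zeta g : admissible V -> half_disc zeta ->
  Im zeta < 0 -> cabs zeta < 1 -> jost V zeta g -> curr (g 0) < 0.
Proof.
move=> aV hz Iz z1 sg; have [saV cV Vq] := aV; have [z0 _ _] := hz.
have zp : 0 < cabs zeta by rewrite cabs_gt0.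
have Ie : 0 < Im (energy m zeta).
  rewrite Im_energy mulr_gt0 ?divr_gt0// mulr_gt0 ?oppr_gt0// subr_gt0.
  by rewrite -[1]invr1 ltf_pV2 ?posrE ?exprn_gt0// expr_lt1// ltW.
have Ik : 0 < Im (momentum m zeta).
  rewrite Im_momentum mulr_gt0 ?divr_gt0// mulr_gt0 ?oppr_gt0//.
  by rewrite addr_gt0// invr_gt0 exprn_gt0.
have dw (x : R) := curr_derive saV x (wave_mder hz sg).
pose w x := curr (wave zeta g x).
have mono x y : x <= y -> w x <= w y.
  move=> xy; apply: (derive_ge0_le xy dw) => t _ _.
  by rewrite mulr_ge0 ?mulr_ge0 ?(ltW Ie)// addr_ge0// sqr_ge0.
have [dg gb ge] := sg.
have wle x : w x <= 0.
  rewrite leNgt; apply/negP => wx.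
  have J0 := jostC_gt0 m q.
  pose J := jostC m q; pose b := Im (momentum m zeta).
  (* Far enough that J^2 / (1 + b y) < w x; the exponential decay is used only through e^{-by} <= 1
     / (1 + b y). *)
  pose y := Num.max (Num.max x 0) (J ^+ 2 / w x / b).
  have xy : x <= y by rewrite !le_max lexx.
  have y0 : 0 <= y by rewrite !le_max lexx orbT.
  have yb : J ^+ 2 / w x / b <= y by rewrite le_max lexx orbT.
  have := mono _ _ xy; rewrite leNgt => /negP; apply.
  apply: (@le_lt_trans _ _ (cabs (cexp (momentum m zeta) y) ^+ 2 * J ^+ 2)).
    rewrite /w currZ ler_wpM2l ?sqr_ge0// /curr.
    apply: (@le_trans _ _ (cabs (g y 1 0) ^+ 2)); first by rewrite gerBl sqr_ge0.
    rewrite ler_pXn2r ?nnegrE ?cabs_ge0 ?(ltW J0)//.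
    apply: (le_trans (cabs_le_mnorm _ _ _)); apply: (le_trans (gb y)).
    by rewrite lweight_nonneg// mulr1.
  have b0 : 0 < b by exact: Ik.
  have by0 : 0 <= b * y by rewrite mulr_ge0// ltW.
  have h1 : cabs (cexp (momentum m zeta) y) <= (1 + b * y)^-1.
    rewrite cabs_cexp -/b mulNr expRN lef_pV2 ?posrE ?expR_gt0//; last lra.
    exact: expR_ge1Dx.
  have h2 : (1 + b * y)^-1 <= 1 by rewrite invf_le1; lra.
  have h3 : cabs (cexp (momentum m zeta) y) ^+ 2 <= (1 + b * y)^-1.
    rewrite expr2 -[leRHS]mulr1 ler_pM ?cabs_ge0//; exact: le_trans h1 h2.
  apply: (@le_lt_trans _ _ ((1 + b * y)^-1 * J ^+ 2)).
    by rewrite ler_wpM2r ?sqr_ge0.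
  rewrite mulrC ltr_pdivrMr; last lra.
  move: yb; rewrite ler_pdivrMr// ler_pdivrMr// => yb.
  by rewrite mulrDr mulr1 -[w x * _]mulrC [b * y]mulrC; lra.
rewrite ltNge; apply/negP => g00.
have w0 : w 0 = curr (g 0) by rewrite /w /wave cexp0 scale1r.
have wz x : 0 <= x -> w x = 0.
  by move=> x0; apply/eqP; rewrite eq_le wle -[leLHS]/0 (le_trans g00)// -w0 mono.
have gz x : 1 <= x -> g x = 0.
  move=> x1.
  have D0 : is_derive x 1 w 0.
    apply: (@near_eq_is_derive _ _ _ (cst 0)); near=> y; rewrite wz//.
    near: y; exists 1 => //= y /=; rewrite ltr_norml => /andP[? ?]; lra.
  have [_ E1] := dw x; have [_ E2] := D0; move: E1; rewrite E2 => /esym/eqP.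
  rewrite mulf_eq0 mulf_eq0 pnatr_eq0 (gt_eqF Ie) /= paddr_eq0 ?sqr_ge0//.
  rewrite !sqrf_eq0 !cabs_eq0 /wave !colZE !mulf_eq0 !(negPf (cexp_neq0 _ _)) /=.
  by move=> /andP[/eqP a0 /eqP a1]; apply/cV2P; rewrite mxE.
exact: (jost_neq0 ge gz).
Unshelve. all: by end_near. Qed.

Definition lwave zeta (h : R -> 'cV[C]_2) x := beta *m wave zeta h (- x).

Lemma lwave_mder V zeta h : half_disc zeta -> jost (reflect V) zeta h ->
  mder (lwave zeta h) (fun x => dmx m V (energy m zeta) x *m lwave zeta h x).
Proof. by move=> hz sh; apply: reflect_mder; exact: wave_mder hz sh. Qed.

Definition wronskian zeta (g h : R -> 'cV[C]_2) x := det2 (wave zeta g x) (lwave zeta h x).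

Lemma wronskian0 zeta g h : wronskian zeta g h 0 = det2 (g 0) (beta *m h 0).
Proof. by rewrite /wronskian /lwave /wave oppr0 cexp0 !scale1r. Qed.

Lemma wronskian_cder V zeta g h : admissible V -> half_disc zeta ->
  jost V zeta g -> jost (reflect V) zeta h ->
  cder (wronskian zeta g h)
    (fun x => ci * (((Re (V x 1 1) - Re (V x 0 0))%:C)%C) * wronskian zeta g h x).
Proof.
move=> [saV _ _] hz sg sh.
exact: (det2_derive saV (wave_mder hz sg) (lwave_mder hz sh)).
Qed.

Lemma cabs_wronskian V zeta g h x : admissible V -> half_disc zeta ->
  jost V zeta g -> jost (reflect V) zeta h ->
  cabs (wronskian zeta g h x) = cabs (det2 (g 0) (beta *m h 0)).
Proof.
move=> aV hz sg sh; rewrite (cabs_phase x (wronskian_cder aV hz sg sh)).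
by rewrite wronskian0.
Qed.

(* The phase of the Wronskian does not depend on the energy. *)
Lemma cabs_wronskian_sub V z w g h g' h' x : admissible V -> half_disc z -> half_disc w ->
  jost V z g -> jost (reflect V) z h -> jost V w g' -> jost (reflect V) w h' ->
  cabs (wronskian z g h x - wronskian w g' h' x) =
  cabs (det2 (g 0) (beta *m h 0) - det2 (g' 0) (beta *m h' 0)).
Proof.
move=> aV hz hw sg sh sg' sh'; rewrite -(wronskian0 z g h) -(wronskian0 w g' h').
have d := cderB (wronskian_cder aV hz sg sh) (wronskian_cder aV hw sg' sh').
apply: (cabs_phase (W := fun x => wronskian z g h x - wronskian w g' h' x)
  (tau := fun x => Re (V x 1 1) - Re (V x 0 0)) x).
by apply: eq_cder d => y; rewrite -mulrBr.
Qed.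

(** Conjugation by beta reverses the current, so the two Jost solutions carry opposite currents of
    size 1 - |zeta|^2, and [det2_curr] bounds the square of the determinant below by the square of
    this number. *)
Lemma wronskian_real_ge V zeta g h : admissible V -> half_disc zeta -> Im zeta = 0 ->
  jost V zeta g -> jost (reflect V) zeta h ->
  1 - cabs zeta ^+ 2 <= cabs (det2 (g 0) (beta *m h 0)).
Proof.
move=> aV hz Iz sg sh; have [_ z1 _] := hz.
have c1 := jost_curr_real aV hz Iz sg 0.
have c2 := jost_curr_real (admissible_reflect aV) hz Iz sh 0.
have := det2_curr (g 0) (beta *m h 0); rewrite curr_beta c1 c2 mulrN opprK -expr2.
have p0 : 0 <= 1 - cabs zeta ^+ 2 by rewrite subr_ge0 expr_le1// cabs_ge0.
by rewrite -sqrrN opprB ler_pXn2r ?nnegrE ?cabs_ge0.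
Qed.

Lemma wronskian_neq0 V zeta g h : admissible V -> half_disc zeta ->
  Im zeta < 0 -> cabs zeta < 1 -> jost V zeta g -> jost (reflect V) zeta h ->
  det2 (g 0) (beta *m h 0) != 0.
Proof.
move=> aV hz Iz z1 sg sh.
have c1 := jost_curr_neg aV hz Iz z1 sg.
have c2 := jost_curr_neg (admissible_reflect aV) hz Iz z1 sh.
have := det2_curr (g 0) (beta *m h 0); rewrite curr_beta mulrN opprK => H.
rewrite -cabs_eq0; apply: contraTneq H => ->.
by rewrite expr0n -ltNge nmulr_rgt0.
Qed.

Lemma ae_exists_ge (P : R -> Prop) M : {ae mu, forall x, P x} -> exists2 x, M <= x & P x.
Proof.
move=> [N [mN N0 PN]]; apply: contrapT => H.
have sub : `[M, M + 1] `<=` N.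
  move=> x /=; rewrite in_itv /= => /andP[Mx _]; apply: PN => /= Px.
  by apply: H; exists x.
have E : lebesgue_measure (`[M, M + 1]%classic : set R) = 1%E.
  by rewrite lebesgue_measure_itv /= lte_fin ltrDl ltr01 -EFinB addrC addKr.
have : (lebesgue_measure (`[M, (M + 1)%R]%classic : set R) <= mu N)%E.
  by apply: le_measure => //; rewrite inE//; exact: measurable_itv.
by rewrite E N0 lee_fin ler10.
Qed.

Lemma dmx_bounded V z : admissible V -> exists b, forall x, mnorm (dmx m V z x) <= b.
Proof.
move=> [_ _ Vq]; exists (qb + mnorm (ci *: (alpha *m (z%:M - (m%:C)%C *: beta)))) => x.
apply: (le_trans (mnormB _ _)); rewrite lerD2r mnorm_potmx.
apply: le_trans (qle x); apply: le_trans (Vq x).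
rewrite ler_peMr ?mnorm_ge0// expr_ge1 ?powR_ge0//.
by rewrite -[leLHS](powRr0 (bweight x)) ler_powR ?bweight_ge1// addr_ge0// ltW.
Qed.

(** At a threshold each Jost solution is bounded only on its own half-line. A vanishing Wronskian
    makes them proportional, hence [g] bounded on both sides; regularity then makes it zero almost
    everywhere, against its limit [jvec], whose norm is 2. *)
Lemma wronskian_threshold V (zeta : C) (E : R) g h : admissible V -> half_disc zeta ->
  momentum m zeta = 0 -> energy m zeta = ((E%:C)%C) -> cabs zeta = 1 -> regular_energy m V E ->
  jost V zeta g -> jost (reflect V) zeta h -> det2 (g 0) (beta *m h 0) != 0.
Proof.
move=> aV hz k0 eE z1 reg sg sh; apply/eqP => W0.
have [saV cV Vq] := aV.
have wE (f : R -> 'cV[C]_2) x : wave zeta f x = f x by rewrite /wave k0 cexp0l scale1r.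
have [b Hb] := dmx_bounded (energy m zeta) aV.
have dg := wave_mder hz sg; have dh := lwave_mder hz sh.
have [_ gb ge] := sg; have [_ hb he] := sh.
have comb (c1 c2 : C) : c1 *: g 0 + c2 *: (beta *m h 0) = 0 ->
    forall x, c1 *: g x + c2 *: (beta *m h (- x)) = 0.
  move=> e0 x.
  have d : mder (fun x => c1 *: wave zeta g x + c2 *: lwave zeta h x)
     (fun x => dmx m V (energy m zeta) x *m (c1 *: wave zeta g x + c2 *: lwave zeta h x)).
    apply: eq_mder (mderD (mderZ (cder_cst c1) dg) (mderZ (cder_cst c2) dh)) => y.
    by rewrite !scale0r !add0r mulmxDr -!scalemxAr.
  have := ode_zero Hb d; rewrite /lwave !wE oppr0 => /(_ e0 x).
  by rewrite !wE.
have J0 := jostC_gt0 m q.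
have [r0|r0] := eqVneq (beta *m h 0) 0.
  have := jost_neq0 (a := 0) he; apply => x _.
  have := comb 0 1; rewrite r0 scaler0 scale0r addr0 => /(_ erefl (- x)).
  rewrite scale0r add0r scale1r opprK => H.
  by rewrite -[h x]mul1mx -beta_sqr -mulmxA H mulmx0.
have [i ri] : exists i, (beta *m h 0) i 0 != 0.
  apply: contrapT => H; case/negP: r0; apply/eqP/matrixP => i j; rewrite (ord1 j) [RHS]mxE.
  by apply/eqP; apply: contrapT => /negP ?; apply: H; exists i.
set r := beta *m h 0 in ri W0 comb.
(* A linear relation read off from the vanishing determinant; [i] is an index where [r] is nonzero,
   so that the relation can be solved for [g]. *)
have e0 : r i 0 *: g 0 + (- g 0 i 0) *: r = 0.
  clear - W0; move: r (g 0) W0 => r v W0.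
  apply/matrixP => k j; rewrite (ord1 j) !mxE; move: W0; rewrite /det2 => W0.
  case: (I2P i) => ->; case: (I2P k) => ->; first by ring.
  - by rewrite -[RHS]oppr0 -W0; ring.
  - by rewrite -W0; ring.
  - by ring.
have gE x : g x = (g 0 i 0 / r i 0) *: (beta *m h (- x)).
  have := comb _ _ e0 x; rewrite scaleNr => /eqP; rewrite subr_eq0 => /eqP H.
  by rewrite mulrC -scalerA -H scalerA mulVf// scale1r.
pose b1 := jostC m q + cabs (g 0 i 0 / r i 0) * jostC m q.
have gbd x : mnorm (g x) <= b1.
  have [x0|/ltW x0] := leP 0 x.
    apply: (le_trans (gb x)); rewrite lweight_nonneg// mulr1 lerDl.
    by rewrite mulr_ge0 ?cabs_ge0// ltW.
  rewrite gE mnormZ mnorm_beta /b1 -[leLHS]add0r lerD ?(ltW J0)//.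
  rewrite ler_wpM2l ?cabs_ge0// (le_trans (hb _))//.
  by rewrite lweight_nonneg ?mulr1// oppr_ge0.
have cg : mcont g by exact: jost_cont sg.
have dg' : mder g (fun x => dmx m V ((E%:C)%C) x *m g x).
  by move: dg; rewrite -eE (_ : wave zeta g = g)//; apply/funext => x; rewrite wE.
have g0ae := reg g (bounded_Linfty cg gbd) (classical_distributional cV dg').
have [M HM] := jost_limit m0 theta0 q0 iq (pc aV) (pq aV) hz sg (ltr01 : 0 < 1 :> R).
have [x Mx gx] := ae_exists_ge M g0ae.
have := HM x Mx; rewrite (gx I) sub0r mnormN mnorm_jvec z1; lra.
Qed.

Let det2_dist (v w v' w' : 'cV[C]_2) : cabs (det2 v w - det2 v' w') <=
  mnorm (v - v') * mnorm w + mnorm v' * mnorm (w - w').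
Proof.
have -> : det2 v w - det2 v' w' = det2 (v - v') w + det2 v' (w - w').
  by rewrite /det2 !colBE; ring.
have H (a b : 'cV[C]_2) : cabs (det2 a b) <= mnorm a * mnorm b.
  rewrite /det2 (le_trans (cabsB _ _))// !cabsM !mnorm_cV2.
  have := mulr_ge0 (cabs_ge0 (a 0 0)) (cabs_ge0 (b 0 0)).
  have := mulr_ge0 (cabs_ge0 (a 1 0)) (cabs_ge0 (b 1 0)).
  by rewrite mulrDl !mulrDr; lra.
by rewrite (le_trans (cabsD _ _))// lerD.
Qed.

Lemma wronskian_holder V (r : R) : admissible V -> 0 < r -> exists2 K, 0 <= K &
  forall z w g h g' h', half_disc z -> half_disc w -> r <= cabs z -> r <= cabs w ->
  jost V z g -> jost (reflect V) z h -> jost V w g' -> jost (reflect V) w h' ->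
  cabs (det2 (g 0) (beta *m h 0) - det2 (g' 0) (beta *m h' 0)) <= K * cabs (z - w) `^ theta.
Proof.
move=> aV r0; have aV' := admissible_reflect aV.
have [K K0 HK] := jost_holder m0 theta0 theta1 cq q0 iq (pc aV) (pq aV) r0.
have [K' K0' HK'] := jost_holder m0 theta0 theta1 cq q0 iq (pc aV') (pq aV') r0.
have J0 := jostC_gt0 m q.
exists ((K + K') * jostC m q) => [|z w g h g' h' hz hw rz rw sg sh sg' sh'].
  by rewrite mulr_ge0 ?addr_ge0// ltW.
have l0 : lweight (0 : R) = 1 by rewrite lweight_nonneg.
apply: (le_trans (det2_dist _ _ _ _)).
have H1 := HK _ _ _ _ hz hw rz rw sg sg' 0.
have H2 := HK' _ _ _ _ hz hw rz rw sh sh' 0.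
rewrite l0 powR1 mulr1 in H1; rewrite l0 powR1 mulr1 in H2.
have [_ hb _] := sh; have [_ gb' _] := sg'.
have Hh := hb 0; have Hg := gb' 0; rewrite l0 mulr1 in Hh; rewrite l0 mulr1 in Hg.
rewrite -mulmxBr !mnorm_beta.
set d := cabs (z - w) `^ theta in H1 H2 *.
have d0 : 0 <= d by rewrite powR_ge0.
apply: (@le_trans _ _ (K * d * jostC m q + jostC m q * (K' * d))).
  by rewrite lerD// ler_pM ?mnorm_ge0.
by apply: eq_ler; ring.
Qed.

Lemma powR_small (A e : R) : 0 <= A -> 0 < e ->
  exists2 d, 0 < d & forall t, 0 <= t -> t <= d -> A * t `^ theta <= e.
Proof.
(* The denominator [A + 1] covers the case A = 0. *)
move=> A0 e0; exists ((e / (A + 1)) `^ theta^-1); first by rewrite powR_gt0// divr_gt0// ltr_wpDl.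
move=> t t0 td.
have A1 : 0 < A + 1 by rewrite ltr_wpDl.
have : t `^ theta <= e / (A + 1).
  have -> : e / (A + 1) = ((e / (A + 1)) `^ theta^-1) `^ theta.
    by rewrite -powRrM mulVf ?gt_eqF// powRr1// divr_ge0// ltW.
  by apply: ge0_ler_powR; rewrite ?nnegrE ?powR_ge0// ltW.
move=> H; apply: (le_trans (ler_wpM2l A0 H)).
rewrite mulrCA ler_piMr ?(ltW e0)// ler_pdivrMr// mul1r lerDl//.
Qed.

Lemma half_disc_real (a : R) : a != 0 -> `|a| <= 1 -> half_disc ((a%:C)%C : C).
Proof.
move=> a0 a1; split=> //=; last by rewrite cabs_real.
by rewrite -cabs_eq0 cabs_real normr_eq0.
Qed.

(** Near a = 1 and a = -1 the bound is inherited by continuity from the nonzero threshold value.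
    Elsewhere 1 - a^2 is already bounded below, including at a close to 0, that is, at high
    energy. *)
Lemma wronskian_lower V : admissible V -> thresholds_regular m V -> exists2 c, 0 < c &
  forall (a : R) g h, a != 0 -> `|a| < 1 ->
    jost V ((a%:C)%C) g -> jost (reflect V) ((a%:C)%C) h ->
    c <= cabs (det2 (g 0) (beta *m h 0)).
Proof.
move=> aV [reg1 reg2].
have near (s : R) : `|s| = 1 -> regular_energy m V (m * s) ->
  exists2 d, 0 < d & exists2 c, 0 < c & forall (a : R) g h, 2^-1 <= `|a| -> `|a| <= 1 ->
    `|a - s| <= d -> jost V ((a%:C)%C) g -> jost (reflect V) ((a%:C)%C) h ->
    c <= cabs (det2 (g 0) (beta *m h 0)).
  move=> s1 reg.
  have s0 : s != 0 by rewrite -normr_eq0 s1 oner_eq0.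
  have hs : half_disc ((s%:C)%C : C) by apply: half_disc_real; rewrite ?s1.
  have ss : s^-1 = s.
    by move: s1 => /eqP; rewrite eqr_norml => /andP[/orP[]/eqP-> _]; rewrite ?invrN invr1.
  have k0 : momentum m ((s%:C)%C) = 0.
    by rewrite /momentum -fmorphV ss subrr mulr0 mul0r.
  have eE : energy m ((s%:C)%C) = (((m * s)%:C)%C).
    by rewrite /energy -fmorphV ss rmorphM /=; field.
  have [g1 sg1] := jost_exists m0 theta0 cq q0 iq (pc aV) (pq aV) hs.
  have aV' := admissible_reflect aV.
  have [h1 sh1] := jost_exists m0 theta0 cq q0 iq (pc aV') (pq aV') hs.
  have cs : cabs ((s%:C)%C : C) = 1 by rewrite cabs_real.
  have W1 := wronskian_threshold aV hs k0 eE cs reg sg1 sh1.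
  set c1 := cabs (det2 (g1 0) (beta *m h1 0)).
  have c10 : 0 < c1 by rewrite cabs_gt0.
  have half0 : 0 < 2^-1 :> R by [].
  (* Near the thresholds |zeta| >= 1/2, so continuity is only called upon away from the singular
     point 0. *)
  have [K K0 HK] := wronskian_holder aV half0.
  have [d d0 Hd] := powR_small K0 (divr_gt0 c10 (ltr0Sn _ 1)).
  exists d => //; exists (c1 / 2) => [|a g h ah a1 ad sg sh]; first by rewrite divr_gt0.
  have a0 : a != 0 by rewrite -normr_gt0 (lt_le_trans half0).
  have H : cabs (det2 (g 0) (beta *m h 0) - det2 (g1 0) (beta *m h1 0)) <= c1 / 2.
    have ha := half_disc_real a0 a1.
    have := HK _ _ _ _ _ _ ha hs _ _ sg sh sg1 sh1; rewrite !cabs_real s1.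
    move=> /(_ ah (ltac:(lra))) /le_trans; apply.
    by rewrite -rmorphB cabs_real Hd.
  have := cabsB (det2 (g 0) (beta *m h 0)) (det2 (g 0) (beta *m h 0) - det2 (g1 0) (beta *m h1 0)).
  rewrite opprB addrC subrK -/c1; lra.
have reg1' : regular_energy m V (m * 1) by rewrite mulr1.
have reg2' : regular_energy m V (m * -1) by rewrite mulrN1.
have [d1 d10 [c1 c10 H1]] := near 1 (normr1 _) reg1'.
have [d2 d20 [c2 c20 H2]] := near (- 1) (normrN1 _) reg2'.
pose d := Num.min (Num.min d1 d2) 2^-1.
have d0 : 0 < d by rewrite !lt_min d10 d20 /=.
have dd1 : d <= d1 by rewrite !ge_min lexx.
have dd2 : d <= d2 by rewrite !ge_min lexx orbT.
have dh : d <= 2^-1 by rewrite ge_min lexx orbT.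
(* Away from the thresholds 1 - a and 1 + a both exceed [d] and one of them is at least 1, hence (1
   - a)(1 + a) >= d. *)
pose c := Num.min (Num.min c1 c2) d.
have cc1 : c <= c1 by rewrite !ge_min lexx.
have cc2 : c <= c2 by rewrite !ge_min lexx orbT.
have cd : c <= d by rewrite ge_min lexx orbT.
exists c => [|a g h a0 a1 sg sh]; first by rewrite !lt_min c10 c20 d10 d20 /=.
have ha := half_disc_real a0 (ltW a1).
have W := wronskian_real_ge aV ha erefl sg sh; rewrite cabs_real real_normK ?num_real// in W.
move: (a1); rewrite ltr_norml => /andP[al ar].
have [e1|e1] := leP (1 - a) d.
  apply: (le_trans cc1); apply: (H1 a) => //; last 2 first.
  - exact: ltW.
  - by rewrite distrC ger0_norm ?subr_ge0; lra.
  by rewrite ger0_norm; lra.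
have [e2|e2] := leP (1 + a) d.
  apply: (le_trans cc2); apply: (H2 a) => //; last 2 first.
  - exact: ltW.
  - by rewrite opprK addrC ger0_norm; lra.
  by rewrite ler0_norm; lra.
apply: (le_trans cd); apply: le_trans W.
have -> : 1 - a ^+ 2 = (1 - a) * (1 + a) by ring.
have [ap|ap] := leP 0 a; nra.
Qed.

End Scattering.

(** * Smooth bump functions *)

Section SmoothFunctions.
Context {R : realType}.
Local Notation mu := (@lebesgue_measure R).
Implicit Types (f g : R -> R) (x a b : R) (k n : nat).

(** Class C^n with the successive derivatives as witnesses, so that closure under products and
    affine changes of variable is a plain induction. *)
Fixpoint nsmooth n f : Prop :=
  if n is n.+1 then exists2 f', forall x : R, is_derive x 1 f (f' x) & nsmooth n f'
  else continuous f.

Lemma nsmooth_continuous n f : nsmooth n f -> continuous f.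
Proof. by case: n => //= n [f' df _]; exact: is_derive_continuous df. Qed.

Lemma nsmoothD n f g : nsmooth n f -> nsmooth n g -> nsmooth n (fun x => f x + g x).
Proof.
elim: n f g => [f g cf cg x|n IH f g [f' df sf] [g' dg sg]] /=.
  by apply: cvgD; [exact: cf|exact: cg].
exists (fun x => f' x + g' x); last exact: IH.
by move=> x; exact: (is_derive_add (df x) (dg x)).
Qed.

Lemma nsmoothZ n (c : R) f : nsmooth n f -> nsmooth n (fun x => c * f x).
Proof.
elim: n f => [f cf x|n IH f [f' df sf]] /=.
  by apply: cvgM; [exact: cvg_cst|exact: cf].
exists (fun x => c * f' x); last exact: IH.
by move=> x; exact: is_derive_scale.
Qed.

Lemma nsmoothS n f : nsmooth n.+1 f -> nsmooth n f.
Proof.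
elim: n f => [f|n IH f [f' df sf]]; first exact: nsmooth_continuous.
by exists f' => //; exact: IH.
Qed.

Lemma nsmoothM n f g : nsmooth n f -> nsmooth n g -> nsmooth n (fun x => f x * g x).
Proof.
elim: n f g => [f g cf cg x|n IH f g sf sg] /=.
  by apply: cvgM; [exact: cf|exact: cg].
have [f' df sf'] := sf; have [g' dg sg'] := sg.
exists (fun x => f' x * g x + f x * g' x).
  by move=> x; exact: (is_derive_mul (df x) (dg x)).
by apply: nsmoothD; apply: IH => //; exact: nsmoothS.
Qed.

Lemma is_derive_affine f (f' : R -> R) (c d x : R) : (forall x, is_derive x 1 f (f' x)) ->
  is_derive x 1 (fun x => f (c * x + d)) (c * f' (c * x + d)).
Proof.
move=> df.
have dl : is_derive x 1 (fun x => c * x + d) c.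
  apply: (is_derive_eq (is_derive_add (is_derive_scale c (is_derive_id x 1))
    (is_derive_cst d x 1))).
  by rewrite mulr1 addr0.
by apply: (is_derive_eq (@is_derive1_comp _ f _ x _ _ (df _) dl)); rewrite mulrC.
Qed.

Lemma nsmooth_affine n f (c d : R) : nsmooth n f -> nsmooth n (fun x => f (c * x + d)).
Proof.
elim: n f => [f cf x|n IH f [f' df sf]] /=.
  apply: (@continuous_comp _ _ _ (fun x => c * x + d) f); last exact: cf.
  apply: cvgD; last exact: cvg_cst.
  by apply: cvgM; [exact: cvg_cst|exact: cvg_id].
exists (fun x => c * f' (c * x + d)); first by move=> x; exact: is_derive_affine.
by apply: nsmoothZ; exact: IH.
Qed.

Lemma nsmooth_derivable n f x : nsmooth n.+1 f -> derivable (derive1n n f) x 1.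
Proof.
elim: n f => [f [f' df _]|n IH f [f' df sf]]; first by have [] := df x.
have -> : derive1n n.+1 f = derive1n n f'.
  rewrite /derive1n iterSr; congr (iter n _ _).
  by apply/funext => y; rewrite derive1E; have [_ ->] := df y.
exact: IH.
Qed.

Lemma smooth_test f (M : R) : (forall n, nsmooth n f) -> (forall x, M < `|x| -> f x = 0) ->
  test_function f.
Proof. by move=> sf fM; split; [move=> n x; exact: nsmooth_derivable|exists M]. Qed.

(** x^-k e^{-1/x} extended by 0. The powers are included because the family is then closed under
    differentiation, which gives smoothness of all its members by one induction. *)
Definition flat k x := if 0 < x then (x^-1) ^+ k * expR (- x^-1) else 0.

Lemma flat_ge0 k x : 0 <= flat k x.
Proof.
rewrite /flat; case: ifP => // x0; rewrite mulr_ge0 ?expR_ge0//.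
by rewrite exprn_ge0// invr_ge0 ltW.
Qed.

(** Comes from the single term y^(k+2) / (k+2)! of the exponential series at y = 1/x. The factor x^2
    is what gives derivative 0 at the origin. *)
Lemma flat_le k x : flat k x <= k.+2`!%:R * x ^+ 2.
Proof.
rewrite /flat; case: ifP => x0; last by rewrite mulr_ge0// sqr_ge0.
have y0 : 0 < x^-1 by rewrite invr_gt0.
rewrite expRN ler_pdivrMr ?expR_gt0//.
have H : (x^-1) ^+ k.+2 / k.+2`!%:R <= expR x^-1.
  by apply: le_trans (expR_ge1Dxn k.+1 (ltW y0)); rewrite lerDr.
have fp : 0 < k.+2`!%:R :> R by rewrite ltr0n fact_gt0.
move: H; rewrite ler_pdivrMr// => H.
have -> : (x^-1) ^+ k = (x^-1) ^+ k.+2 * x ^+ 2.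
  by rewrite !exprS; field; rewrite gt_eqF.
rewrite [leRHS](_ : _ = expR x^-1 * k.+2`!%:R * x ^+ 2); last by ring.
by rewrite ler_wpM2r ?sqr_ge0.
Qed.

Lemma flat_is_derive k x : is_derive x 1 (flat k) (flat k.+2 x - k%:R * flat k.+1 x).
Proof.
have [x0|x0|x0] := ltgtP x 0.
- rewrite /flat !ltNge !(ltW x0) /= mulr0 subr0.
  apply: (@near_eq_is_derive _ _ _ (cst 0)).
  near=> y; rewrite ltNge; case: ifPn => // /negP; case; apply: ltW.
  near: y; exact: lt_nbhsl.
- have dV : is_derive x 1 (fun x => x^-1) (- (x^-1) ^+ 2).
    apply: (is_derive_eq (@realfun.is_deriveV _ id x 1 1 _ (is_derive_id _ _))); first by rewrite gt_eqF.
    by rewrite /GRing.scale /= mulr1 exprVn.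
  have dE : is_derive x 1 (fun x => expR (- x^-1)) (expR (- x^-1) * (x^-1) ^+ 2).
    by apply: (is_derive_eq (is_derive_expR_comp (is_derive_opp dV))); rewrite opprK.
  have dX : is_derive x 1 (fun x => (x^-1) ^+ k) (- (k%:R * (x^-1) ^+ k.+1)).
    elim: k => [|k IH]; first by rewrite mul0r oppr0; exact: is_derive_cst.
    have -> : (fun x : R => (x^-1) ^+ k.+1) = (fun x => x^-1 * (x^-1) ^+ k).
      by apply/funext => y; rewrite exprS.
    by apply: (is_derive_eq (is_derive_mul dV IH)); rewrite -[k.+1%:R]natr1 !exprS; ring.
  have d : is_derive x 1 (fun x => (x^-1) ^+ k * expR (- x^-1))
      (flat k.+2 x - k%:R * flat k.+1 x).
    apply: (is_derive_eq (is_derive_mul dX dE)); rewrite /flat x0.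
    by rewrite !exprS; ring.
  apply: (near_eq_is_derive _ d); near=> y; rewrite /flat.
  suff -> : 0 < y by [].
  by near: y; exact: lt_nbhsr.
- rewrite x0 /flat ltxx mulr0 subr0.
  have cv : h^-1 *: (flat k (h *: 1 + 0) - flat k 0) @[h --> 0^'] --> (0 : R).
    apply/cvgrPdist_le => e e0; near=> h.
    have h0 : h != 0 by near: h; exact: nbhs_dnbhs_neq.
    rewrite sub0r normrN /GRing.scale /= mulr1 addr0 {2}/flat ltxx subr0 normrM normfV.
    rewrite ler_pdivrMl ?normr_gt0//.
    rewrite ger0_norm ?flat_ge0// (le_trans (flat_le _ _))//.
    rewrite -real_normK ?num_real// expr2 mulrA mulrC ler_wpM2l//.
    rewrite -ler_pdivlMl ?ltr0n ?fact_gt0// mulrC ltW//; near: h.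
    have ek : 0 < e / k.+2`!%:R by rewrite divr_gt0// ltr0n fact_gt0.
    apply: dnbhs0_lt; exact: ek.
  split; first by apply/cvg_ex; exists 0.
  by apply: cvg_lim => //; exact: Rhausdorff.
Unshelve. all: by end_near. Qed.

Lemma nsmooth_flat n k : nsmooth n (flat k).
Proof.
elim: n k => [|n IH] k /=; first exact: is_derive_continuous (flat_is_derive k).
exists (fun x => flat k.+2 x - k%:R * flat k.+1 x); first exact: flat_is_derive.
have := nsmoothD (IH k.+2) (nsmoothZ (- k%:R) (IH k.+1)).
by congr nsmooth; apply/funext => x; rewrite mulNr.
Qed.

(** As [n] grows these functions, with values in [0, 1] and vanishing outside ]a, b[, converge to
    the indicator of that interval. For n = 0 the function is identically 0, hence the shift to
    [n.+1] in limits. *)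
Definition bump a b n x := flat 0 (n%:R * (x - a)) * flat 0 (n%:R * (b - x)).

Lemma bump_ge0 a b n x : 0 <= bump a b n x.
Proof. by rewrite mulr_ge0 ?flat_ge0. Qed.

Lemma flat0_le1 x : flat 0 x <= 1.
Proof.
rewrite /flat; case: ifP => // x0; rewrite expr0 mul1r -expR0 ler_expR oppr_le0 invr_ge0 ltW//.
Qed.

Lemma flat_neg k x : x <= 0 -> flat k x = 0.
Proof. by move=> x0; rewrite /flat ltNge x0. Qed.

Lemma bump_out a b n x : ~~ (x \in `]a, b[) -> bump a b n x = 0.
Proof.
rewrite in_itv /= negb_and -!leNgt => /orP[xa|bx].
  by rewrite /bump flat_neg ?mul0r// mulr_ge0_le0// subr_le0.
by rewrite /bump mulrC flat_neg ?mul0r// mulr_ge0_le0// subr_le0.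
Qed.

Lemma bump_le1 a b n x : bump a b n x <= 1.
Proof. by rewrite -[leRHS]mulr1 ler_pM ?flat_ge0 ?flat0_le1. Qed.

Lemma bump_cvg a b x : bump a b n.+1 x @[n --> \oo] --> (\1_(`]a, b[%classic : set R) x : R).
Proof.
rewrite indicE mem_setE; have [xab|xab] := boolP (x \in `]a, b[); last first.
  by apply: cvg_near_cst; apply: nearW => n; rewrite bump_out.
move: xab; rewrite in_itv /= => /andP[ax xb].
have H d : 0 < d -> flat 0 (n.+1%:R * d) @[n --> \oo] --> (1 : R).
  move=> d0; have -> : (fun n => flat 0 (n.+1%:R * d)) = (fun n => expR (- (d^-1 * n.+1%:R^-1))).
    apply/funext => n; rewrite /flat pmulr_lgt0// ltr0Sn expr0 mul1r invfM.
    by rewrite [_ * d^-1]mulrC.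
  rewrite -[X in _ --> X]expR0.
  apply: (@cvg_comp _ _ _ (fun n => - (d^-1 * n.+1%:R^-1)) expR _ (nbhs (0 : R)));
    last exact: continuous_expR.
  rewrite -oppr0; apply: cvgN; rewrite -(mulr0 d^-1); apply: cvgM; first exact: cvg_cst.
  exact: cvg_harmonic.
rewrite -[X in _ --> X]mulr1; apply: cvgM; apply: H; rewrite subr_gt0//.
Qed.

End SmoothFunctions.

(** * The du Bois-Reymond lemma *)

Section DuBoisReymond.
Context {R : realType}.
Local Notation mu := (@lebesgue_measure R).
Implicit Types (J h u v w g phi chi : R -> R) (x a b : R).

Definition locint v := forall a b, mu.-integrable `[a, b] (EFin \o v).

Lemma aeS (P Q : R -> Prop) : (forall x, P x -> Q x) ->
  {ae mu, forall x, P x} -> {ae mu, forall x, Q x}.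
Proof. by move=> PQ; apply: filterS PQ; exact: (ae_filter_ringOfSetsType mu). Qed.

Lemma Rint_split v a b x : locint v -> a <= b -> b <= x ->
  \int[mu]_(t in `[a, x]) v t =
  \int[mu]_(t in `[a, b]) v t + \int[mu]_(t in `[b, x]) v t.
Proof.
move=> iv ab bx; apply/eqP; rewrite addrC -subr_eq; apply/eqP.
rewrite (@Rintegral_itvB R v (BLeft a) _ b) ?bnd_simp//.
by rewrite Rintegral_itv_obnd_cbnd//; apply: integrableS (iv b x) => //; apply: subset_itvr; rewrite bnd_simp.
Qed.

Lemma primitive_exists v : locint v -> exists J, primitive J v.
Proof.
move=> iv.
exists (fun x => if 0 <= x then \int[mu]_(t in `[0, x]) v t
                 else - \int[mu]_(t in `[x, 0]) v t).
split=> // x y xy; have [x0|x0] := leP 0 x.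
  by rewrite (le_trans x0 xy) (Rint_split iv x0 xy) addrC addKr.
have [y0|y0] := leP 0 y; first by rewrite (Rint_split iv (ltW x0) y0) opprK addrC.
by rewrite opprK (Rint_split iv xy (ltW y0)) addrC addrK.
Qed.

Lemma locintD u v : locint u -> locint v -> locint (fun x => u x + v x).
Proof.
move=> iu iv a b.
have mI : measurable (`[a, b]%classic : set (measurableTypeR R)) by exact: measurable_itv.
exact: (integrableD mI (iu a b) (iv a b)).
Qed.

Lemma locintN v : locint v -> locint (fun x => - v x).
Proof.
move=> iv a b; rewrite (_ : EFin \o _ = -%E \o (EFin \o v)); last by apply/funext.
exact: integrableN.
Qed.

Lemma continuous_locint v : continuous v -> locint v.
Proof. by move=> cv a b; exact: continuous_itv_integrable. Qed.

Lemma locint_measurable v : locint v -> measurable_fun setT v.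
Proof.
move=> iv.
have -> : [set: R] = \bigcup_n `[- n%:R, n%:R]%classic.
  apply/seteqP; split=> // x _; exists (Num.trunc `|x|).+1 => //=.
  by rewrite in_itv /= -ler_norml ltW// truncnS_gt.
apply/measurable_fun_bigcup => [n|n]; first exact: measurable_itv.
by have /measurable_int/measurable_EFinP := iv (- n%:R) n%:R.
Qed.

Lemma supp_mul_integrable phi v (L : R) : continuous phi -> locint v ->
  (forall x, L < `|x| -> phi x = 0) ->
  mu.-integrable setT (EFin \o (fun x => phi x * v x)).
Proof.
move=> cphi iv phi0.
have mI : measurable (`[- L, L]%classic : set (measurableTypeR R)) by exact: measurable_itv.
have := integrable_patch mI (integrable_itv_mul cphi (iv (- L) L)).
congr (integrable _ _ (EFin \o _)); apply/funext => x.
rewrite patchE; case: ifPn => [//|/itv_notinP Lx].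
by rewrite (phi0 _ Lx) mul0r.
Qed.

(** Lebesgue's differentiation theorem, applied to [v] cut off to [-n, n] so as to have an
    integrable function; the countably many exceptional sets are then joined. *)
Lemma primitive_null J v : primitive J v -> (forall x, J x = J 0) ->
  v = (fun=> 0) %[ae mu].
Proof.
move=> pJ J0; have [iv _] := pJ.
have mI n : measurable (`[- n%:R, n%:R]%classic : set (measurableTypeR R)).
  exact: measurable_itv.
have H n : {ae mu, forall x, `|x| < n%:R -> v x = 0}.
  have iP := integrable_patch (mI n) (iv (- n%:R) n%:R).
  have l1 : forall y, mu.-integrable `]-oo, y] (EFin \o (v \_ `[- n%:R, n%:R])).
    by move=> y; apply: integrableS iP.
  have l2 : locally_integrable [set: R] (v \_ `[- n%:R, n%:R]).
    by apply: integrable_locally => //; exact: openT.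
  have := FTC1Ny l1 l2; apply: aeS => x [_ +] xn.
  rewrite patchE ifT; last by rewrite mem_setE in_itv /= -ler_norml ltW.
  have D : is_derive x 1 (fun y => \int[mu]_(t in `]-oo, y]) (v \_ `[- n%:R, n%:R]) t) 0; last first.
    by move=> <-; rewrite derive1E; have [_ ->] := D.
  apply: (@near_eq_is_derive _ _ _ (cst 0)) => //.
  move: xn; rewrite ltr_norml => /andP[nx xn].
  near=> y; rewrite (@Rint_left_patch R J v (- n%:R) n%:R y pJ).
  - by rewrite (J0 (- _)) (J0 y) subrr.
  - by apply: ltW; near: y; exact: lt_nbhsr.
  - by apply: ltW; near: y; exact: lt_nbhsl.
have : {ae mu, forall x, forall n, `|x| < n%:R -> v x = 0} by apply/ae_foralln => n; exact: H.
apply: aeS => x Hx _; apply: (Hx (Num.trunc `|x|).+1); exact: truncnS_gt.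
Unshelve. all: by end_near. Qed.

Lemma nsmooth_bump k a b n : nsmooth k (bump a b n).
Proof.
apply: nsmoothM.
  have := nsmooth_affine (n%:R) (- (n%:R * a)) (nsmooth_flat k 0).
  by congr nsmooth; apply/funext => x; rewrite mulrBr.
have := nsmooth_affine (- n%:R) (n%:R * b) (nsmooth_flat k 0).
by congr nsmooth; apply/funext => x; rewrite mulNr addrC mulrBr.
Qed.

Lemma bump_integral_cvg w a b : a < b -> locint w ->
  \int[mu]_x (bump a b n.+1 x * w x) @[n --> \oo] --> (\int[mu]_(x in `[a, b]) w x : R).
Proof.
move=> ab iw.
have mI : measurable (`]a, b[%classic : set (measurableTypeR R)) by exact: measurable_itv.
have mJ : measurable (`[a, b]%classic : set (measurableTypeR R)) by exact: measurable_itv.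
have cb n := nsmooth_continuous (nsmooth_bump 0 a b n).
have mw := locint_measurable iw.
pose f n x : \bar R := (bump a b n.+1 x * w x)%:E.
pose F := EFin \o (w \_ `]a, b[).
have io : mu.-integrable `]a, b[ (EFin \o w).
  by apply: integrableS (iw a b) => //; exact: subset_itv_oo_cc.
have iF : mu.-integrable setT F by exact: integrable_patch.
pose G := EFin \o ((fun x => `|w x|) \_ `[a, b]).
have mf n : measurable_fun setT (f n).
  apply/measurable_EFinP; apply: measurable_funM => //.
  exact: continuous_measurable_fun (cb _).
have mF : measurable_fun setT F by exact: measurable_int iF.
have fF : {ae mu, forall x, setT x -> f ^~ x @ \oo --> F x}.
  apply: aeW => x _; apply: cvg_EFin; first exact: nearW.
  have -> : (w \_ `]a, b[) x = \1_(`]a, b[%classic : set R) x * w x.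
    by rewrite patchE indicE; case: ifPn => _; rewrite ?mul1r ?mul0r.
  by apply: cvgM; [exact: bump_cvg|exact: cvg_cst].
have iG : mu.-integrable setT G.
  by apply: integrable_patch => //; exact: integrable_norm (iw a b).
have fG : {ae mu, forall x n, setT x -> (`|f n x| <= G x)%E}.
  apply: aeW => x n _; rewrite /f /G /= lee_fin patchE normrM.
  case: ifPn => xab.
    by rewrite ler_piMl// ger0_norm ?bump_ge0 ?bump_le1.
  rewrite bump_out ?normr0 ?mul0r//; apply: contra xab; rewrite mem_setE !in_itv /=.
  by move=> /andP[/ltW -> /ltW ->].
have [_ _ cv] := @dominated_convergence _ _ _ mu setT measurableT f F G mf mF fF iG fG.
have FE : (\int[mu]_(x in setT) F x)%E = (\int[mu]_(x in `[a, b]) w x)%:E.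
  rewrite -Rintegral_itv_obnd_cbnd -?Rintegral_itv_bndo_bndc//; last first.
    by apply: integrableS (iw a b) => //; exact: subset_itv_oc_cc.
  rewrite Rintegral_mkcond /Rintegral fineK//; exact: integrable_fin_num iF.
rewrite FE in cv.
by apply: (@fine_cvg _ _ _ _ (fun n => \int[mu]_(x in setT) f n x)%E).
Qed.

Lemma bump_supp a b n x : Num.max `|a| `|b| < `|x| -> bump a b n x = 0.
Proof.
rewrite gt_max => /andP[ax bx]; apply: bump_out; rewrite in_itv /=.
apply/negP => /andP[h1 h2]; move: ax bx.
have := ler_norm b; have := ler_norm (- a); rewrite normrN => h3 h4.
by have [x0|x0] := leP 0 x; [rewrite (ger0_norm x0)|rewrite (ltr0_norm x0)]; lra.
Qed.

(** The primitive from -oo vanishes on the left of the support, and on the right because the mean of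
    [chi] is zero. *)
Lemma smooth_primitive_test chi (L : R) : (forall n, nsmooth n chi) ->
  (forall x, L < `|x| -> chi x = 0) -> \int[mu]_x chi x = 0 ->
  exists2 psi, test_function psi & derive1 psi = chi.
Proof.
move=> sc c0 I0; have cc := nsmooth_continuous (sc 0%N).
have ic : mu.-integrable setT (EFin \o chi).
  rewrite (_ : chi = (fun x => chi x * 1)); last by apply/funext => x; rewrite mulr1.
  by apply: (supp_mul_integrable cc _ c0); apply: continuous_locint => x; exact: cvg_cst.
have pl : primitive (fun x => \int[mu]_(t in `]-oo, x]) chi t) chi.
  by apply: primitive_left => b; exact: integrableS ic.
set psi := (X in primitive X _) in pl.
have dp x : is_derive x 1 psi (chi x) by apply: (primitive_is_derive pl); exact: cc.
exists psi; last by apply/funext => x; rewrite derive1E; have [_ ->] := dp x.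
apply: (@smooth_test _ _ L) => [[|n]|x Lx].
- exact: primitive_continuous pl.
- by exists chi.
have Z (I : set R) : (forall y, I y -> chi y = 0) -> \int[mu]_(y in I) chi y = 0.
  move=> HI; rewrite /Rintegral integral0_eq// => y Iy; by rewrite HI.
have [x0|x0] := leP x 0.
  apply: Z => y /=; rewrite in_itv /= => yx; apply: c0.
  by move: Lx; rewrite !ler0_norm//; lra.
have -> : psi x = \int[mu]_y chi y - \int[mu]_(y in `]x, +oo[) chi y.
  rewrite -set_itvNyy -(@Rintegral_itvB R chi -oo%O +oo%O x) ?set_itvNyy//.
  by rewrite opprB addrCA subrr addr0.
rewrite I0 Z ?subr0// => y /=; rewrite in_itv /= andbT => xy; apply: c0.
by move: Lx; rewrite !gtr0_norm; lra.
Qed.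

Lemma test_derive phi : test_function phi -> test_function (derive1 phi).
Proof.
move=> [dphi [M HM]]; split=> [n x|]; first by have := dphi n.+1 x; rewrite /derive1n iterSr.
exists M => x Mx; rewrite derive1E.
suff [_ ->] : is_derive x 1 phi 0 by [].
apply: (@near_eq_is_derive _ _ _ (cst 0)) => //; near=> y; rewrite /cst /= HM//.
near: y; have cn : continuous (fun y : R => `|y|) by exact: norm_continuous.
by apply: (cvgr_gt _ (cn x)).
Unshelve. all: by end_near. Qed.

(** Subtracting a multiple of one reference bump gives every bump mean zero, hence makes it a
    derivative of a test function. So w and a fixed constant have the same integral against all
    bumps, and, as bumps sharpen to indicators, over all intervals. *)
Lemma weak_constant w : locint w ->
  (forall phi, test_function phi -> \int[mu]_x (derive1 phi x * w x) = 0) ->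
  exists c, w = (fun=> c) %[ae mu].
Proof.
move=> iw Hw.
have i1 : locint (fun=> 1) by apply: continuous_locint => x; exact: cvg_cst.
have icst (c : R) : locint (fun=> c) by apply: continuous_locint => x; exact: cvg_cst.
have ib a b n v : locint v -> mu.-integrable setT (EFin \o (fun x => bump a b n x * v x)).
  move=> iv; apply: supp_mul_integrable iv (@bump_supp a b n).
  exact: nsmooth_continuous (nsmooth_bump 0 a b n).
(* A reference bump of nonzero mean exists because the means tend to 1, the length of the
   interval. *)
have [n nz] : exists n, \int[mu]_x (bump 0 1 n x * 1) != 0.
  apply: contrapT => /forallNP H.
  have /cvg_lim : \int[mu]_x (bump 0 1 n.+1 x * 1) @[n --> \oo] --> (1 : R).
    have := bump_integral_cvg ltr01 i1.
    by rewrite Rintegral_cst//= lebesgue_measure_itv /= lte_fin ltr01 -EFinB /= subr0 mulr1.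
  have -> : (fun n => \int[mu]_x (bump 0 1 n.+1 x * 1)) = fun=> 0.
    by apply/funext => n; apply/eqP/negPn/negP; exact: H.
  by rewrite lim_cst// => /(_ (@Rhausdorff R))/eqP; rewrite eq_sym oner_eq0.
set ie := (X in X != 0) in nz.
pose c := (\int[mu]_x (bump 0 1 n x * w x)) / ie.
have B a b k : \int[mu]_x (bump a b k x * w x) = \int[mu]_x (bump a b k x * c).
  (* The multiple of the reference bump that cancels the mean. *)
  pose r := (\int[mu]_x (bump a b k x * 1)) / ie.
  pose chi x := bump a b k x + - r * bump 0 1 n x.
  have sc j : nsmooth j chi by apply: nsmoothD; [|apply: nsmoothZ]; exact: nsmooth_bump.
  have c0 x : Num.max (Num.max `|a| `|b|) (Num.max `|0 : R| `|1 : R|) < `|x| -> chi x = 0.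
    by rewrite gt_max => /andP[h1 h2]; rewrite /chi (bump_supp k h1) (bump_supp n h2) mulr0 addr0.
  have E v : locint v -> \int[mu]_x (chi x * v x) =
      \int[mu]_x (bump a b k x * v x) - r * \int[mu]_x (bump 0 1 n x * v x).
    move=> iv; rewrite -RintegralZl ?measurableT//; last exact: ib.
    rewrite -RintegralB ?measurableT//; last 2 first.
    - exact: ib.
    - exact: (integrableZl measurableT r (ib _ _ _ _ iv)).
    by apply: eq_Rintegral => x _; rewrite /chi; ring.
  have I0 : \int[mu]_x chi x = 0.
    have := E _ i1; under eq_Rintegral do rewrite mulr1.
    by move=> ->; rewrite /r divfK// subrr.
  have [psi tpsi dpsi] := smooth_primitive_test sc c0 I0.
  have := Hw psi tpsi; rewrite dpsi E// => /eqP; rewrite subr_eq0 => /eqP ->.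
  under [RHS]eq_Rintegral do rewrite -[c]mul1r mulrA.
  rewrite RintegralZr ?measurableT//; last exact: ib.
  by rewrite /r /c; ring.
have Hab a b : a <= b -> \int[mu]_(x in `[a, b]) (w x - c) = 0.
  rewrite le_eqVlt => /predU1P[->|ab]; first by rewrite set_itv1 Rintegral_set1.
  rewrite RintegralB//; last exact: icst.
  have h1 := bump_integral_cvg ab iw; have h2 := bump_integral_cvg ab (icst c).
  apply/eqP; rewrite subr_eq0; apply/eqP.
  rewrite (_ : (fun n => _) = fun k => \int[mu]_x (bump a b k.+1 x * c)) in h1.
    exact: (cvg_unique (@Rhausdorff R) h1 h2).
  by apply/funext => k; exact: B.
exists c.
have : (fun x => w x - c) = (fun=> 0) %[ae mu].
  apply: (@primitive_null (fun=> 0)) => //; split=> [a b|x y xy].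
    exact: (locintD iw (locintN (icst c))).
  by rewrite Hab// subrr.
by apply: aeS => x H _; apply/eqP; rewrite -subr_eq0 H.
Qed.

(** With [J] any primitive of [g], the difference u - J has weak derivative zero, so it is constant
    almost everywhere. *)
Lemma weak_primitive u g : locint u -> locint g ->
  (forall phi, test_function phi ->
    \int[mu]_x (phi x * g x) = - \int[mu]_x (derive1 phi x * u x)) ->
  exists2 J, primitive J g & u = J %[ae mu].
Proof.
move=> iu ig H; have [J pJ] := primitive_exists ig.
have iJ := continuous_locint (primitive_continuous pJ).
have [|c Hc] := @weak_constant (fun x => u x - J x) (locintD iu (locintN iJ)).
  move=> phi tphi; have [cphi cphi' dphi [L L0 phi0]] := test_functionP tphi.
  have [_ [M HM]] := test_derive tphi.
  have [_ _ E] := primitive_ibp L0 pJ cphi' dphi phi0.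
  transitivity (\int[mu]_x (derive1 phi x * u x - derive1 phi x * J x)).
    by apply: eq_Rintegral => x _; rewrite mulrBr.
  rewrite RintegralB ?measurableT//; try exact: (supp_mul_integrable cphi' _ HM).
  by rewrite E opprK (H _ tphi) subrr.
exists (fun x => J x + c).
  split=> [a b|x y xy]; first exact: ig.
  by rewrite -(pJ.2 _ _ xy); ring.
by move: Hc; apply: aeS => x /(_ I) Hx _; rewrite -Hx addrC subrK.
Qed.

End DuBoisReymond.

(** * Square-integrable spinor fields *)

Section SquareIntegrable.
Context {R : realType}.
Local Notation C := R[i].
Local Notation Re := complex.Re.
Local Notation Im := complex.Im.
Local Notation mu := (@lebesgue_measure R).
Implicit Types (f g u : R -> 'cV[C]_2) (A h : R -> R).

Definition sqint f : \bar R := (\int[mu]_x ((spinor_norm (f x)) ^+ 2)%:E)%E.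

Lemma LpN2E f : LpN 2%:E f = poweR (sqint f) 2^-1.
Proof.
rewrite /LpN /sqint unlock; congr (poweR _ _).
apply: eq_integral => x _ /=.
by rewrite ger0_norm ?spinor_norm_ge0// powR_mulrn ?spinor_norm_ge0.
Qed.

Lemma sqint_ge0 f : (0 <= sqint f)%E.
Proof. by apply: integral_ge0 => x _; rewrite lee_fin sqr_ge0. Qed.

Lemma L2E f : L2 f <-> spinor_measurable f /\ (sqint f < +oo)%E.
Proof.
rewrite /L2 LpN2E; split=> -[mf H]; split=> //.
  by apply: lty_poweRy H; rewrite invr_neq0.
exact: poweR_lty.
Qed.

Lemma L2_integrable f : L2 f ->
  mu.-integrable setT (EFin \o (fun x => spinor_norm (f x) ^+ 2)).
Proof.
move=> /L2E[mf lf]; apply/integrableP; split.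
  apply/measurable_EFinP; apply: measurable_funX; exact: measurable_spinor_norm.
apply: le_lt_trans lf; rewrite le_eqVlt; apply/orP; left; apply/eqP.
by apply: eq_integral => x _ /=; rewrite ger0_norm ?sqr_ge0.
Qed.

Definition sqnorm f : R := \int[mu]_x (spinor_norm (f x) ^+ 2).

Lemma sqint_sqnorm f : L2 f -> sqint f = (sqnorm f)%:E.
Proof.
by move=> lf; rewrite /sqnorm /Rintegral fineK//; exact: integrable_fin_num (L2_integrable lf).
Qed.

Lemma LpN_le (K : R) f g : 0 <= K -> (sqint g <= (K ^+ 2)%:E * sqint f)%E ->
  (LpN 2%:E g <= K%:E * LpN 2%:E f)%E.
Proof.
move=> K0 H; rewrite !LpN2E.
have -> : K%:E = poweR (K ^+ 2)%:E 2^-1.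
  by rewrite poweR_EFin -powR_mulrn// -powRrM mulfV// powRr1.
rewrite -poweRM ?sqint_ge0 ?lee_fin ?sqr_ge0//.
apply: gt0_ler_poweR => //.
- by rewrite in_itv /= sqint_ge0 leey.
- by rewrite in_itv /= leey mule_ge0 ?sqint_ge0 ?lee_fin ?sqr_ge0.
Qed.

Lemma opnorm_le (K : R) (B : operator) : 0 <= K ->
  (forall f, L2 f -> (sqint (B f) <= (K ^+ 2)%:E * sqint f)%E) -> (opnorm B <= K%:E)%E.
Proof.
move=> K0 H; apply: ereal_inf_lbound; exists K => //; split=> // f lf.
by apply: LpN_le => //; exact: H.
Qed.

Lemma opnorm_ge0 (B : @operator R) : (0 <= opnorm B)%E.
Proof. by apply: le_ereal_inf_tmp => _ [K [K0 _] <-]; rewrite lee_fin. Qed.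

Lemma L2_dom (a b : R) f g u : spinor_measurable u -> L2 f -> L2 g ->
  (forall x, spinor_norm (u x) <= a * spinor_norm (f x) + b * spinor_norm (g x)) -> L2 u.
Proof.
move=> mu' lf lg H; apply/L2E; split=> //.
have i1 := integrableZl measurableT (2 * a ^+ 2) (L2_integrable lf).
have i2 := integrableZl measurableT (2 * b ^+ 2) (L2_integrable lg).
have i3 := integrableD measurableT i1 i2.
have : mu.-integrable setT (EFin \o (fun x => spinor_norm (u x) ^+ 2)).
  apply: (@dominated_integrable _ _ (fun x => 2 * a ^+ 2 * spinor_norm (f x) ^+ 2 +
     2 * b ^+ 2 * spinor_norm (g x) ^+ 2)) => //.
    by apply: measurable_funX; exact: measurable_spinor_norm.
  move=> x _; rewrite ger0_norm ?sqr_ge0//.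
  have h0 := spinor_norm_ge0 (u x).
  set p := a * spinor_norm (f x) in H *; set r := b * spinor_norm (g x).
  have : spinor_norm (u x) ^+ 2 <= (a * spinor_norm (f x) + b * spinor_norm (g x)) ^+ 2.
    by rewrite ler_sqr ?nnegrE ?(le_trans h0).
  have := sqr_ge0 (a * spinor_norm (f x) - b * spinor_norm (g x)).
  by nra.
move=> /integrableP[_]; apply: le_lt_trans.
rewrite le_eqVlt; apply/orP; left; apply/eqP.
by apply: eq_integral => x _ /=; rewrite ger0_norm ?sqr_ge0.
Qed.

Lemma cauchy_schwarz A h : measurable_fun setT A -> measurable_fun setT h ->
  mu.-integrable setT (EFin \o (fun x => A x ^+ 2)) ->
  mu.-integrable setT (EFin \o (fun x => h x ^+ 2)) ->
  mu.-integrable setT (EFin \o (fun x => A x * h x)) /\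
  (\int[mu]_x (A x * h x)) ^+ 2 <= (\int[mu]_x (A x ^+ 2)) * (\int[mu]_x (h x ^+ 2)).
Proof.
move=> mA mh iA ih.
have iAh : mu.-integrable setT (EFin \o (fun x => A x * h x)).
  apply: (@dominated_integrable _ _ (fun x => A x ^+ 2 + h x ^+ 2)) => //.
  - exact: measurable_funM.
  - move=> x _; rewrite normrM -[A x ^+ 2]real_normK ?num_real// -[h x ^+ 2]real_normK ?num_real//.
    have := sqr_ge0 (`|A x| - `|h x|); have := normr_ge0 (A x); have := normr_ge0 (h x).
    by nra.
  - exact: (integrableD measurableT iA ih).
split=> //.
set a := \int[mu]_x (A x ^+ 2); set c := \int[mu]_x (h x ^+ 2); set b := \int[mu]_x _.
have a0 : 0 <= a by apply: Rintegral_ge0 => x _; exact: sqr_ge0.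
have H t : 0 <= t ^+ 2 * a - 2 * t * b + c.
  have : 0 <= \int[mu]_x ((t * A x - h x) ^+ 2) by apply: Rintegral_ge0 => x _; exact: sqr_ge0.
  have -> : \int[mu]_x ((t * A x - h x) ^+ 2) =
      \int[mu]_x (t ^+ 2 * A x ^+ 2 + ((- (2 * t)) * (A x * h x) + h x ^+ 2)).
    by apply: eq_Rintegral => x _; ring.
  have i1 := integrableZl measurableT (t ^+ 2) iA.
  have i2 := integrableZl measurableT (- (2 * t)) iAh.
  rewrite (RintegralD measurableT i1 (integrableD measurableT i2 ih)).
  rewrite (RintegralD measurableT i2 ih) !RintegralZl ?measurableT//.
  by rewrite -/a -/b -/c; lra.
have [a1|a1] := eqVneq a 0.
  rewrite a1 mul0r; suff -> : b = 0 by rewrite expr0n.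
  apply/eqP; apply: contraT => b0.
  (* When the quadratic term vanishes the inequality is affine in t; at this value it reads 0 <=
     -1. *)
  have := H ((c + 1) / (2 * b)); rewrite a1 mulr0 add0r.
  have -> : 2 * ((c + 1) / (2 * b)) * b = c + 1 by field.
  by lra.
have ap : 0 < a by rewrite lt_neqAle eq_sym a1.
have := H (b / a).
have -> : (b / a) ^+ 2 * a - 2 * (b / a) * b + c = c - b ^+ 2 / a by field; rewrite a1.
by rewrite subr_ge0 ler_pdivrMr// mulrC.
Qed.

Lemma L2_mintegrable f a b : L2 f -> mintegrable `[a, b] f.
Proof.
move=> lf; have mI : measurable (`[a, b]%classic : set (measurableTypeR R)) by exact: measurable_itv.
apply: (@dominated_mintegrable _ _ _ _ _ (fun x => 2 * (1 + spinor_norm (f x) ^+ 2))) => //.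
- by move=> i j; have [/spinor_measurableE mf _] := lf; have [h1 h2] := mf i j; split; exact: measurable_funTS.
- move=> x _; apply: le_trans (mnorm_le_spinor _) _; rewrite ler_pM2l//.
  by have := spinor_norm_ge0 (f x); nra.
have i1 : mu.-integrable `[a, b] (EFin \o (fun=> 1 : R)).
  by apply: continuous_itv_integrable => x; exact: cvg_cst.
have i2 : mu.-integrable `[a, b] (EFin \o (fun x => spinor_norm (f x) ^+ 2)).
  by apply: integrableS (L2_integrable lf).
exact: (integrableZl mI 2 (integrableD mI i1 i2)).
Qed.

Lemma weak_mprimitive u g : L2 u -> L2 g -> weak_derivative u g ->
  exists2 J, mprimitive J g & u = J %[ae mu].
Proof.
move=> lu lg w.
have iu a b := L2_mintegrable a b lu; have ig a b := L2_mintegrable a b lg.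
have H (i : 'I_2) : (exists2 J, primitive J (fun x => Re (g x i 0)) & (fun x => Re (u x i 0)) = J %[ae mu]) /\
   (exists2 J, primitive J (fun x => Im (g x i 0)) & (fun x => Im (u x i 0)) = J %[ae mu]).
  split; apply: weak_primitive.
  - by move=> a b; have [] := iu a b i 0.
  - by move=> a b; have [] := ig a b i 0.
  - move=> phi tphi; have := w phi tphi; rewrite !distrE => /matrixP/(_ i 0).
    rewrite !mxE /cint => /(congr1 (@complex.Re R)); rewrite ReN /= => E.
    transitivity (\int[mu]_x Re ((((phi x)%:C)%C *: g x) i 0)).
      by apply: eq_Rintegral => x _; rewrite mxE ReM /=; ring.
    rewrite E; congr (- _).
    by apply: eq_Rintegral => x _; rewrite mxE ReM /=; ring.
  - by move=> a b; have [] := iu a b i 0.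
  - by move=> a b; have [] := ig a b i 0.
  - move=> phi tphi; have := w phi tphi; rewrite !distrE => /matrixP/(_ i 0).
    rewrite !mxE /cint => /(congr1 (@complex.Im R)); rewrite ImN /= => E.
    transitivity (\int[mu]_x Im ((((phi x)%:C)%C *: g x) i 0)).
      by apply: eq_Rintegral => x _; rewrite mxE ImM /=; ring.
    rewrite E; congr (- _).
    by apply: eq_Rintegral => x _; rewrite mxE ImM /=; ring.
have [[a0 pa0 ea0] [b0 pb0 eb0]] := H 0; have [[a1 pa1 ea1] [b1 pb1 eb1]] := H 1.
exists (fun x => \col_i (if i == 0 then (a0 x +i* b0 x)%C else (a1 x +i* b1 x)%C)).
  move=> i j; rewrite (ord1 j); case: (I2P i) => ->; split.
  - by under eq_fun do rewrite mxE /=.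
  - by under eq_fun do rewrite mxE /=.
  - by under eq_fun do rewrite mxE /=.
  - by under eq_fun do rewrite mxE /=.
have H2 (P Q : R -> Prop) : {ae mu, forall x, P x} -> {ae mu, forall x, Q x} -> {ae mu, forall x, P x /\ Q x}.
  move=> h1 h2; have FF := ae_filter_ringOfSetsType mu; exact: filterI h1 h2.
apply: aeS (H2 _ _ (H2 _ _ ea0 eb0) (H2 _ _ ea1 eb1)) => x [[h1 h2] [h3 h4]] _.
apply/matrixP => i j; rewrite (ord1 j) !mxE; case: (I2P i) => ->; apply: complexP => /=.
- exact: h1.
- exact: h2.
- exact: h3.
- exact: h4.
Qed.

End SquareIntegrable.

(** * Schur's test, rank-one kernels and integrable powers *)

Section IntegralOperators.
Context {R : realType}.
Local Notation mu := (@lebesgue_measure R).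
Implicit Types (f F A h U : R -> R) (x y : R).

(** Over [-n, n] the integral is F(n) - F(-n), at most 2 M; monotone convergence does the rest. *)
Lemma bounded_primitive_integrable F f (M : R) : continuous f -> (forall x, 0 <= f x) ->
  (forall x, is_derive x 1 F (f x)) -> (forall x, `|F x| <= M) ->
  mu.-integrable setT (EFin \o f) /\ (\int[mu]_x (f x)%:E <= (2 * M)%:E)%E.
Proof.
move=> cf f0 dF FM.
have mf : measurable_fun setT f by exact: continuous_measurable_fun.
have L : (\int[mu]_x (f x)%:E <= (2 * M)%:E)%E.
  pose D (n : nat) := `[- n%:R, n%:R]%classic : set (measurableTypeR R).
  have -> : [set: measurableTypeR R] = \bigcup_n D n.
    apply/seteqP; split=> // x _; exists (Num.trunc `|x|).+1 => //=.
    by rewrite /D /= in_itv /= -ler_norml ltW// truncnS_gt.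
  have cv := @ge0_nondecreasing_set_cvg_integral _ (measurableTypeR R) R D (EFin \o f) mu.
  have {}cv : (\int[mu]_(x in D n) (EFin \o f) x)%E @[n --> \oo] --> (\int[mu]_(x in \bigcup_n D n) (EFin \o f) x)%E.
  apply: cv.
  - move=> m n mn; apply/subsetPset => x; rewrite /D /= !in_itv /= -!ler_norml => /le_trans; apply.
    by rewrite ler_nat.
  - by move=> n; exact: measurable_itv.
  - by move=> n; apply/measurable_EFinP; exact: measurable_funTS.
  - by move=> n x _; rewrite lee_fin.
  rewrite -(cvg_lim _ cv)//; apply: lime_le; first exact: cvgP cv.
  apply: nearW => n.
  have [i1 E] := primitive_derive cf dF.
  have n0 : - n%:R <= n%:R :> R by rewrite ge0_cp// .
  have -> : (\int[mu]_(x in D n) (EFin \o f) x)%E = (F n%:R - F (- n%:R))%:E.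
    by rewrite (E _ _ n0) /Rintegral fineK//; exact: integrable_fin_num (i1 _ _).
  rewrite lee_fin; have := FM n%:R; have := FM (- n%:R); rewrite !ler_norml.
  by move=> /andP[a1 a2] /andP[a3 a4]; lra.
split=> //; apply/integrableP; split; first exact/measurable_EFinP.
apply: (@le_lt_trans _ _ (2 * M)%:E); last exact: ltry.
apply: le_trans L; rewrite le_eqVlt; apply/orP; left; apply/eqP.
by apply: eq_integral => x _ /=; rewrite ger0_norm.
Qed.

(** A smooth symmetric majorant of exponentially decaying kernels whose integral is available
    through the arctangent. *)
Definition cauchy_kernel x y : R := (1 + (x - y) ^+ 2)^-1.

Lemma one_sqr_gt0 x : 0 < 1 + x ^+ 2.
Proof. by have := sqr_ge0 x; lra. Qed.

Lemma cauchy_kernelC x y : cauchy_kernel x y = cauchy_kernel y x.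
Proof. by rewrite /cauchy_kernel -sqrrN opprB. Qed.

Lemma cauchy_kernel_gt0 x y : 0 < cauchy_kernel x y.
Proof. by rewrite invr_gt0 one_sqr_gt0. Qed.

Lemma cauchy_kernel_le1 x y : cauchy_kernel x y <= 1.
Proof. by rewrite invf_le1 ?one_sqr_gt0// lerDl sqr_ge0. Qed.

Lemma is_derive_atan x : is_derive x 1 (@atan R) (1 + x ^+ 2)^-1.
Proof. by apply: DeriveDef; [exact: derivable_atan|rewrite -derive1E derive1_atan]. Qed.

Lemma continuous_poly2 (a : R) : continuous (fun y => 1 + (y - a) ^+ 2).
Proof.
move=> y; apply: cvgD; first exact: cvg_cst.
rewrite expr2; apply: cvgM; (apply: cvgB; [exact: cvg_id|exact: cvg_cst]).
Qed.

Lemma continuous_cauchy_kernel x : continuous (fun y => cauchy_kernel y x).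
Proof.
move=> y; apply: cvgV; first by rewrite gt_eqF ?one_sqr_gt0.
exact: continuous_poly2.
Qed.

Lemma cauchy_kernel_integrable x :
  mu.-integrable setT (EFin \o (fun y => cauchy_kernel y x)) /\
  (\int[mu]_y (cauchy_kernel y x)%:E <= (pi : R)%:E)%E.
Proof.
have -> : pi = 2 * (pi / 2) :> R by field.
apply: (@bounded_primitive_integrable (fun y => atan (y - x))).
- exact: continuous_cauchy_kernel.
- by move=> y; exact: ltW (cauchy_kernel_gt0 _ _).
- move=> y.
  have ds : is_derive y 1 (fun y => y - x) 1.
    apply: (is_derive_eq (is_derive_sub (is_derive_id y 1) (is_derive_cst x y 1))).
    by rewrite subr0.
  by apply: (is_derive_eq (@is_derive1_comp _ (@atan R) _ y _ _ (is_derive_atan _) ds)); rewrite mulr1.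
- by move=> y; rewrite ler_norml !ltW ?atan_gtNpi2 ?atan_ltpi2.
Qed.

(** Cauchy-Schwarz with the kernel split into two square roots gives one factor pi; exchanging the
    integrals by Tonelli gives the other. *)
Lemma schur_cauchy (K : R) U h : measurable_fun setT U -> measurable_fun setT h -> 0 <= K ->
  (forall x, 0 <= U x) ->
  mu.-integrable setT (EFin \o (fun x => h x ^+ 2)) ->
  (forall x, U x <= K * \int[mu]_y (cauchy_kernel y x * h y)) ->
  (\int[mu]_x (U x ^+ 2)%:E <= ((K * pi) ^+ 2)%:E * \int[mu]_x (h x ^+ 2)%:E)%E.
Proof.
move=> mU mh K0 U0 ih UK.
pose G (z : R * R) := cauchy_kernel z.2 z.1 * h z.2 ^+ 2.
have G0 z : (0 <= (G z)%:E)%E.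
  by rewrite lee_fin mulr_ge0 ?sqr_ge0// ltW ?cauchy_kernel_gt0.
have mG : measurable_fun setT (EFin \o G).
  apply/measurable_EFinP; apply: measurable_funM.
    have -> : (fun z : R * R => cauchy_kernel z.2 z.1) = (fun t => cauchy_kernel t 0) \o (fun z : R * R => z.2 - z.1).
      by apply/funext => z; rewrite /cauchy_kernel /= subr0.
    apply: measurableT_comp; first exact: continuous_measurable_fun (@continuous_cauchy_kernel 0).
    exact: measurable_funB.
  by apply: measurable_funX; exact: measurableT_comp.
have iG x : mu.-integrable setT (EFin \o (fun y => cauchy_kernel y x * h y ^+ 2)).
  apply: (@dominated_integrable _ _ (fun y => h y ^+ 2)) => //.
    apply: measurable_funM; last exact: measurable_funX.
    exact: continuous_measurable_fun (@continuous_cauchy_kernel x).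
  move=> y _; rewrite ger0_norm; last by rewrite mulr_ge0 ?sqr_ge0// ltW ?cauchy_kernel_gt0.
  by rewrite ler_piMl ?sqr_ge0 ?cauchy_kernel_le1.
have pw x : U x ^+ 2 <= K ^+ 2 * pi * \int[mu]_y (cauchy_kernel y x * h y ^+ 2).
  pose s y := Num.sqrt (cauchy_kernel y x).
  have s2 y : s y ^+ 2 = cauchy_kernel y x by rewrite sqr_sqrtr// ltW ?cauchy_kernel_gt0.
  have ms : measurable_fun setT s.
    apply: measurableT_comp; first exact: (continuous_measurable_fun (@sqrt_continuous R)).
    exact: continuous_measurable_fun (@continuous_cauchy_kernel x).
  have [ik lk] := cauchy_kernel_integrable x.
  have [||_ CS] := @cauchy_schwarz _ s (fun y => s y * h y) ms (measurable_funM ms mh).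
  - by under eq_fun do rewrite s2.
  - by under eq_fun do rewrite exprMn s2; exact: iG.
  have E1 : \int[mu]_y (s y * (s y * h y)) = \int[mu]_y (cauchy_kernel y x * h y).
    by apply: eq_Rintegral => y _; rewrite mulrA -expr2 s2.
  have E2 : \int[mu]_y (s y ^+ 2) <= pi.
    under eq_Rintegral do rewrite s2.
    by rewrite -lee_fin /Rintegral fineK//; exact: integrable_fin_num ik.
  have E3 : \int[mu]_y ((s y * h y) ^+ 2) = \int[mu]_y (cauchy_kernel y x * h y ^+ 2).
    by apply: eq_Rintegral => y _; rewrite exprMn s2.
  rewrite E1 E3 in CS.
  have I0 : 0 <= \int[mu]_y (cauchy_kernel y x * h y ^+ 2).
    by apply: Rintegral_ge0 => y _; rewrite mulr_ge0 ?sqr_ge0// ltW ?cauchy_kernel_gt0.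
  apply: (@le_trans _ _ ((K * \int[mu]_y (cauchy_kernel y x * h y)) ^+ 2)).
    by rewrite ler_sqr ?nnegrE ?(le_trans (U0 x)).
  rewrite exprMn -mulrA ler_wpM2l ?sqr_ge0// (le_trans CS)// ler_wpM2r//.
have mT : measurable_fun setT (fun x => \int[mu]_y (EFin \o G) (x, y))%E.
  by have := @measurable_fun_fubini_tonelli_F _ _ _ _ _ mu _ mG G0; apply.
apply: (@le_trans _ _ (\int[mu]_x ((K ^+ 2 * pi)%:E * \int[mu]_y (EFin \o G) (x, y)))%E).
  apply: ge0_le_integral => //.
  - by move=> x _; rewrite lee_fin sqr_ge0.
  - by apply/measurable_EFinP; exact: measurable_funX.
  - by apply: emeasurable_funM.
  move=> x _; have -> : (\int[mu]_y (EFin \o G) (x, y))%E = (\int[mu]_y (cauchy_kernel y x * h y ^+ 2))%:E.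
    by rewrite /Rintegral fineK//; exact: integrable_fin_num (iG x).
  by rewrite -EFinM lee_fin.
have pi0 : 0 <= pi :> R by exact: pi_ge0.
pose T x : \bar R := (\int[mu]_y (EFin \o G) (x, y))%E.
have c0 : (0 <= (K ^+ 2 * pi)%:E)%E by rewrite lee_fin mulr_ge0 ?sqr_ge0.
have T0 x : setT x -> (0 <= T x)%E by move=> _; apply: integral_ge0 => y _; exact: G0.
have -> := @ge0_integralZl _ _ _ mu setT measurableT T mT _ T0 c0.
have -> : (\int[mu]_x T x = \int[mu]_y \int[mu]_x (EFin \o G) (x, y))%E.
  exact: fubini_tonelli.
have -> : ((K * pi) ^+ 2)%:E = ((K ^+ 2 * pi)%:E * (pi : R)%:E)%E.
  by rewrite -EFinM; congr EFin; ring.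
rewrite -muleA; apply: lee_wpmul2l; first exact: c0.
rewrite -ge0_integralZl//; last 2 first.
- by apply/measurable_EFinP; exact: measurable_funX.
- by move=> x _; rewrite lee_fin sqr_ge0.
apply: ge0_le_integral => //.
- by move=> y _; apply: integral_ge0 => x _; exact: G0.
- by have := @measurable_fun_fubini_tonelli_G _ _ _ _ _ mu _ mG G0; apply.
- by apply: emeasurable_funM => //; apply/measurable_EFinP; exact: measurable_funX.
move=> y _; have [ik lk] := cauchy_kernel_integrable y.
rewrite /= /G /=; under eq_integral do rewrite cauchy_kernelC mulrC EFinM.
rewrite ge0_integralZl//; last 3 first.
- by apply/measurable_EFinP; exact: continuous_measurable_fun (@continuous_cauchy_kernel y).
- by move=> x _; rewrite lee_fin ltW ?cauchy_kernel_gt0.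
- by rewrite lee_fin sqr_ge0.
by rewrite muleC; apply: lee_wpmul2r => //; rewrite lee_fin sqr_ge0.
Qed.

Lemma rank_one_bound (K : R) A U h : measurable_fun setT U -> measurable_fun setT h ->
  measurable_fun setT A -> 0 <= K -> (forall x, 0 <= U x) ->
  mu.-integrable setT (EFin \o (fun x => A x ^+ 2)) ->
  mu.-integrable setT (EFin \o (fun x => h x ^+ 2)) ->
  (forall x, U x <= K * A x * \int[mu]_y (A y * h y)) ->
  (\int[mu]_x (U x ^+ 2)%:E <= ((K * \int[mu]_x (A x ^+ 2)) ^+ 2)%:E * \int[mu]_x (h x ^+ 2)%:E)%E.
Proof.
move=> mU mh mA K0 U0 iA ih UK.
have [iAh CS] := cauchy_schwarz mA mh iA ih.
set b := \int[mu]_y (A y * h y) in CS UK.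
have := integrableZl measurableT ((K * b) ^+ 2) iA => iR.
apply: (@le_trans _ _ (\int[mu]_x ((K * b) ^+ 2 * A x ^+ 2)%:E)%E).
  apply: ge0_le_integral => //.
  - by move=> x _; rewrite lee_fin sqr_ge0.
  - by apply/measurable_EFinP; exact: measurable_funX.
  - exact: measurable_int iR.
  move=> x _; rewrite lee_fin -exprMn mulrAC ler_sqr ?nnegrE ?(le_trans (U0 x))//.
have -> : (\int[mu]_x ((K * b) ^+ 2 * A x ^+ 2)%:E)%E = ((K * b) ^+ 2 * \int[mu]_x (A x ^+ 2))%:E.
  by rewrite -RintegralZl// /Rintegral fineK//; exact: integrable_fin_num iR.
have -> : (\int[mu]_x (h x ^+ 2)%:E)%E = (\int[mu]_x (h x ^+ 2))%:E.
  by rewrite /Rintegral fineK//; exact: integrable_fin_num ih.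
have a0 : 0 <= \int[mu]_x (A x ^+ 2) by apply: Rintegral_ge0 => x _; exact: sqr_ge0.
rewrite -EFinM lee_fin !exprMn -!(mulrA (K ^+ 2)) ler_wpM2l ?sqr_ge0//.
by rewrite mulrC [(_ ^+ 2) in leRHS]expr2 -(mulrA (\int[mu]_x (A x ^+ 2))) ler_wpM2l.
Qed.

Lemma japanese_gt0 x : 0 < japanese x :> R.
Proof. by rewrite sqrtr_gt0 one_sqr_gt0. Qed.

Lemma japanese_ge1 x : 1 <= japanese x :> R.
Proof. by rewrite -[X in X <= _]sqrtr1 ler_wsqrtr// lerDl sqr_ge0. Qed.

Lemma bweight_japanese x : bweight x <= 2 * japanese x.
Proof.
have h1 : 1 <= japanese x := japanese_ge1 x.
suff : `|x| <= japanese x by rewrite /bweight; lra.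
by rewrite -sqrtr_sqr ler_wsqrtr// lerDr.
Qed.

Lemma continuous_japanese : continuous (@japanese R).
Proof.
move=> x; apply: (@continuous_comp _ _ _ (fun x : R => 1 + x ^+ 2) Num.sqrt); last exact: sqrt_continuous.
by have := @continuous_poly2 0 x; under eq_fun do rewrite subr0.
Qed.

Lemma powR_gt0_continuous (g : R -> R) (a : R) : continuous g -> (forall x, 0 < g x) ->
  continuous (fun x => g x `^ a).
Proof.
move=> cg g0 x; apply: (@continuous_comp _ _ _ g (fun y => y `^ a)); first exact: cg.
apply: differentiable_continuous; apply/derivable1_diffP.
by have [] := is_derive1_powR a (g0 x).
Qed.

(** In place of a primitive of the power itself, an explicit bounded function is used whose
    derivative dominates [eta] times the power. *)
Lemma japanese_powR_integrable (eta : R) : 0 < eta ->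
  mu.-integrable setT (EFin \o (fun x => japanese x `^ (- 1 - eta))).
Proof.
move=> eta0.
pose a := - ((1 + eta) / 2); pose Y x : R := 1 + x ^+ 2; pose p x := Y x `^ a.
have Y0 x : 0 < Y x by exact: one_sqr_gt0.
have pE x : japanese x `^ (- 1 - eta) = p x.
  have -> : japanese x = Y x `^ 2^-1 by rewrite powR12_sqrt// ltW.
  rewrite -powRrM /p; congr (_ `^ _).
  by rewrite /a; field.
have cY : continuous Y by have := @continuous_poly2 0; under eq_fun do rewrite subr0.
have cp : continuous p by exact: powR_gt0_continuous.
have p0 x : 0 <= p x by exact: powR_ge0.
have pj x : p x * japanese x <= 1.
  rewrite -pE -[X in _ * X](powRr1 (ltW (japanese_gt0 x))) -powRD; last by rewrite (gt_eqF (japanese_gt0 x)) implybT.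
  rewrite -[leRHS](powRr0 (japanese x)) ler_powR ?japanese_ge1//; lra.
have p1 x : p x <= 1.
  by apply: le_trans (pj x); rewrite ler_peMr ?japanese_ge1.
have dY x : is_derive x 1 Y (2 * x).
  have dX : is_derive x 1 (fun x : R => x * x) (2 * x).
    by apply: (is_derive_eq (is_derive_mul (is_derive_id x 1) (is_derive_id x 1))); ring.
  have := is_derive_add (is_derive_cst (1 : R) x 1) dX; rewrite add0r.
  by under eq_fun do rewrite -expr2.
have dp x : is_derive x 1 p (- (1 + eta) * x * (p x / Y x)).
  apply: (is_derive_eq (@is_derive1_comp _ (fun y => y `^ a) Y x _ _ (is_derive1_powR a (Y0 x)) (dY x))).
  rewrite powRB; last by rewrite (gt_eqF (Y0 x)) implybT.
  by rewrite (powRr1 (ltW (Y0 x))) -/(p x) /a; field; rewrite gt_eqF.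
pose P x := (1 + eta) / Y x - (p x - (1 + eta) * x ^+ 2 * (p x / Y x)).
(* The term x p(x) is bounded because p decays faster than 1/<x>. Differentiating it leaves - eta p
   up to a multiple of (1 - p)/Y, and the arctangent gives the remainder the right sign. *)
pose F x := (1 + eta) * atan x - x * p x.
have EP x : P x = eta * p x + (1 + eta) * (1 - p x) / Y x.
  have E : x ^+ 2 = Y x - 1 by rewrite /Y; ring.
  by rewrite /P E; field; rewrite gt_eqF.
have le_P x : eta * p x <= P x.
  rewrite EP lerDl divr_ge0 ?(ltW (Y0 x))// mulr_ge0 ?subr_ge0//; lra.
have P0 x : 0 <= P x by apply: le_trans (le_P x); rewrite mulr_ge0// ltW.
have cP : continuous P.
  have -> : P = fun x => eta * p x + (1 + eta) * (1 - p x) / Y x by exact/funext.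
  move=> x; apply: cvgD; first by apply: cvgM; [exact: cvg_cst|exact: cp].
  apply: cvgM; last by apply: cvgV; [rewrite gt_eqF|exact: cY].
  apply: cvgM; first exact: cvg_cst.
  by apply: cvgB; [exact: cvg_cst|exact: cp].
have dF x : is_derive x 1 F (P x).
  apply: (is_derive_eq (is_derive_sub (is_derive_scale (1 + eta) (is_derive_atan x))
    (is_derive_mul (is_derive_id x 1) (dp x)))).
  by rewrite /P -/(Y x); ring.
have [|iP _] := @bounded_primitive_integrable F P ((1 + eta) * (pi / 2) + 1) cP P0 dF.
  move=> x; apply: le_trans (ler_normB _ _) _; rewrite lerD//.
    rewrite normrM gtr0_norm; last lra.
    rewrite ler_pM2l; last lra.
    by rewrite ler_norml !ltW ?atan_gtNpi2 ?atan_ltpi2.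
  rewrite normrM (ger0_norm (p0 x)) mulrC; apply: le_trans (pj x); rewrite ler_wpM2l//.
  by rewrite -sqrtr_sqr ler_wsqrtr// lerDr.
apply: (@dominated_integrable _ _ (fun x => eta^-1 * P x)) => //.
- by apply: continuous_measurable_fun; under eq_fun do rewrite pE.
- by move=> x _; rewrite ger0_norm ?powR_ge0// pE ler_pdivlMl.
exact: (integrableZl measurableT eta^-1 iP).
Qed.

End IntegralOperators.

(** * Inverting the Joukowski map *)

Section Joukowski.
Context {R : realType}.
Local Notation C := R[i].
Local Notation Re := complex.Re.
Local Notation Im := complex.Im.
Variable m : R.
Hypothesis m0 : 0 < m.
Local Notation mC := ((m%:C)%C : C).
Implicit Types (z w zeta : C).

Lemma energy_unit zeta : cabs zeta = 1 -> Im (energy m zeta) = 0 /\ cabs (energy m zeta) <= m.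
Proof.
move=> z1; split; first by rewrite Im_energy z1 expr1n invr1 subrr !mulr0.
rewrite /energy !cabsM cabsV cabs_mC// cabs2 -mulrA -[leRHS]mulr1 ler_pM2l//.
rewrite ler_pdivrMr// mul1r (le_trans (cabsD _ _))// cabsV z1 invr1; lra.
Qed.

(** With t = z/m, the two preimages of z are t - s and t + s for s^2 = t^2 - 1. Their product is 1,
    so one of them lies in the open disc unless both lie on the unit circle; the circle is excluded
    because its energies are real and of modulus at most m ([energy_unit]). *)
Lemma joukowski z : 0 < Im z \/ m < cabs z ->
  exists2 zeta, [/\ zeta != 0, cabs zeta < 1 & energy m zeta = z] &
    (0 < Im z -> Im zeta < 0) /\ (Im z = 0 -> Im zeta = 0).
Proof.
move=> Hz; have mC0 := mC_neq0 m0.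
pose t := z / mC; pose s := sqrtC (t ^+ 2 - 1).
have s2 : s ^+ 2 = t ^+ 2 - 1 by exact: sqrtCK.
have P : (t - s) * (t + s) = 1.
  have -> : (t - s) * (t + s) = t ^+ 2 - s ^+ 2 by ring.
  by rewrite s2; ring.
have E : forall a b : C, a * b = 1 -> a + b = 2 * t -> a != 0 /\ energy m a = z.
  move=> a b ab s'.
  have a0 : a != 0 by apply: contra_eq_neq ab => ->; rewrite mul0r eq_sym oner_eq0.
  split=> //; have aV : a^-1 = b by apply: (mulfI a0); rewrite divff.
  rewrite /energy aV s' /t; have := @two_neq0 R; by move=> ?; field.
have [a10 E1] := E _ _ P ltac:(ring).
have [a20 E2] : t + s != 0 /\ energy m (t + s) = z by apply: (E _ (t - s)); [rewrite mulrC|ring].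
have [zeta [z0 z1 zE]] : exists zeta, [/\ zeta != 0, cabs zeta < 1 & energy m zeta = z].
  have [c1|c1|c1] := ltgtP (cabs (t - s)) 1; first by exists (t - s).
  - exists (t + s); split=> //; have : cabs (t - s) * cabs (t + s) = 1 by rewrite -cabsM P cabs1.
    by have := cabs_ge0 (t + s); nra.
  - have [h1 h2] := energy_unit c1; rewrite E1 in h1 h2.
    by case: Hz; rewrite ?h1 ?ltxx// ltNge h2.
exists zeta => //; have cp : 0 < cabs zeta by rewrite cabs_gt0.
have q0 : 0 < cabs zeta ^- 2 - 1.
  by rewrite subr_gt0 invf_gt1 ?exprn_gt0// exprn_ilt1 ?cabs_ge0.
split; rewrite -zE Im_energy.
  rewrite pmulr_rgt0 ?divr_gt0// pmulr_lgt0// oppr_gt0//.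
move=> /eqP; rewrite !mulf_eq0 (gt_eqF q0) oppr_eq0 orbF (gt_eqF m0) invr_eq0 pnatr_eq0 /=.
by move=> /eqP.
Qed.

Lemma energy_sub z w : z != 0 -> w != 0 ->
  energy m z - energy m w = mC / 2 * (z - w) * (1 - (z * w)^-1).
Proof.
by move=> z0 w0; rewrite /energy; have := @two_neq0 R; move=> ?; field; rewrite z0 w0.
Qed.

(** In [energy_sub] the factor 1 - 1/(zw) has modulus at least 1 - |w|. The resulting Lipschitz
    constant of the inverse map blows up as [w] approaches the unit circle. *)
Lemma joukowski_lipschitz z w : z != 0 -> w != 0 -> cabs z < 1 -> cabs w < 1 ->
  cabs (z - w) * (1 - cabs w) <= 2 / m * cabs (energy m z - energy m w).
Proof.
move=> z0 w0 z1 w1; rewrite energy_sub// !cabsM cabsV cabs2 cabs_mC//.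
have -> : 2 / m * (m / 2 * cabs (z - w) * cabs (1 - (z * w)^-1)) =
   cabs (z - w) * cabs (1 - (z * w)^-1) by field; rewrite gt_eqF.
apply: ler_wpM2l; first exact: cabs_ge0.
have p : 0 < cabs (z * w) by rewrite cabs_gt0 mulf_neq0.
have -> : 1 - (z * w)^-1 = (z * w - 1) / (z * w) by rewrite mulrBl divff ?mulf_neq0// mul1r.
rewrite cabsM cabsV ler_pdivlMr//.
have := cabsD (z * w) (1 - z * w); rewrite addrC subrK cabs1 (cabs_distC 1) cabsM.
have := cabs_ge0 w; have := cabs_ge0 z; move: p; rewrite cabsM.
move: (cabs z) (cabs w) z1 w1 (cabs (z * w - 1)) => a b a1 b1 c p a0 b0 H.
have h1 : a * b <= b by nra.
have h2 : (1 - b) * (a * b) <= 1 - b by nra.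
lra.
Qed.

End Joukowski.

(** * Integral operators with a kernel split along the diagonal *)

Section SplitKernel.
Context {R : realType}.
Local Notation C := R[i].
Local Notation mu := (@lebesgue_measure R).
Implicit Types (E F : R -> R -> 'M[C]_2) (f g : R -> 'cV[C]_2) (k : R -> R) (x y : R).

Definition splitop E F f x : 'cV[C]_2 :=
  mint `]-oo, x] (fun y => E x y *m f y) + mint `[x, +oo[ (fun y => F x y *m f y).

(** Each half of the kernel is bounded only on the side of the diagonal where [splitop] uses it: for
    a Green kernel the exponential factor may grow on the other side. *)
Definition split_bound E F x k := [/\ mcont (E x), mcont (F x),
  forall y, y <= x -> mnorm (E x y) <= k y & forall y, x <= y -> mnorm (F x y) <= k y].

Let mL x : measurable (`]-oo, x]%classic : set (measurableTypeR R)).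
Proof. exact: measurable_itv. Qed.

Let mR x : measurable (`[x, +oo[%classic : set (measurableTypeR R)).
Proof. exact: measurable_itv. Qed.

Lemma splitop_integrable E F x k f : split_bound E F x k -> mmeas setT f ->
  mu.-integrable setT (EFin \o (fun y => k y * mnorm (f y))) ->
  mintegrable `]-oo, x] (fun y => E x y *m f y) /\
  mintegrable `[x, +oo[ (fun y => F x y *m f y).
Proof.
move=> [cE cF bE bF] mf ik.
have mS (D : set (measurableTypeR R)) : mmeas D f.
  by move=> i j; have [h1 h2] := mf i j; split; exact: measurable_funTS.
have iD (D : set (measurableTypeR R)) : measurable D ->
    mu.-integrable D (EFin \o (fun y => k y * mnorm (f y))).
  by move=> mD; exact: integrableS ik.
split.
  apply: (@dominated_mintegrable _ _ _ _ _ (fun y => k y * mnorm (f y))).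
  - exact: mL.
  - by apply: mmeasM; [apply: mcont_meas; [exact: mL|exact: cE]|exact: mS].
  - move=> y /=; rewrite in_itv /= => yx; apply: (le_trans (mnormM _ _)).
    by rewrite ler_wpM2r ?mnorm_ge0 ?bE.
  - exact: iD (mL x).
apply: (@dominated_mintegrable _ _ _ _ _ (fun y => k y * mnorm (f y))).
- exact: mR.
- by apply: mmeasM; [apply: mcont_meas; [exact: mR|exact: cF]|exact: mS].
- move=> y /=; rewrite in_itv /= andbT => yx; apply: (le_trans (mnormM _ _)).
  by rewrite ler_wpM2r ?mnorm_ge0 ?bF.
- exact: iD (mR x).
Qed.

Lemma splitop_le E F x k f : split_bound E F x k -> mmeas setT f ->
  mu.-integrable setT (EFin \o (fun y => k y * mnorm (f y))) ->
  mnorm (splitop E F f x) <= \int[mu]_y (k y * mnorm (f y)).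
Proof.
move=> b mf ik; have [i1 i2] := splitop_integrable b mf ik.
have [cE cF bE bF] := b.
have iD (D : set (measurableTypeR R)) : measurable D ->
    mu.-integrable D (EFin \o (fun y => k y * mnorm (f y))).
  by move=> mD; exact: integrableS ik.
apply: (le_trans (mnormD _ _)).
have -> : \int[mu]_y (k y * mnorm (f y)) = \int[mu]_(y in `]-oo, x]) (k y * mnorm (f y)) +
    \int[mu]_(y in `[x, +oo[) (k y * mnorm (f y)).
  have E1 := @Rintegral_itvB R (fun y => k y * mnorm (f y)) -oo%O +oo%O x.
  rewrite -(@Rintegral_itv_obnd_cbnd _ x); last by apply: iD; exact: measurable_itv.
  rewrite -E1 ?set_itvNyy//; first by rewrite addrCA subrr addr0.
apply: lerD.
  apply: (le_trans (mnorm_mint_le (mL x) i1)).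
  apply: le_Rintegral.
  - exact: mL.
  - exact: mintegrable_mnorm (mL x) i1.
  - exact: iD (mL x).
  - move=> y /=; rewrite in_itv /= => yx; apply: (le_trans (mnormM _ _)).
    by rewrite ler_wpM2r ?mnorm_ge0 ?bE.
apply: (le_trans (mnorm_mint_le (mR x) i2)).
apply: le_Rintegral.
- exact: mR.
- exact: mintegrable_mnorm (mR x) i2.
- exact: iD (mR x).
- move=> y /=; rewrite in_itv /= andbT => yx; apply: (le_trans (mnormM _ _)).
  by rewrite ler_wpM2r ?mnorm_ge0 ?bF.
Qed.

Lemma splitop_sub E F E' F' x k k' f : split_bound E F x k -> split_bound E' F' x k' ->
  mmeas setT f ->
  mu.-integrable setT (EFin \o (fun y => k y * mnorm (f y))) ->
  mu.-integrable setT (EFin \o (fun y => k' y * mnorm (f y))) ->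
  splitop E F f x - splitop E' F' f x =
  splitop (fun x y => E x y - E' x y) (fun x y => F x y - F' x y) f x.
Proof.
move=> b b' mf ik ik'.
have [i1 i2] := splitop_integrable b mf ik; have [i1' i2'] := splitop_integrable b' mf ik'.
rewrite /splitop; under [X in _ = X + _]eq_mint do rewrite mulmxBl.
under [X in _ = _ + X]eq_mint do rewrite mulmxBl.
rewrite (mintB (mL x) i1 i1') (mintB (mR x) i2 i2').
by rewrite opprD addrACA.
Qed.

Lemma splitop_linear E F x k (z : C) f g : split_bound E F x k ->
  mmeas setT f -> mmeas setT g ->
  mu.-integrable setT (EFin \o (fun y => k y * mnorm (f y))) ->
  mu.-integrable setT (EFin \o (fun y => k y * mnorm (g y))) ->
  splitop E F (fun y => z *: f y + g y) x = z *: splitop E F f x + splitop E F g x.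
Proof.
move=> b mf mg ik ik'.
have [i1 i2] := splitop_integrable b mf ik; have [i1' i2'] := splitop_integrable b mg ik'.
have L (D : set (measurableTypeR R)) (P : R -> 'M[C]_2) : measurable D ->
    mintegrable D (fun y => P y *m f y) -> mintegrable D (fun y => P y *m g y) ->
    mint D (fun y => P y *m (z *: f y + g y)) = z *: mint D (fun y => P y *m f y) + mint D (fun y => P y *m g y).
  move=> mD j1 j2; rewrite -mul_scalar_mx -mint_mulmx// -mintD//; last exact: mintegrable_mulmx.
  by apply: eq_mint => y _; rewrite mulmxDr mul_scalar_mx scalemxAr.
by rewrite /splitop !L//; rewrite scalerDr addrACA.
Qed.

End SplitKernel.

(** * The Green kernel *)

Section Green.
Context {R : realType}.
Local Notation C := R[i].
Local Notation Re := complex.Re.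
Local Notation Im := complex.Im.
Local Notation mu := (@lebesgue_measure R).
Variables (m theta : R) (q : R -> R) (qb : R).
Hypotheses (m0 : 0 < m) (theta0 : 0 < theta) (theta1 : theta <= 1).
Hypotheses (cq : continuous q) (q0 : forall x, 0 <= q x) (qN : forall x, q (- x) = q x)
  (qle : forall x, q x <= qb) (iq : mu.-integrable setT (EFin \o q)).
Implicit Types (zeta : C) (g h f : R -> 'cV[C]_2) (x y : R).
Local Notation admissible := (admissible theta q).
Local Notation jost := (jost m q).
Local Notation wave := (wave m).
Local Notation lwave := (lwave m).
Local Notation wronskian := (wronskian m).
Local Notation J := (jostC m q).

(** Cramer's rule: for F equal to one of the two waves these are, up to sign, the rows of the
    inverse fundamental matrix multiplied by - i alpha, the coefficient of the source in variation
    of constants. Swapping the entries is what [beta] does here, and no conjugation occurs. *)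
Definition dual zeta g h (F : R -> 'cV[C]_2) y : 'rV[C]_2 :=
  (ci / wronskian zeta g h y) *: (beta *m F y)^T.

Definition lkernel zeta g h x y : 'M[C]_2 := wave zeta g x *m dual zeta g h (lwave zeta h) y.
Definition rkernel zeta g h x y : 'M[C]_2 := lwave zeta h x *m dual zeta g h (wave zeta g) y.
Definition green zeta g h f := splitop (lkernel zeta g h) (rkernel zeta g h) f.

Lemma outer_scale p (a b c : C) (v : 'cV[C]_p) (w : 'cV[C]_p) :
  (a *: v) *m (b *: (c *: w)^T) = (b * (a * c)) *: (v *m w^T).
Proof.
by apply/matrixP => i j; rewrite !mxE !big_ord1 !mxE; ring.
Qed.

Lemma lkernelE zeta g h x y : lkernel zeta g h x y =
  (ci * cexp (momentum m zeta) (x - y) / wronskian zeta g h y) *: (g x *m (h (- y))^T).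
Proof.
rewrite /lkernel /dual /lwave mulmxA beta_sqr mul1mx outer_scale cexpD.
by congr (_ *: _); ring.
Qed.

Lemma rkernelE zeta g h x y : rkernel zeta g h x y =
  (ci * cexp (momentum m zeta) (y - x) / wronskian zeta g h y) *:
    ((beta *m h (- x)) *m (beta *m g y)^T).
Proof.
rewrite /rkernel /dual /lwave /wave -(scalemxAr _ beta (h _)) -(scalemxAr _ beta (g y)) outer_scale addrC cexpD.
by congr (_ *: _); ring.
Qed.

Lemma mnorm_tr p r (A : 'M[C]_(p, r)) : mnorm A^T = mnorm A.
Proof. by rewrite /mnorm exchange_big; apply: eq_bigr => i _; apply: eq_bigr => j _; rewrite mxE. Qed.

(** This jump across the diagonal is the whole inhomogeneous term: applying i alpha to it gives the
    identity, so the operator [green] inverts H - z. *)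
Lemma kernel_jump zeta g h x : wronskian zeta g h x != 0 ->
  lkernel zeta g h x x - rkernel zeta g h x x = - (ci *: alpha).
Proof.
rewrite /lkernel /rkernel /dual /wronskian.
move: (wave zeta g x) (lwave zeta h x) => p r; rewrite /det2 => W0.
have := betaM p; have := betaM r; move: (beta *m p) (beta *m r) => bp br Hr Hp.
apply/matrixP => i j; rewrite alphaE !mxE !big_ord1 !mxE Hp Hr.
case: (I2P i) => ->; case: (I2P j) => -> /=; field; exact: W0.
Qed.

Lemma split_derivative (D : 'M[C]_2) (w l : 'cV[C]_2) (a b : 'rV[C]_2) (P Q : 'M[C]_1)
    (f : 'cV[C]_2) :
  (D *m w *m P + w *m (a *m f)) + ((- (D *m l)) *m Q + (- l) *m (b *m f)) =
  D *m (w *m P + (- l) *m Q) + (w *m a - l *m b) *m f.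
Proof.
rewrite addrACA; congr (_ + _); first by rewrite mulmxDr !mulNmx mulmxN !mulmxA.
by rewrite mulmxBl mulNmx !mulmxA.
Qed.

Lemma continuous_inv_sqr (F : R -> R) : continuous F -> (forall x, F x != 0) ->
  continuous (fun x => (F x ^+ 2)^-1).
Proof.
move=> cF F0 x; apply: cvgV; first by rewrite expf_neq0.
by rewrite expr2; apply: cvgM; exact: cF.
Qed.

Section Fixed.
Variables (V : R -> 'M[C]_2) (zeta : C) (g h : R -> 'cV[C]_2) (c : R).
Hypotheses (aV : admissible V) (hz : half_disc zeta) (sg : jost V zeta g)
  (sh : jost (reflect V) zeta h) (c0 : 0 < c)
  (cW : c <= cabs (det2 (g 0) (beta *m h 0))).
Local Notation E := (lkernel zeta g h).
Local Notation F := (rkernel zeta g h).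

Let W_ge y : c <= cabs (wronskian zeta g h y).
Proof. by rewrite (cabs_wronskian _ aV hz sg sh). Qed.

Let W_neq0 y : wronskian zeta g h y != 0.
Proof. by rewrite -cabs_gt0 (lt_le_trans c0). Qed.

Let cwave : mcont (wave zeta g).
Proof. exact: mder_cont (wave_mder hz sg). Qed.

Let clwave : mcont (lwave zeta h).
Proof. exact: mder_cont (lwave_mder hz sh). Qed.

Lemma cont_dual (P : R -> 'cV[C]_2) : mcont P -> mcont (dual zeta g h P).
Proof.
move=> cP; apply: mcontZ; last first.
  move=> i j; have := mcontM (mcont_cst beta) cP j i.
  by congr ccont; apply/funext => y; rewrite [RHS]mxE.
have cW' : ccont (wronskian zeta g h).
  exact: cder_cont (wronskian_cder aV hz sg sh).
(* Writing 1/W as conj W / |W|^2 reduces continuity to that of a real reciprocal. *)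
have -> : (fun y => ci / wronskian zeta g h y) =
    fun y => ci * (((cabs (wronskian zeta g h y) ^- 2)%:C)%C * conjc (wronskian zeta g h y)).
  by apply/funext => y; rewrite cinvE.
apply: ccontM; first exact: ccont_cst.
apply: ccontM.
  apply: ccont_real; apply: continuous_inv_sqr; first exact: ccont_cabs.
  by move=> y; rewrite cabs_eq0.
have [c1 c2] := cW'; split.
  by rewrite (_ : (fun y => _) = fun y => Re (wronskian zeta g h y))//; apply/funext => y; case: (wronskian _ _ _ _).
rewrite (_ : (fun y => _) = fun y => - Im (wronskian zeta g h y)); first by move=> y; apply: cvgN; exact: c2.
by apply/funext => y; case: (wronskian _ _ _ _).
Qed.

Lemma cont_lkernel x : mcont (E x).
Proof. by apply: mcontM; [exact: mcont_cst|exact: cont_dual]. Qed.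

Lemma cont_rkernel x : mcont (F x).
Proof. by apply: mcontM; [exact: mcont_cst|exact: cont_dual]. Qed.

Lemma mnorm_lkernel x y : y <= x -> mnorm (E x y) <=
  c^-1 * expR (- Im (momentum m zeta) * (x - y)) * (mnorm (g x) * mnorm (h (- y))).
Proof.
move=> yx; rewrite lkernelE mnormZ !cabsM cabsi mul1r cabsV cabs_cexp.
rewrite [_ * (cabs _)^-1]mulrC; apply: ler_pM => //.
- by rewrite mulr_ge0 ?expR_ge0// invr_ge0 cabs_ge0.
- exact: mnorm_ge0.
- by rewrite ler_wpM2r ?expR_ge0// lef_pV2 ?posrE// (lt_le_trans c0).
- by apply: (le_trans (mnormM _ _)); rewrite mnorm_tr.
Qed.

Lemma mnorm_rkernel x y : x <= y -> mnorm (F x y) <=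
  c^-1 * expR (- Im (momentum m zeta) * (y - x)) * (mnorm (h (- x)) * mnorm (g y)).
Proof.
move=> yx; rewrite rkernelE mnormZ !cabsM cabsi mul1r cabsV cabs_cexp.
rewrite [_ * (cabs _)^-1]mulrC; apply: ler_pM => //.
- by rewrite mulr_ge0 ?expR_ge0// invr_ge0 cabs_ge0.
- exact: mnorm_ge0.
- by rewrite ler_wpM2r ?expR_ge0// lef_pV2 ?posrE// (lt_le_trans c0).
- by apply: (le_trans (mnormM _ _)); rewrite mnorm_tr !mnorm_beta.
Qed.

Lemma green_mprimitive f :
  (forall x, mintegrable `]-oo, x] (fun y => dual zeta g h (lwave zeta h) y *m f y)) ->
  (forall x, mintegrable `[x, +oo[ (fun y => dual zeta g h (wave zeta g) y *m f y)) ->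
  mprimitive (green zeta g h f)
    (fun x => dmx m V (energy m zeta) x *m green zeta g h f x - ci *: (alpha *m f x)).
Proof.
move=> i1 i2.
have mL x : measurable (`]-oo, x]%classic : set (measurableTypeR R)) by exact: measurable_itv.
have mR x : measurable (`[x, +oo[%classic : set (measurableTypeR R)) by exact: measurable_itv.
pose P x := mint `]-oo, x] (fun y => dual zeta g h (lwave zeta h) y *m f y).
(* The tail integral has the opposite sign to a primitive; the sign is carried by [Q] and
   compensated by the minus in front of [lwave]. *)
pose Q x := - mint `[x, +oo[ (fun y => dual zeta g h (wave zeta g) y *m f y).
have GE x : green zeta g h f x = wave zeta g x *m P x + (- lwave zeta h x) *m Q x.
  rewrite /P /Q mulNmx mulmxN opprK -!mint_mulmx//.
  by rewrite /green /splitop; congr (_ + _); apply: eq_mint => y _; rewrite mulmxA.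
have d1 := wave_mder hz sg; have d2 := lwave_mder hz sh.
have [_ cV _] := aV.
have cM (p : R -> 'cV[C]_2) : mcont p -> mcont (fun x => dmx m V (energy m zeta) x *m p x).
  by move=> cp; apply: mcontM => //; exact: mcont_dmx.
have p1 := mprimitiveM (cM _ cwave) d1 (mprimitive_left i1).
have cN : mcont (fun x => - (dmx m V (energy m zeta) x *m lwave zeta h x)).
  have := mcontB (mcont_cst 0) (cM _ clwave).
  by under eq_fun do rewrite sub0r.
have p2 := mprimitiveM cN (mderN d2) (mprimitive_right i2).
have := mprimitiveD p1 p2.
rewrite -/P -/Q; congr mprimitive; apply/funext => x; first by rewrite GE.
rewrite split_derivative GE; congr (_ + _).
have := kernel_jump (W_neq0 x); rewrite /lkernel /rkernel => ->.
by rewrite mulNmx -scalemxAl.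
Qed.

End Fixed.

End Green.

(** * Weighted bounds and Hoelder continuity of the Green kernel *)

Section GreenEstimates.
Context {R : realType}.
Local Notation C := R[i].
Local Notation Re := complex.Re.
Local Notation Im := complex.Im.
Local Notation mu := (@lebesgue_measure R).
Variables (m theta : R) (q : R -> R) (qb : R).
Hypotheses (m0 : 0 < m) (theta0 : 0 < theta) (theta1 : theta <= 1).
Hypotheses (cq : continuous q) (q0 : forall x, 0 <= q x) (qN : forall x, q (- x) = q x)
  (qle : forall x, q x <= qb) (iq : mu.-integrable setT (EFin \o q)).
Implicit Types (z w zeta : C) (g h f : R -> 'cV[C]_2) (x y : R).
Local Notation admissible := (admissible theta q).
Local Notation jost := (jost m q).
Local Notation wronskian := (wronskian m).
Local Notation J := (jostC m q).
Local Notation rho := (2^-1 + theta).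

Definition bprod x y : R := bweight x * bweight y.

Lemma bprod_ge1 x y : 1 <= bprod x y.
Proof. by rewrite /bprod; have := bweight_ge1 x; have := bweight_ge1 y; nra. Qed.

Lemma bprod_gt0 x y : 0 < bprod x y.
Proof. exact: lt_le_trans ltr01 (bprod_ge1 x y). Qed.

Lemma bprodC x y : bprod x y = bprod y x.
Proof. by rewrite /bprod mulrC. Qed.

(** The origin of the exponent 1/2. For y <= 0 <= x both one-sided weights are 1; when [x] and [y]
    have the same sign only the one nearer to 0 grows, and it is bounded by the geometric mean of
    the two. *)
Lemma lweight_prod x y : y <= x -> lweight x * lweight (- y) <= bprod x y `^ 2^-1.
Proof.
move=> yx; rewrite powR12_sqrt ?(ltW (bprod_gt0 _ _))//.
have l0 : 0 <= lweight x * lweight (- y) by rewrite mulr_ge0 ?(ltW (lweight_gt0 _)).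
rewrite -(ger0_norm l0) -sqrtr_sqr ler_wsqrtr//.
rewrite /bprod /bweight /lweight opprK.
have [x0|x0] := leP 0 x.
  rewrite (max_r _); last by rewrite oppr_le0.
  rewrite addr0 mul1r (ger0_norm x0).
  have [y0|y0] := leP 0 y; first by rewrite ger0_norm//; nra.
  by rewrite ltr0_norm//; nra.
have y0 : y < 0 by exact: le_lt_trans x0.
rewrite (max_l _); last by rewrite oppr_ge0 ltW.
by rewrite (max_r (ltW y0)) !ltr0_norm//; nra.
Qed.

Lemma bprod_rho x y (a : R) : a <= rho -> bprod x y `^ a <= bprod x y `^ rho.
Proof. by move=> ar; rewrite ler_powR// bprod_ge1. Qed.

(** Only the growth of the Jost solutions counts, since the exponential has modulus at most 1 on the
    relevant side. The exponent is rounded up from 1/2 to 1/2 + theta so that the same weights serve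
    for differences of kernels. *)
Lemma green_bound V zeta g h (c : R) x : admissible V -> half_disc zeta -> jost V zeta g ->
  jost (reflect V) zeta h -> 0 < c -> c <= cabs (det2 (g 0) (beta *m h 0)) ->
  split_bound (lkernel m zeta g h) (rkernel m zeta g h) x
    (fun y => c^-1 * J ^+ 2 * bprod x y `^ rho).
Proof.
move=> aV hz sg sh c0 cW; have J0 := jostC_gt0 m q.
have k0 := Im_momentum_ge0 m0 hz.
have [_ gb _] := sg; have [_ hb _] := sh.
have core t a b (A B : R) : 0 <= t -> b <= a -> 0 <= A -> A <= J * lweight a ->
    0 <= B -> B <= J * lweight (- b) ->
    c^-1 * expR (- Im (momentum m zeta) * t) * (A * B) <= c^-1 * J ^+ 2 * bprod a b `^ rho.
  move=> t0 ba A0 AJ B0 BJ; rewrite -!(mulrA c^-1) ler_pM2l ?invr_gt0//.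
  apply: (@le_trans _ _ (A * B)).
    by rewrite ler_piMl ?mulr_ge0// -expR0 ler_expR mulNr oppr_le0 mulr_ge0.
  apply: (@le_trans _ _ ((J * lweight a) * (J * lweight (- b)))); first exact: ler_pM.
  have -> : J * lweight a * (J * lweight (- b)) = J ^+ 2 * (lweight a * lweight (- b)) by ring.
  rewrite ler_pM2l ?exprn_gt0// (le_trans (lweight_prod ba))// bprod_rho//.
  by rewrite lerDl ltW.
split.
- exact: (cont_lkernel aV hz sg sh c0 cW).
- exact: (cont_rkernel aV hz sg sh c0 cW).
- move=> y yx; apply: (le_trans (mnorm_lkernel aV hz sg sh c0 cW yx)).
  by apply: core; rewrite ?mnorm_ge0 ?subr_ge0.
- move=> y xy; apply: (le_trans (mnorm_rkernel aV hz sg sh c0 cW xy)).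
  rewrite [mnorm (h _) * _]mulrC bprodC.
  by apply: core; rewrite ?mnorm_ge0 ?subr_ge0.
Qed.

Lemma outer_diff (s s' : C) (v v' w w' : 'cV[C]_2) :
  mnorm (s *: (v *m w^T) - s' *: (v' *m w'^T)) <=
  cabs (s - s') * (mnorm v * mnorm w) +
  cabs s' * (mnorm (v - v') * mnorm w + mnorm v' * mnorm (w - w')).
Proof.
have -> : s *: (v *m w^T) - s' *: (v' *m w'^T) =
    (s - s') *: (v *m w^T) + s' *: ((v - v') *m w^T + v' *m (w - w')^T).
  by apply/matrixP => i j; rewrite !mxE !big_ord1 !mxE; ring.
apply: (le_trans (mnormD _ _)); rewrite !mnormZ; apply: lerD; rewrite ler_wpM2l ?cabs_ge0//.
  by apply: (le_trans (mnormM _ _)); rewrite mnorm_tr.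
by apply: (le_trans (mnormD _ _)); apply: lerD; apply: (le_trans (mnormM _ _)); rewrite mnorm_tr.
Qed.

Lemma tr_outer (s : C) (v w : 'cV[C]_2) : (s *: (v *m w^T))^T = s *: (w *m v^T).
Proof. by rewrite linearZ /= trmx_mul trmxK. Qed.

Lemma mnorm_outerC (s s' : C) (v v' w w' : 'cV[C]_2) :
  mnorm (s *: (v *m w^T) - s' *: (v' *m w'^T)) = mnorm (s *: (w *m v^T) - s' *: (w' *m v'^T)).
Proof.
rewrite -[LHS]mnorm_tr; apply: f_equal.
rewrite -(tr_outer s v w) -(tr_outer s' v' w').
by rewrite [LHS]raddfB.
Qed.

Lemma cexp_holder (k k' : C) (t d : R) : 0 <= Im k -> 0 <= Im k' -> 0 <= t ->
  cabs (k - k') <= d -> cabs (cexp k t - cexp k' t) <= 2 * d `^ theta * t `^ theta.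
Proof.
move=> k0 k0' t0 kd; have d0 : 0 <= d by exact: le_trans (cabs_ge0 _) kd.
rewrite -mulrA -powRM//.
have h1 : cabs (cexp k t - cexp k' t) <= d * t.
  by apply: (le_trans (cexp_lipschitz k0 k0' t0)); rewrite ler_wpM2r.
have h2 : cabs (cexp k t - cexp k' t) <= 2.
  apply: (le_trans (cabsB _ _)).
  by have := cabs_cexp_le1 k0 t0; have := cabs_cexp_le1 k0' t0; lra.
have [s1|s1] := leP (d * t) 1.
  apply: (le_trans h1); have s0 : 0 <= d * t by rewrite mulr_ge0.
  move: s0; rewrite le_eqVlt => /predU1P[<-|s0]; first by rewrite mulr_ge0 ?powR_ge0.
  have : d * t <= (d * t) `^ theta by rewrite ger1_powR// s0 s1.
  by have := powR_ge0 (d * t) theta; lra.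
apply: (le_trans h2); rewrite ler_peMr//.
by rewrite -[leLHS](powRr0 (d * t)) ler_powR// ltW.
Qed.

(** The kernel varies through its phase, its Wronskian and its two Jost factors, which give the
    three parts of the constant. The phase costs |x - y|^theta on top of the exponent 1/2; the Jost
    factors cost the exponent (1 + theta)/2; both fit under 1/2 + theta. *)
Lemma green_holder V (r c : R) : admissible V -> 0 < r -> 0 < c -> exists2 K, 0 <= K &
  forall z w g h g' h' x, half_disc z -> half_disc w -> r <= cabs z -> r <= cabs w ->
  jost V z g -> jost (reflect V) z h -> jost V w g' -> jost (reflect V) w h' ->
  c <= cabs (det2 (g 0) (beta *m h 0)) -> c <= cabs (det2 (g' 0) (beta *m h' 0)) ->
  split_bound (fun x y => lkernel m z g h x y - lkernel m w g' h' x y)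
    (fun x y => rkernel m z g h x y - rkernel m w g' h' x y) x
    (fun y => K * cabs (z - w) `^ theta * bprod x y `^ rho).
Proof.
move=> aV r0 c0; have aV' := admissible_reflect qN aV.
have J0 := jostC_gt0 m q.
have [_ cV1 _] := aV; have [_ cV2 _] := aV'.
have Vq U : admissible U -> forall y, mnorm (potmx U y) * (bweight y `^ (1 + theta)) ^+ 2 <= q y.
  by move=> [_ _ Uq] y; rewrite mnorm_potmx.
have [K1 K10 H1] := jost_holder m0 theta0 theta1 cq q0 iq (mcont_potmx cV1) (Vq _ aV) r0.
have [K2 K20 H2] := jost_holder m0 theta0 theta1 cq q0 iq (mcont_potmx cV2) (Vq _ aV') r0.
have [Kw Kw0 Hw] := wronskian_holder m0 theta0 theta1 cq q0 qN iq aV r0.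
pose kap := m * (1 + r ^- 2).
pose K := (c^-1 * (2 * kap `^ theta) + c ^- 2 * Kw) * J ^+ 2 + c^-1 * ((K1 + K2) * J).
have kap0 : 0 <= kap by rewrite mulr_ge0 ?addr_ge0 ?invr_ge0 ?exprn_ge0// ltW.
have ci0 : 0 < c^-1 by rewrite invr_gt0.
have ci20 : 0 <= c ^- 2 by rewrite invr_ge0 exprn_ge0// ltW.
exists K; first by rewrite addr_ge0 ?mulr_ge0 ?addr_ge0 ?mulr_ge0 ?powR_ge0 ?exprn_ge0 ?(ltW ci0) ?(ltW J0).
move=> z w g h g' h' x hz hw rz rw sg sh sg' sh' cW cW'.
have kz := Im_momentum_ge0 m0 hz; have kw := Im_momentum_ge0 m0 hw.
have kd := momentum_lipschitz m0 r0 rz rw; rewrite -/kap in kd.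
set d := cabs (z - w) in kd *; have d0 : 0 <= d by exact: cabs_ge0.
have [_ gb _] := sg; have [_ hb _] := sh; have [_ gb' _] := sg'; have [_ hb' _] := sh'.
have H1' := H1 _ _ _ _ hz hw rz rw sg sg'.
have H2' := H2 _ _ _ _ hz hw rz rw sh sh'.
have HW := Hw _ _ _ _ _ _ hz hw rz rw sg sh sg' sh'.
rewrite -/d in H1' H2' HW.
have wge y : c <= cabs (wronskian z g h y) by rewrite (cabs_wronskian _ aV hz sg sh).
have wge' y : c <= cabs (wronskian w g' h' y) by rewrite (cabs_wronskian _ aV hw sg' sh').
set D := d `^ theta in H1' H2' HW *; have D0 : 0 <= D by exact: powR_ge0.
(* Stated for arbitrary vectors, with [a] the right and [b] the left of the two points, so as to
   serve both halves of the kernel. *)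
have core a b y (v v' p p' : 'cV[C]_2) (K' K'' : R) : b <= a -> K' + K'' = K1 + K2 -> 0 <= K' -> 0 <= K'' ->
    mnorm v <= J * lweight a -> mnorm v' <= J * lweight a ->
    mnorm (v - v') <= K' * D * lweight a `^ (1 + theta) ->
    mnorm p <= J * lweight (- b) -> mnorm p' <= J * lweight (- b) ->
    mnorm (p - p') <= K'' * D * lweight (- b) `^ (1 + theta) ->
    mnorm ((ci * cexp (momentum m z) (a - b) / wronskian z g h y) *: (v *m p^T) -
      (ci * cexp (momentum m w) (a - b) / wronskian w g' h' y) *: (v' *m p'^T)) <=
      K * D * bprod a b `^ rho.
  move=> ba KE K'0 K''0 v1 v'1 vd p1 p'1 pd.
  have ab0 : 0 <= a - b by rewrite subr_ge0.
  set W := wronskian z g h y; set W' := wronskian w g' h' y.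
  set e := cexp (momentum m z) (a - b); set e' := cexp (momentum m w) (a - b).
  set B := bprod a b `^ rho; have B0 : 0 <= B by exact: powR_ge0.
  have Bt : (a - b) `^ theta * bprod a b `^ 2^-1 <= B.
    rewrite /B [2^-1 + theta]addrC powRD; last by rewrite (gt_eqF (bprod_gt0 _ _)) implybT.
    rewrite ler_wpM2r ?powR_ge0// ge0_ler_powR ?nnegrE ?(ltW theta0) ?(ltW (bprod_gt0 _ _))//.
    have := ler_normB a b; rewrite (ger0_norm ab0) /bprod /bweight.
    by have := normr_ge0 a; have := normr_ge0 b; nra.
  set L := lweight a * lweight (- b).
  have LB : L <= bprod a b `^ 2^-1 by exact: lweight_prod.
  have LB1 : L <= B by apply: (le_trans LB); apply: bprod_rho; rewrite lerDl ltW.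
  have la := lweight_ge1 a; have lb := lweight_ge1 (- b).
  have LB2 : lweight a `^ (1 + theta) * lweight (- b) `^ (1 + theta) <= B.
    rewrite -powRM ?(ltW (lweight_gt0 _))// -/L.
    have L0 : 0 <= L by rewrite mulr_ge0 ?(ltW (lweight_gt0 _)).
    have th0 : 0 <= 1 + theta by rewrite addr_ge0 ?(ltW theta0).
    apply: (@le_trans _ _ ((bprod a b `^ 2^-1) `^ (1 + theta))).
      by rewrite ge0_ler_powR ?nnegrE ?powR_ge0.
    by rewrite -powRrM; apply: bprod_rho; have := theta0; lra.
  have lp u : lweight u <= lweight u `^ (1 + theta).
    rewrite -[leLHS](powRr1 (ltW (lweight_gt0 u))) ler_powR ?lweight_ge1// lerDl ltW//.
  have S' : cabs (ci * e' / W') <= c^-1.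
    rewrite !cabsM cabsi mul1r cabsV -[leRHS]mul1r ler_pM ?invr_ge0 ?cabs_ge0//.
      exact: cabs_cexp_le1.
    by rewrite lef_pV2 ?posrE ?wge' ?(lt_le_trans c0 (wge' _)).
  have ed : cabs (e - e') <= 2 * (kap `^ theta * D) * (a - b) `^ theta.
    by rewrite -powRM//; apply: cexp_holder.
  have Wd : cabs (W^-1 - W'^-1) <= c ^- 2 * (Kw * D).
    apply: (le_trans (cabs_inv_sub c0 (wge y) (wge' y))); rewrite ler_wpM2l//.
    by rewrite (cabs_wronskian_sub _ aV hz hw sg sh sg' sh').
  have Sd : cabs (ci * e / W - ci * e' / W') <=
      c^-1 * (2 * (kap `^ theta * D) * (a - b) `^ theta) + c ^- 2 * (Kw * D).
    have -> : ci * e / W - ci * e' / W' = ci * ((e - e') / W + e' * (W^-1 - W'^-1)) by ring.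
    rewrite cabsM cabsi mul1r; apply: (le_trans (cabsD _ _)); apply: lerD; rewrite cabsM.
      rewrite mulrC ler_pM ?cabs_ge0// cabsV ?invr_ge0 ?cabs_ge0//.
      by rewrite lef_pV2 ?posrE ?wge ?(lt_le_trans c0 (wge _)).
    by apply: le_trans Wd; rewrite ler_piMl ?cabs_ge0//; exact: cabs_cexp_le1.
  apply: (le_trans (outer_diff _ _ _ _ _ _)).
  have vp : mnorm v * mnorm p <= J ^+ 2 * L.
    rewrite (_ : J ^+ 2 * L = J * lweight a * (J * lweight (- b))); last by rewrite /L; ring.
    by rewrite ler_pM ?mnorm_ge0.
  have T1 : cabs (ci * e / W - ci * e' / W') * (mnorm v * mnorm p) <=
      (c^-1 * (2 * kap `^ theta) + c ^- 2 * Kw) * J ^+ 2 * D * B.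
    apply: (@le_trans _ _ ((c^-1 * (2 * (kap `^ theta * D) * (a - b) `^ theta) + c ^- 2 * (Kw * D)) * (J ^+ 2 * L))).
      by rewrite ler_pM ?cabs_ge0 ?mulr_ge0 ?mnorm_ge0.
    have : (a - b) `^ theta * L <= B.
      by apply: le_trans Bt; rewrite ler_wpM2l ?powR_ge0.
    move=> hB; set X := (a - b) `^ theta in hB *.
    have q1 : 0 <= c^-1 * (2 * kap `^ theta) * J ^+ 2 * D.
      by rewrite !mulr_ge0 ?powR_ge0 ?exprn_ge0 ?(ltW ci0) ?(ltW J0).
    have q2 : 0 <= c ^- 2 * Kw * J ^+ 2 * D.
      by rewrite !mulr_ge0 ?powR_ge0 ?exprn_ge0 ?(ltW J0).
    have := ler_wpM2l q1 hB; have := ler_wpM2l q2 LB1.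
    set kt := kap `^ theta; set ci' := c^-1; set cc := c ^- 2; set J2 := J ^+ 2; lra.
  have T2 : cabs (ci * e' / W') * (mnorm (v - v') * mnorm p + mnorm v' * mnorm (p - p')) <=
      c^-1 * ((K1 + K2) * J) * D * B.
    apply: (@le_trans _ _ (c^-1 * (K' * D * lweight a `^ (1 + theta) * (J * lweight (- b) `^ (1 + theta)) +
       J * lweight a `^ (1 + theta) * (K'' * D * lweight (- b) `^ (1 + theta))))).
      apply: ler_pM; rewrite ?cabs_ge0 ?addr_ge0 ?mulr_ge0 ?mnorm_ge0//.
      have u1 := le_trans p1 (ler_wpM2l (ltW J0) (lp (- b))).
      have u2 := le_trans v'1 (ler_wpM2l (ltW J0) (lp a)).
      by apply: lerD; apply: ler_pM; rewrite ?mnorm_ge0.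
    have qq : 0 <= c^-1 * ((K1 + K2) * J) * D.
      by rewrite !mulr_ge0 ?addr_ge0 ?(ltW ci0) ?(ltW J0).
    apply: le_trans (ler_wpM2l qq LB2); rewrite -KE; apply: eq_ler; ring.
  apply: (le_trans (lerD T1 T2)); rewrite /K; apply: eq_ler; ring.
split.
- apply: mcontB; first exact: (cont_lkernel aV hz sg sh c0 cW).
  exact: (cont_lkernel aV hw sg' sh' c0 cW').
- apply: mcontB; first exact: (cont_rkernel aV hz sg sh c0 cW).
  exact: (cont_rkernel aV hw sg' sh' c0 cW').
- by move=> y yx; rewrite !lkernelE; apply: (core _ _ y _ _ _ _ K1 K2).
- move=> y xy; rewrite !rkernelE bprodC.
  (* Transposing the rank-one matrix exchanges its two factors, which turns the upper half of the
     kernel into the lower one with [x] and [y] interchanged. *)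
  rewrite mnorm_outerC; apply: (core _ _ y _ _ _ _ K1 K2) => //; rewrite ?mnorm_beta//;
    by rewrite -mulmxBr mnorm_beta.
Qed.

End GreenEstimates.

(** * Operator norms of weighted kernels *)

Section OperatorBounds.
Context {R : realType}.
Local Notation C := R[i].
Local Notation mu := (@lebesgue_measure R).
Implicit Types (f g phi : R -> 'cV[C]_2) (x y : R) (B : @operator R).

Lemma spinor_normZ (a : C) (v : 'cV[C]_2) : spinor_norm (a *: v) = cabs a * spinor_norm v.
Proof.
rewrite !spinor_normE !mxE !cabsM !exprMn -mulrDr sqrtrM ?sqr_ge0//.
by rewrite sqrtr_sqr ger0_norm ?cabs_ge0.
Qed.

Lemma measurable_mnorm f : spinor_measurable f -> measurable_fun setT (fun x => mnorm (f x)).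
Proof. by move=> /spinor_measurableE mf; apply: mmeas_mnorm. Qed.

Lemma mnorm_sqr_integrable f : L2 f ->
  mu.-integrable setT (EFin \o (fun x => mnorm (f x) ^+ 2)) /\
  (\int[mu]_x (mnorm (f x) ^+ 2)%:E <= 4%:E * sqint f)%E.
Proof.
move=> lf; have [mf _] := lf; have mn := measurable_mnorm mf.
have H x : mnorm (f x) ^+ 2 <= 4 * spinor_norm (f x) ^+ 2.
  have -> : 4 * spinor_norm (f x) ^+ 2 = (2 * spinor_norm (f x)) ^+ 2 by ring.
  by rewrite ler_sqr ?nnegrE ?mnorm_ge0 ?mulr_ge0 ?spinor_norm_ge0 ?mnorm_le_spinor.
have i4 := integrableZl measurableT 4 (L2_integrable lf).
split.
  apply: (@dominated_integrable _ _ (fun x => 4 * spinor_norm (f x) ^+ 2)) => //.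
    exact: measurable_funX.
  by move=> x _; rewrite ger0_norm ?sqr_ge0.
rewrite /sqint -ge0_integralZl//; last 2 first.
- by apply/measurable_EFinP; apply: measurable_funX; exact: measurable_spinor_norm.
- by move=> x _; rewrite lee_fin sqr_ge0.
apply: ge0_le_integral => //.
- by move=> x _; rewrite lee_fin sqr_ge0.
- by apply/measurable_EFinP; exact: measurable_funX.
- exact: measurable_int i4.
- by move=> x _; rewrite -EFinM lee_fin.
Qed.

Lemma cauchy_kernel_mnorm_integrable f x : L2 f ->
  mu.-integrable setT (EFin \o (fun y => cauchy_kernel y x * mnorm (f y))).
Proof.
move=> lf; have [mf _] := lf; have mn := measurable_mnorm mf.
have mk : measurable_fun setT (fun y => cauchy_kernel y x).
  exact: continuous_measurable_fun (@continuous_cauchy_kernel R x).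
have [ik _] := cauchy_kernel_integrable x; have [i2 _] := mnorm_sqr_integrable lf.
have ik2 : mu.-integrable setT (EFin \o (fun y => cauchy_kernel y x ^+ 2)).
  apply: (@dominated_integrable _ _ (fun y => cauchy_kernel y x)) => //.
    exact: measurable_funX.
  move=> y _; rewrite ger0_norm ?sqr_ge0// expr2 ler_piMl ?cauchy_kernel_le1//.
  exact: ltW (cauchy_kernel_gt0 _ _).
by have [] := cauchy_schwarz mk mn ik2 i2.
Qed.

Lemma schur_sqint (K : R) f u : 0 <= K -> L2 f -> spinor_measurable u ->
  (forall x, mnorm (u x) <= K * \int[mu]_y (cauchy_kernel y x * mnorm (f y))) ->
  (sqint u <= ((2 * K * pi) ^+ 2)%:E * sqint f)%E.
Proof.
move=> K0 lf mu' H; have [mf _] := lf; have mn := measurable_mnorm mf.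
have [i2 l2] := mnorm_sqr_integrable lf.
have ms := measurable_spinor_norm mu'.
have := schur_cauchy ms mn K0 (fun x => spinor_norm_ge0 (u x)) i2
  (fun x => le_trans (spinor_norm_le _) (H x)).
move/le_trans; apply.
have -> : ((2 * K * pi) ^+ 2)%:E = (((K * pi) ^+ 2)%:E * 4%:E)%E.
  by rewrite -EFinM; congr EFin; ring.
by rewrite -muleA; apply: lee_wpmul2l; rewrite ?lee_fin ?sqr_ge0.
Qed.

Section Weighted.
Variables (theta sigma : R).
Hypotheses (theta0 : 0 < theta) (ts : 1 + theta < sigma).
Local Notation rho := (2^-1 + theta).

Let s0 : 0 < sigma. Proof. by have := theta0; have := ts; lra. Qed.

(** Between the weights of [sandwich], a kernel bounded by a power [rho] of [bprod] is dominated by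
    the product of this function at [x] and at [y]: a rank-one kernel, of norm at most [jmass]. *)
Definition jweight x : R := bweight x `^ rho * japanese x `^ (- sigma).
Definition jmass : R := \int[mu]_x (jweight x ^+ 2).

Lemma continuous_bweight : continuous (@bweight R).
Proof.
by move=> x; apply: cvgD; [exact: cvg_cst|exact: norm_continuous].
Qed.

Lemma continuous_japanese_powR (a : R) : continuous (fun x => japanese x `^ a).
Proof.
by apply: powR_gt0_continuous; [exact: continuous_japanese|move=> x; exact: japanese_gt0].
Qed.

Lemma jweight_continuous : continuous jweight.
Proof.
move=> x; apply: cvgM; last exact: continuous_japanese_powR.
by apply: powR_gt0_continuous; [exact: continuous_bweight|move=> y; exact: bweight_gt0].
Qed.

(** The square behaves like <x> to the power 1 + 2 theta - 2 sigma, which is integrable precisely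
    when sigma exceeds 1 + theta; this is the condition [ts]. *)
Lemma jweight_integrable : mu.-integrable setT (EFin \o (fun x => jweight x ^+ 2)).
Proof.
have eta0 : 0 < 2 * sigma - 2 - 2 * theta by have := ts; lra.
have i1 := integrableZl measurableT (2 `^ (2 * rho)) (japanese_powR_integrable eta0).
apply: (@dominated_integrable _ _ (fun x => 2 `^ (2 * rho) * japanese x `^ (- 1 - (2 * sigma - 2 - 2 * theta)))) => //.
  apply: measurable_funX; exact: continuous_measurable_fun jweight_continuous.
move=> x _; rewrite ger0_norm ?sqr_ge0// /jweight exprMn.
have j0 := japanese_gt0 x; have b0 := bweight_gt0 x.
rewrite -!powR_mulrn ?powR_ge0// -!powRrM.
have -> : - 1 - (2 * sigma - 2 - 2 * theta) = 2 * rho - sigma * 2 by field.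
rewrite mulNr powRD; last by rewrite (gt_eqF j0) implybT.
rewrite mulrA ler_wpM2r ?powR_ge0// -powRM ?(ltW j0)// [rho * _]mulrC.
have r0 : 0 <= 2 * rho by have := theta0; lra.
by rewrite ge0_ler_powR ?nnegrE ?bweight_japanese ?(ltW b0)// mulr_ge0 ?(ltW j0).
Qed.

Lemma jmass_ge0 : 0 <= jmass.
Proof. by apply: Rintegral_ge0 => x _; exact: sqr_ge0. Qed.

Lemma weight_measurable (a : R) f : spinor_measurable f -> spinor_measurable (weight a f).
Proof.
move=> /spinor_measurableE mf; apply/spinor_measurableE => i j.
rewrite /weight; have -> : (fun x => (((japanese x `^ a)%:C)%C *: f x) i j) =
  fun x => ((japanese x `^ a)%:C)%C * f x i j by apply/funext => x; rewrite mxE.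
apply: cmeasM; last exact: mf.
by apply: ccont_meas => //; apply: ccont_real; exact: continuous_japanese_powR.
Qed.

Lemma mnorm_weight (a : R) f x : mnorm (weight a f x) = japanese x `^ a * mnorm (f x).
Proof. by rewrite /weight mnormZ cabs_real ger0_norm ?powR_ge0. Qed.

Lemma spinor_norm_weight (a : R) f x :
  spinor_norm (weight a f x) = japanese x `^ a * spinor_norm (f x).
Proof. by rewrite /weight spinor_normZ cabs_real ger0_norm ?powR_ge0. Qed.

Lemma bprod_weightE phi x y : bprod x y `^ rho * mnorm (weight (- sigma) phi y) =
  bweight x `^ rho * (jweight y * mnorm (phi y)).
Proof.
rewrite mnorm_weight /bprod powRM ?(ltW (bweight_gt0 _))// /jweight; ring.
Qed.

Lemma bprod_weight_integrable phi x : L2 phi ->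
  mu.-integrable setT (EFin \o (fun y => bprod x y `^ rho * mnorm (weight (- sigma) phi y))).
Proof.
move=> lf; have [mf _] := lf; have mn := measurable_mnorm mf.
have [i2 _] := mnorm_sqr_integrable lf.
have mj := continuous_measurable_fun jweight_continuous.
have [ij _] := cauchy_schwarz mj mn jweight_integrable i2.
under eq_fun do rewrite bprod_weightE.
exact: (integrableZl measurableT (bweight x `^ rho) ij).
Qed.

Lemma sandwich_sqint (K : R) phi B : 0 <= K -> L2 phi ->
  spinor_measurable (B (weight (- sigma) phi)) ->
  (forall x, mnorm (B (weight (- sigma) phi) x) <=
    K * \int[mu]_y (bprod x y `^ rho * mnorm (weight (- sigma) phi y))) ->
  (sqint (sandwich sigma B phi) <= ((2 * K * jmass) ^+ 2)%:E * sqint phi)%E.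
Proof.
move=> K0 lf mB H; have [mf _] := lf; have mn := measurable_mnorm mf.
have [i2 l2] := mnorm_sqr_integrable lf.
have mj := continuous_measurable_fun jweight_continuous.
have [ij _] := cauchy_schwarz mj mn jweight_integrable i2.
have ms : measurable_fun setT (fun x => spinor_norm (sandwich sigma B phi x)).
  by apply: measurable_spinor_norm; exact: weight_measurable.
have := rank_one_bound ms mn mj K0 (fun x => spinor_norm_ge0 _) jweight_integrable i2.
rewrite -/jmass => HH; apply: (@le_trans _ _ (((K * jmass) ^+ 2)%:E * \int[mu]_x (mnorm (phi x) ^+ 2)%:E)%E).
  apply: HH => x; rewrite /sandwich spinor_norm_weight.
  apply: (le_trans (ler_wpM2l (powR_ge0 _ _) (le_trans (spinor_norm_le _) (H x)))).
  under eq_Rintegral do rewrite bprod_weightE.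
  by rewrite RintegralZl// /jweight; apply: eq_ler; ring.
have -> : ((2 * K * jmass) ^+ 2)%:E = (((K * jmass) ^+ 2)%:E * 4%:E)%E.
  by rewrite -EFinM; congr EFin; ring.
by rewrite -muleA; apply: lee_wpmul2l; rewrite ?lee_fin ?sqr_ge0.
Qed.

End Weighted.

End OperatorBounds.

(** * Uniqueness of square-integrable solutions *)

Section Uniqueness.
Context {R : realType}.
Local Notation C := R[i].
Local Notation Re := complex.Re.
Local Notation Im := complex.Im.
Local Notation mu := (@lebesgue_measure R).
Implicit Types (f g u w : R -> 'cV[C]_2) (x y a b : R).

Lemma ae_Rintegral (f g : R -> R) a b :
  mu.-integrable `[a, b] (EFin \o f) -> mu.-integrable `[a, b] (EFin \o g) ->
  {ae mu, forall x, f x = g x} ->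
  \int[mu]_(x in `[a, b]) f x = \int[mu]_(x in `[a, b]) g x.
Proof.
move=> if1 ig fg; rewrite /Rintegral; congr fine; apply: ae_eq_integral.
- exact: measurable_itv.
- exact: measurable_int if1.
- exact: measurable_int ig.
- by apply: aeS fg => x /= -> .
Qed.

Lemma ae_mprimitive (F G G' : R -> 'cV[C]_2) : mprimitive F G ->
  (forall a b, mintegrable `[a, b] G') -> {ae mu, forall x, G x = G' x} -> mprimitive F G'.
Proof.
move=> pF iG' GG' i j; have [[i1 E1] [i2 E2]] := pF i j.
split; split.
- by move=> a b; have [] := iG' a b i j.
- move=> x y xy; rewrite E1//; apply: ae_Rintegral => //; first by have [] := iG' x y i j.
  by apply: aeS GG' => t ->.
- by move=> a b; have [] := iG' a b i j.
- move=> x y xy; rewrite E2//; apply: ae_Rintegral => //; first by have [] := iG' x y i j.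
  by apply: aeS GG' => t ->.
Qed.

Lemma spinor_norm_sqr (v : 'cV[C]_2) : spinor_norm v ^+ 2 = cabs (v 0 0) ^+ 2 + cabs (v 1 0) ^+ 2.
Proof. by rewrite spinor_normE sqr_sqrtr// addr_ge0 ?sqr_ge0. Qed.

Lemma continuous_spinor_norm_sqr w : mcont w -> continuous (fun x => spinor_norm (w x) ^+ 2).
Proof.
move=> cw; have cc i : continuous (fun x => cabs (w x i 0)) by apply: ccont_cabs; exact: cw.
under eq_fun do rewrite spinor_norm_sqr.
by move=> x; apply: cvgD; (rewrite expr2; apply: cvgM; exact: cc).
Qed.

Lemma spinor_norm_eq0 (v : 'cV[C]_2) : spinor_norm v ^+ 2 = 0 -> v = 0.
Proof.
move=> v0; apply: mnorm_eq0; apply/eqP; rewrite -normr_le0 ger0_norm ?mnorm_ge0//.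
apply: (le_trans (mnorm_le_spinor v)); move/eqP: v0; rewrite sqrf_eq0 => /eqP ->.
by rewrite mulr0.
Qed.

Lemma curr_le (v : 'cV[C]_2) : `|curr v| <= spinor_norm v ^+ 2.
Proof.
rewrite spinor_norm_sqr /curr ler_norml.
have := sqr_ge0 (cabs (v 0 0)); have := sqr_ge0 (cabs (v 1 0)) => h1 h2.
by apply/andP; split; lra.
Qed.

Lemma bounded_mass_small (N : R -> R) (S c : R) : continuous N ->
  (forall a b, a <= b -> \int[mu]_(x in `[a, b]) N x <= S) -> 0 < c ->
  forall x0, (forall x, x0 <= x -> c <= N x) \/ (forall x, x <= x0 -> c <= N x) -> False.
Proof.
move=> cN NS c0 x0 H.
have K a b : a <= b -> (forall x, a <= x -> x <= b -> c <= N x) -> (b - a) * c <= S.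
  move=> ab cNx; apply: le_trans (NS _ _ ab).
  have ic : mu.-integrable `[a, b] (EFin \o (fun=> c)).
    by apply: continuous_itv_integrable => x; exact: cvg_cst.
  have -> : (b - a) * c = \int[mu]_(x in `[a, b]) c.
    rewrite Rintegral_cst//= lebesgue_measure_itv /= lte_fin.
    move: ab; rewrite le_eqVlt => /predU1P[->|->]; first by rewrite ltxx /= subrr mul0r mulr0.
    by rewrite -EFinB /= mulrC.
  apply: le_Rintegral => //; first exact: continuous_itv_integrable.
  by move=> x /=; rewrite in_itv /= => /andP[ax xb]; exact: cNx.
have S0 : 0 <= S.
  case: H => H; have := @K x0 x0 (lexx _); rewrite subrr mul0r; apply=> x h1 h2.
    exact: H.
  exact: H.
(* An interval of length (S + 1) / c on which N >= c would carry mass at least S + 1. *)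
have [t tc l0] : exists2 t, t * c = S + 1 & 0 <= t.
  by exists ((S + 1) / c); [rewrite divfK ?gt_eqF|rewrite divr_ge0 ?addr_ge0 ?(ltW c0)].
case: H => H.
  have := @K x0 (x0 + t); rewrite (_ : (x0 + t - x0) * c = S + 1); last by rewrite -tc; ring.
  move=> K1.
  suff : S + 1 <= S by lra.
  by apply: K1; [lra|move=> x h1 _; exact: H].
have := @K (x0 - t) x0; rewrite (_ : (x0 - (x0 - t)) * c = S + 1); last by rewrite -tc; ring.
move=> K1.
suff : S + 1 <= S by lra.
by apply: K1; [lra|move=> x _ h1; exact: H].
Qed.

(** A negative current stays below its value all the way to the left, a positive one stays above it
    all the way to the right, and the current is bounded by the squared norm; either contradicts
    finite mass. A current that is identically zero has zero derivative, a positive multiple of the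
    squared norm. *)
Lemma ode_L2_zero (m : R) (V : R -> 'M[C]_2) (z : C) (S : R) w :
  self_adjoint V -> 0 < Im z ->
  mder w (fun x => dmx m V z x *m w x) ->
  (forall a b, a <= b -> \int[mu]_(x in `[a, b]) (spinor_norm (w x) ^+ 2) <= S) ->
  forall x, w x = 0.
Proof.
move=> sV z0 dw wS.
have dc x : is_derive x 1 (fun x => curr (w x)) (2 * Im z * spinor_norm (w x) ^+ 2).
  by rewrite spinor_norm_sqr; exact: (curr_derive sV x dw).
have N0 x : 0 <= 2 * Im z * spinor_norm (w x) ^+ 2.
  by apply: mulr_ge0; [apply: mulr_ge0 => //; exact: ltW|exact: sqr_ge0].
have mono x y : x <= y -> curr (w x) <= curr (w y).
  by move=> xy; apply: (derive_ge0_le xy dc).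
have cw := mder_cont dw.
have cN := continuous_spinor_norm_sqr cw.
have c0 x : curr (w x) = 0.
  have [neg|pos|//] := ltgtP (curr (w x)) 0.
    exfalso; have n0 : 0 < - curr (w x) by rewrite oppr_gt0.
    apply: (@bounded_mass_small _ S _ cN wS n0 x); right => y yx.
    apply: le_trans (curr_le (w y)); rewrite -normrN; apply: le_trans (ler_norm _).
    by rewrite lerN2 mono.
  exfalso; apply: (@bounded_mass_small _ S _ cN wS pos x); left => y xy.
  by apply: le_trans (curr_le (w y)); apply: le_trans (ler_norm _); exact: mono.
move=> x; apply: spinor_norm_eq0.
have : is_derive x 1 (fun x => curr (w x)) 0.
  by rewrite (_ : (fun x => _) = cst 0); [exact: is_derive_cst|exact/funext].
move=> [_ E0]; have [_ E1] := dc x; rewrite E0 in E1.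
by apply/eqP; have /eqP := esym E1; rewrite !mulf_eq0 pnatr_eq0 (gt_eqF z0).
Qed.

End Uniqueness.

(** * Integrability and decay of the Green kernel *)

Section Resolvent.
Context {R : realType}.
Local Notation C := R[i].
Local Notation Re := complex.Re.
Local Notation Im := complex.Im.
Local Notation mu := (@lebesgue_measure R).
Variables (m theta : R) (q : R -> R) (qb : R).
Hypotheses (m0 : 0 < m) (theta0 : 0 < theta) (theta1 : theta <= 1).
Hypotheses (cq : continuous q) (q0 : forall x, 0 <= q x) (qN : forall x, q (- x) = q x)
  (qle : forall x, q x <= qb) (iq : mu.-integrable setT (EFin \o q)).
Implicit Types (f u : R -> 'cV[C]_2) (x y : R).
Local Notation admissible := (admissible theta q).
Local Notation jost := (jost m q).

Lemma mnorm_outer (v : 'cV[C]_2) (w : 'rV[C]_2) : mnorm (v *m w) = mnorm v * mnorm w.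
Proof.
by rewrite /mnorm !sum2E !big_ord1 !sum2E !mxE !big_ord1 !cabsM; ring.
Qed.

Variables (V : R -> 'M[C]_2) (zeta : C) (g h : R -> 'cV[C]_2).
Hypotheses (aV : admissible V) (hz : half_disc zeta) (sg : jost V zeta g)
  (sh : jost (reflect V) zeta h) (W0 : det2 (g 0) (beta *m h 0) != 0).
Local Notation E := (lkernel m zeta g h).
Local Notation F := (rkernel m zeta g h).
Local Notation z := (energy m zeta).
Local Notation G := (green m zeta g h).

Let c0 : 0 < cabs (det2 (g 0) (beta *m h 0)).
Proof. by rewrite cabs_gt0. Qed.

Let W_neq0 x : det2 (wave m zeta g x) (lwave m zeta h x) != 0.
Proof. by rewrite -cabs_gt0 (cabs_wronskian _ aV hz sg sh). Qed.

Let wave_gt0 x : 0 < mnorm (wave m zeta g x) /\ 0 < mnorm (lwave m zeta h x).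
Proof.
have := W_neq0 x; move: (wave m zeta g x) (lwave m zeta h x) => v w vw.
split; rewrite lt_neqAle mnorm_ge0 andbT eq_sym; apply: contraNneq vw => /mnorm_eq0 ->.
  by rewrite /det2 !mxE !mul0r subrr.
by rewrite /det2 !mxE !mulr0 subrr.
Qed.

(** Differentiation needs the row factors integrable on their own. As [mnorm] is multiplicative on
    rank-one matrices, a bound on the kernel at [x] divided by the nonzero norm of the wave at [x]
    is a bound on the row factor. *)
Lemma green_primitive f (k : R -> R -> R) : (forall x, split_bound E F x (k x)) ->
  mmeas setT f ->
  (forall x, mu.-integrable setT (EFin \o (fun y => k x y * mnorm (f y)))) ->
  mprimitive (G f) (fun x => dmx m V z x *m G f x - ci *: (alpha *m f x)).
Proof.
move=> kb mf ik.
have mL x : measurable (`]-oo, x]%classic : set (measurableTypeR R)) by exact: measurable_itv.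
have mR x : measurable (`[x, +oo[%classic : set (measurableTypeR R)) by exact: measurable_itv.
have mS (D : set (measurableTypeR R)) : mmeas D f.
  by move=> i j; have [h1 h2] := mf i j; split; exact: measurable_funTS.
have cw := mder_cont (wave_mder hz sg); have cl := mder_cont (lwave_mder hz sh).
have cdl := cont_dual aV hz sg sh c0 (lexx _) cl.
have cdw := cont_dual aV hz sg sh c0 (lexx _) cw.
apply: (green_mprimitive aV hz sg sh c0 (lexx _)) => x.
  have [p0 _] := wave_gt0 x; have [_ _ bE _] := kb x.
  apply: (@dominated_mintegrable _ _ _ _ _ (fun y => (mnorm (wave m zeta g x))^-1 * (k x y * mnorm (f y)))).
  - exact: mL.
  - by apply: mmeasM; [apply: mcont_meas|].
  - move=> y /=; rewrite in_itv /= => yx; apply: (le_trans (mnormM _ _)).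
    rewrite mulrA ler_wpM2r ?mnorm_ge0// ler_pdivlMl// -mnorm_outer; exact: bE.
  - by apply: integrableS (integrableZl measurableT _ (ik x)) => //.
have [_ p0] := wave_gt0 x; have [_ _ _ bF] := kb x.
apply: (@dominated_mintegrable _ _ _ _ _ (fun y => (mnorm (lwave m zeta h x))^-1 * (k x y * mnorm (f y)))).
- exact: mR.
- by apply: mmeasM; [apply: mcont_meas|].
- move=> y /=; rewrite in_itv /= andbT => xy; apply: (le_trans (mnormM _ _)).
  rewrite mulrA ler_wpM2r ?mnorm_ge0// ler_pdivlMl// -mnorm_outer; exact: bF.
- by apply: integrableS (integrableZl measurableT _ (ik x)) => //.
Qed.

(** Follows from e^s >= 1 + s^2/2 at s = bt; the constant is chosen so that (1 + 2/b^2)(1 + b^2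
    t^2/2) dominates 1 + t^2. *)
Lemma exp_le_cauchy (b t : R) : 0 < b -> 0 <= t ->
  expR (- b * t) <= (1 + 2 / b ^+ 2) * (1 + t ^+ 2)^-1.
Proof.
move=> b0 t0; rewrite mulNr expRN.
have bt0 : 0 <= b * t by rewrite mulr_ge0// ltW.
have H : 1 + (b * t) ^+ 2 / 2 <= expR (b * t) by have := expR_ge1Dxn 1 bt0.
rewrite ler_pdivlMr ?one_sqr_gt0// mulrC ler_pdivrMr ?expR_gt0//.
apply: le_trans (ler_wpM2l _ H); last by rewrite addr_ge0// divr_ge0// sqr_ge0.
have -> : (1 + 2 / b ^+ 2) * (1 + (b * t) ^+ 2 / 2) = 1 + t ^+ 2 + 2 / b ^+ 2 + (b * t) ^+ 2 / 2.
  by field; rewrite gt_eqF.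
by rewrite -addrA lerDl addr_ge0 ?divr_ge0 ?sqr_ge0.
Qed.

Hypothesis zeta_neg : Im zeta < 0.

Let k0 : 0 < Im (momentum m zeta).
Proof.
rewrite Im_momentum// mulr_gt0 ?divr_gt0// mulr_gt0 ?oppr_gt0//.
by rewrite ltr_wpDl// invr_ge0 exprn_ge0// cabs_ge0.
Qed.

(** Off the real axis k is nonzero, so both Jost solutions are bounded and the decay of e^{ik|x-y|}
    is left intact. *)
Lemma green_decay : exists2 K, 0 <= K &
  forall x, split_bound E F x (fun y => K * cauchy_kernel y x).
Proof.
have kn0 : momentum m zeta != 0 by apply: contraTneq k0 => ->; rewrite ltxx.
have [_ cV1 _] := aV; have aV' := admissible_reflect qN aV; have [_ cV2 _] := aV'.
have Vq U : admissible U -> forall y, mnorm (potmx U y) * (bweight y `^ (1 + theta)) ^+ 2 <= q y.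
  by move=> [_ _ Uq] y; rewrite mnorm_potmx.
have [b1 b10 H1] := jost_bounded m0 theta0 cq q0 iq (mcont_potmx cV1) (Vq _ aV) hz kn0 sg.
have [b2 b20 H2] := jost_bounded m0 theta0 cq q0 iq (mcont_potmx cV2) (Vq _ aV') hz kn0 sh.
pose c := cabs (det2 (g 0) (beta *m h 0)); pose b := Im (momentum m zeta).
exists (c^-1 * (1 + 2 / b ^+ 2) * (b1 * b2)) => [|x].
  by rewrite !mulr_ge0 ?invr_ge0 ?cabs_ge0 ?addr_ge0 ?divr_ge0 ?sqr_ge0 ?(ltW b10) ?(ltW b20).
have ci0 : 0 <= c^-1 by rewrite invr_ge0 cabs_ge0.
have core (t A B P : R) : 0 <= t -> P = t ^+ 2 -> 0 <= A -> 0 <= B -> A <= b1 -> B <= b2 ->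
    c^-1 * expR (- Im (momentum m zeta) * t) * (A * B) <=
    c^-1 * (1 + 2 / b ^+ 2) * (b1 * b2) * (1 + P)^-1.
  move=> t0 -> A0 B0 A1 B1; rewrite [leRHS]mulrAC.
  apply: ler_pM; rewrite ?mulr_ge0 ?expR_ge0//; last exact: ler_pM.
  by rewrite -(mulrA c^-1) ler_wpM2l//; exact: exp_le_cauchy.
split.
- exact: (cont_lkernel aV hz sg sh c0 (lexx _)).
- exact: (cont_rkernel aV hz sg sh c0 (lexx _)).
- move=> y yx; apply: (le_trans (mnorm_lkernel aV hz sg sh c0 (lexx _) yx)).
  by apply: core; rewrite ?mnorm_ge0 ?subr_ge0//; ring.
- move=> y xy; apply: (le_trans (mnorm_rkernel aV hz sg sh c0 (lexx _) xy)).
  rewrite [mnorm (h _) * _]mulrC.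
  by apply: core; rewrite ?mnorm_ge0 ?subr_ge0//; ring.
Qed.

End Resolvent.

(** * The Green operator is the resolvent *)

Section GreenResolvent.
Context {R : realType}.
Local Notation C := R[i].
Local Notation Re := complex.Re.
Local Notation Im := complex.Im.
Local Notation mu := (@lebesgue_measure R).
Variables (m theta : R) (q : R -> R) (qb : R).
Hypotheses (m0 : 0 < m) (theta0 : 0 < theta) (theta1 : theta <= 1).
Hypotheses (cq : continuous q) (q0 : forall x, 0 <= q x) (qN : forall x, q (- x) = q x)
  (qle : forall x, q x <= qb) (iq : mu.-integrable setT (EFin \o q)).
Implicit Types (f u : R -> 'cV[C]_2) (x y : R).
Variables (V : R -> 'M[C]_2) (zeta : C) (g h : R -> 'cV[C]_2).
Hypotheses (aV : admissible theta q V) (hz : half_disc zeta) (sg : jost m q V zeta g)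
  (sh : jost m q (reflect V) zeta h) (zeta_neg : Im zeta < 0) (zeta_lt1 : cabs zeta < 1).
Local Notation z := (energy m zeta).
Local Notation G := (green m zeta g h).

Let W0 : det2 (g 0) (beta *m h 0) != 0.
Proof. exact: (wronskian_neq0 m0 qN aV hz zeta_neg zeta_lt1 sg sh). Qed.

Let decay : exists2 K, 0 <= K & forall x,
  split_bound (lkernel m zeta g h) (rkernel m zeta g h) x (fun y => K * cauchy_kernel y x).
Proof. exact: (green_decay m0 theta0 cq q0 qN iq aV hz sg sh W0 zeta_neg). Qed.

Let ik (K : R) f x : L2 f ->
  mu.-integrable setT (EFin \o (fun y => K * cauchy_kernel y x * mnorm (f y))).
Proof.
move=> lf; have := integrableZl measurableT K (cauchy_kernel_mnorm_integrable x lf).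
by congr (integrable _ _ _); apply/funext => y /=; rewrite -EFinM mulrA.
Qed.

Let mm f : L2 f -> mmeas setT f.
Proof. by move=> [/spinor_measurableE]. Qed.

Let primitive_green f : L2 f ->
  mprimitive (G f) (fun x => dmx m V z x *m G f x - ci *: (alpha *m f x)).
Proof.
move=> lf; have [K K0 HK] := decay.
by apply: (green_primitive aV hz sg sh W0 HK); [exact: mm|move=> x; exact: ik].
Qed.

Lemma green_measurable f : L2 f -> spinor_measurable (G f).
Proof.
move=> lf; apply/spinor_measurableE; apply: mcont_meas => //.
exact: mprimitive_cont (primitive_green lf).
Qed.

Lemma green_sqint : exists2 K : R, 0 <= K &
  forall f, L2 f -> (sqint (G f) <= (K ^+ 2)%:E * sqint f)%E.
Proof.
have [K K0 HK] := decay; exists (2 * K * pi); first by rewrite !mulr_ge0 ?pi_ge0.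
move=> f lf; apply: schur_sqint => //; first exact: green_measurable.
move=> x; apply: (le_trans (splitop_le (HK x) (mm lf) (ik K x lf))).
rewrite -RintegralZl//; last exact: cauchy_kernel_mnorm_integrable.
by apply: eq_ler; apply: eq_Rintegral => y _; rewrite mulrA.
Qed.

Lemma green_L2 f : L2 f -> L2 (G f).
Proof.
move=> lf; have [K K0 HK] := green_sqint; apply/L2E; split; first exact: green_measurable.
by apply: le_lt_trans (HK f lf) _; rewrite sqint_sqnorm// -EFinM ltry.
Qed.

Lemma green_linear (a : C) f1 f2 : L2 f1 -> L2 f2 ->
  G (fun x => a *: f1 x + f2 x) = (fun x => a *: G f1 x + G f2 x).
Proof.
move=> l1 l2; apply/funext => x; have [K K0 HK] := decay.
exact: (splitop_linear a (HK x) (mm l1) (mm l2) (ik K x l1) (ik K x l2)).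
Qed.

Lemma green_derivative_L2 f : L2 f -> L2 (fun x => dmx m V z x *m G f x - ci *: (alpha *m f x)).
Proof.
move=> lf; have lG := green_L2 lf; have [_ cV _] := aV.
have [b Hb] := dmx_bounded m theta0 qle z aV.
apply: (@L2_dom _ (2 * b) (2 * mnorm (ci *: alpha : 'M[C]_2)) (G f) f) => //.
  apply/spinor_measurableE; apply: mmeasB.
    by apply: mmeasM; [apply: mcont_meas => //; exact: mcont_dmx|exact: mm].
  have -> : (fun x => ci *: (alpha *m f x)) = (fun x => (ci *: alpha) *m f x).
    by apply/funext => x; rewrite scalemxAl.
  by apply: mmeasM; [apply: mcont_meas => //; exact: mcont_cst|exact: mm].
move=> x; apply: (le_trans (spinor_norm_le _)); apply: (le_trans (mnormB _ _)).
have b0 : 0 <= b by exact: le_trans (mnorm_ge0 _) (Hb 0).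
apply: lerD.
  apply: (le_trans (mnormM _ _)); rewrite [2 * b]mulrC -mulrA.
  by apply: ler_pM; rewrite ?mnorm_ge0 ?mnorm_le_spinor.
rewrite scalemxAl; apply: (le_trans (mnormM _ _)); rewrite [2 * mnorm _]mulrC -mulrA.
by apply: ler_pM; rewrite ?mnorm_ge0 ?mnorm_le_spinor.
Qed.

Lemma L2_linear (a : C) u1 u2 : L2 u1 -> L2 u2 -> L2 (fun x => u1 x + a *: u2 x).
Proof.
move=> l1 l2; apply: (@L2_dom _ 2 (2 * cabs a) u1 u2) => // [|x].
  apply/spinor_measurableE; apply: mmeasD; first exact: mm.
  have -> : (fun x => a *: u2 x) = (fun x => a%:M *m u2 x).
    by apply/funext => x; rewrite mul_scalar_mx.
  by apply: mmeasM; [apply: mcont_meas => //; exact: mcont_cst|exact: mm].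
apply: (le_trans (spinor_norm_le _)); apply: (le_trans (mnormD _ _)).
rewrite mnormZ; apply: lerD; first exact: mnorm_le_spinor.
by rewrite [2 * _]mulrC -mulrA ler_wpM2l ?cabs_ge0 ?mnorm_le_spinor.
Qed.

Lemma green_graph f : L2 f -> dirac_graph m V (G f) (fun x => f x + z *: G f x).
Proof.
move=> lf; have lG := green_L2 lf; have lG' := green_derivative_L2 lf.
have w := mprimitive_weak (primitive_green lf).
split; [by split=> //; eexists; [exact: lG'|exact: w]|exact: L2_linear|].
eexists; split; [exact: lG'|exact: w|].
apply: aeW => x _; rewrite -/ci mulmxBr scalerBr dmxE ci_alphaK.
rewrite [in X in _ - X]scalemxAl ci_alphaK mulmxBl -scalemxAl mul_scalar_mx.
move: (V x *m _) (z *: _) (_ *: (beta *m _)) (f x) => a b c d.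
by apply/matrixP => i j; rewrite !mxE; ring.
Qed.

(** Regularity: an element of the operator domain agrees almost everywhere with an absolutely
    continuous solution of the first-order system, obtained by solving the operator equation for the
    weak derivative. *)
Lemma dirac_graph_ode f u : L2 f -> dirac_graph m V u (fun x => f x + z *: u x) ->
  exists2 J, mprimitive J (fun x => dmx m V z x *m J x - ci *: (alpha *m f x)) & u = J %[ae mu].
Proof.
move=> lf [[lu _] lh [u' [lu' wu E]]].
have [J pJ uJ] := weak_mprimitive lu lu' wu; exists J => //.
have [_ cV _] := aV.
apply: (ae_mprimitive pJ) => [a b|].
  have mI : measurable (`[a, b]%classic : set (measurableTypeR R)) by exact: measurable_itv.
  have i1 : mintegrable `[a, b] (fun x => dmx m V z x *m J x).
    by apply: mcont_integrable; apply: mcontM; [exact: mcont_dmx|exact: mprimitive_cont pJ].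
  have i2 := mintegrable_mulmx (- (ci *: alpha)) mI (L2_mintegrable a b lf).
  move=> i j; have := cintegrableD mI (i1 i j) (i2 i j); congr cintegrable.
  by apply/funext => x; rewrite mulNmx -scalemxAl [RHS]mxE.
have H2 (P Q : R -> Prop) : {ae mu, forall x, P x} -> {ae mu, forall x, Q x} -> {ae mu, forall x, P x /\ Q x}.
  move=> h1 h2; have FF := ae_filter_ringOfSetsType mu; exact: filterI h1 h2.
apply: aeS (H2 _ _ uJ E) => x [/(_ I) Jx /(_ I)]; rewrite -/ci Jx => Ex.
have -> : dmx m V z x *m J x = (ci *: alpha) *m (f x - ci *: (alpha *m u' x)).
  rewrite dmxE mulmxBl -(scalemxAl _ beta) mul_scalar_mx; congr (_ *m _).
  move: Ex; move: (V x *m _) (z *: _) (_ *: (beta *m _)) (f x) (ci *: _) => a b c d e Ex.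
  have -> : d = e + c + a - b by rewrite -Ex addrK.
  by apply/matrixP => i j; rewrite !mxE; ring.
have Y : (ci *: alpha) *m (ci *: (alpha *m u' x)) = - u' x.
  by rewrite [ci *: (alpha *m u' x)]scalemxAl -(scalemxAl ci alpha (_ *m _)) ci_alphaK.
by rewrite mulmxBr Y -scalemxAl opprK addrAC subrr add0r.
Qed.

Lemma Im_energy_gt0 : 0 < Im z.
Proof.
have [z0 _ _] := hz; have c0 : 0 < cabs zeta by rewrite cabs_gt0.
rewrite Im_energy mulr_gt0 ?divr_gt0// mulr_gt0 ?oppr_gt0//.
by rewrite subr_gt0 invf_gt1 ?exprn_gt0// exprn_ilt1 ?cabs_ge0.
Qed.

(** In the difference of two absolutely continuous solutions the source cancels; the density becomes
    continuous, the difference is a classical solution, and the current argument applies. *)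
Lemma green_unique f u : L2 f -> dirac_graph m V u (fun x => f x + z *: u x) ->
  u = G f %[ae mu].
Proof.
move=> lf gu; have [J pJ uJ] := dirac_graph_ode lf gu.
have [[lu _] _ _] := gu; have [sV cV _] := aV; have lG := green_L2 lf.
have pv := primitive_green lf.
pose w x := J x - G f x.
have pw : mprimitive w (fun x => dmx m V z x *m w x).
  have c0 : mcont (fun=> 0 : 'M[C]_2) by exact: mcont_cst.
  have := mprimitiveD pJ (mprimitiveM c0 (mder_cst (- 1%:M)) pv).
  congr mprimitive; apply/funext => x; rewrite /w; first by rewrite mulNmx mul1mx.
  rewrite mul0mx add0r mulNmx mul1mx mulmxBr.
  move: (dmx _ _ _ _ *m J x) (dmx _ _ _ _ *m G f x) (ci *: _) => a b c.
  by apply/matrixP => i j; rewrite !mxE; ring.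
have cw := mprimitive_cont pw.
have dw : mder w (fun x => dmx m V z x *m w x).
  by apply: mprimitive_mder pw; apply: mcontM => //; exact: mcont_dmx.
have ld : L2 (fun x => u x + (-1) *: G f x) by exact: L2_linear.
have id1 := L2_integrable ld.
have cN := continuous_spinor_norm_sqr cw.
have w0 : forall x, w x = 0.
  apply: (@ode_L2_zero _ m V z (sqnorm (fun x => u x + (-1) *: G f x)) w sV Im_energy_gt0 dw).
  move=> a b ab.
  have mI : measurable (`[a, b]%classic : set (measurableTypeR R)) by exact: measurable_itv.
  have iD : mu.-integrable `[a, b] (EFin \o (fun x => spinor_norm (u x + (-1) *: G f x) ^+ 2)).
    exact: integrableS id1.
  rewrite (@ae_Rintegral _ _ (fun x => spinor_norm (u x + (-1) *: G f x) ^+ 2))//.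
  - rewrite -lee_fin /sqnorm /Rintegral !fineK; last 2 first.
    + exact: integrable_fin_num id1.
    + exact: integrable_fin_num iD.
    apply: ge0_subset_integral => //; first exact: measurable_int id1.
    by move=> x _; rewrite lee_fin sqr_ge0.
  - exact: continuous_itv_integrable.
  - by apply: aeS uJ => x /(_ I) ->; rewrite scaleN1r.
by apply: aeS uJ => x H _; rewrite H//; apply/eqP; rewrite -subr_eq0; apply/eqP; exact: w0.
Qed.

Lemma green_resolvent : is_resolvent m V z G.
Proof.
split; last by move=> f lf; split; [exact: green_graph|move=> u; exact: green_unique].
split=> [f lf|a f1 f2 l1 l2|]; first exact: green_L2.
  by rewrite green_linear//; apply: aeW.
have [K K0 HK] := green_sqint.
by apply: le_lt_trans (opnorm_le K0 HK) _; rewrite ltry.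
Qed.

End GreenResolvent.

(** * Limiting absorption *)

Section LimitingAbsorption.
Context {R : realType}.
Local Notation C := R[i].
Local Notation Re := complex.Re.
Local Notation Im := complex.Im.
Local Notation mu := (@lebesgue_measure R).
Implicit Types (f u phi : R -> 'cV[C]_2) (x y : R).

Lemma admissible_exists (V : R -> 'M[C]_2) (sigma : R) :
  self_adjoint V -> continuous_entries V -> decay 3 V -> 1 < sigma ->
  exists (theta : R) (q : R -> R) (qb : R), [/\ [/\ 0 < theta, theta <= 1 & 1 + theta < sigma],
    [/\ continuous q, forall x : R, 0 <= q x, forall x, q (- x) = q x & forall x, q x <= qb],
    mu.-integrable setT (EFin \o q) & admissible theta q V].
Proof.
move=> sV cV [eps [K [eps0 HK]]] s1.
(* The bound by eps/4 leaves room for eta = eps - 2 theta > 0 in the decay of [q]; the bound by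
   (sigma - 1)/2 leaves 1 + theta < sigma. *)
pose theta := Num.min 1 (Num.min (eps / 4) ((sigma - 1) / 2)).
have t1 : theta <= 1 by rewrite ge_min lexx.
have t2 : theta <= eps / 4 by rewrite !ge_min lexx orbT.
have t3 : theta <= (sigma - 1) / 2 by rewrite !ge_min lexx !orbT.
have t0 : 0 < theta by rewrite !lt_min ltr01 !divr_gt0// subr_gt0.
have HV i j x : cabs (V x i j) <= K * japanese x `^ (- 3 - eps) by rewrite -cabs_normE; exact: HK.
have K0 : 0 <= K.
  have := le_trans (cabs_ge0 _) (HV 0 0 0); rewrite pmulr_lge0// powR_gt0//; exact: japanese_gt0.
(* The 4 counts the entries of V, and the power of 2 comes from replacing [bweight] by twice
   [japanese]. *)
pose Kq := 4 * K * 2 `^ (2 * (1 + theta)); pose eta := eps - 2 * theta.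
have Kq0 : 0 <= Kq by rewrite mulr_ge0 ?powR_ge0 ?mulr_ge0.
have eta0 : 0 < eta by rewrite /eta; lra.
pose q x := Kq * japanese x `^ (- 1 - eta).
have q0 x : 0 <= q x by rewrite mulr_ge0 ?powR_ge0.
exists theta, q, Kq; split.
- by split=> //; lra.
- split=> //.
  + by move=> x; apply: cvgM; [exact: cvg_cst|exact: continuous_japanese_powR].
  + by move=> x; rewrite /q /japanese sqrrN.
  + move=> x; rewrite /q ler_piMr// -[leRHS](powRr0 (japanese x)) ler_powR ?japanese_ge1//; lra.
- exact: (integrableZl measurableT Kq (japanese_powR_integrable eta0)).
- split=> // y; have j0 := japanese_gt0 y; have b0 := bweight_gt0 y.
  have mV : mnorm (V y) <= 4 * (K * japanese y `^ (- 3 - eps)).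
    rewrite mnorm_M2; have := HV 0 0 y; have := HV 0 1 y; have := HV 1 0 y; have := HV 1 1 y.
    lra.
  apply: (@le_trans _ _ (4 * (K * japanese y `^ (- 3 - eps)) * (2 * japanese y) `^ (2 * (1 + theta)))).
    apply: ler_pM; rewrite ?mnorm_ge0 ?exprn_ge0 ?powR_ge0//.
    rewrite -powR_mulrn ?powR_ge0// -powRrM [(1 + theta) * _]mulrC.
    have th : 0 <= 2 * (1 + theta) by lra.
    by rewrite ge0_ler_powR ?nnegrE ?bweight_japanese ?(ltW b0)// mulr_ge0 ?(ltW j0).
  rewrite powRM ?(ltW j0)// /q /Kq.
  have -> : - 1 - eta = (- 3 - eps) + 2 * (1 + theta) by rewrite /eta; ring.
  rewrite [_ `^ (- 3 - eps + _)]powRD; last by rewrite (gt_eqF j0) implybT.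
  by apply: eq_ler; ring.
Qed.

Variables (m theta sigma : R) (q : R -> R) (qb : R) (V : R -> 'M[C]_2).
Hypotheses (m0 : 0 < m) (theta0 : 0 < theta) (theta1 : theta <= 1) (ts : 1 + theta < sigma).
Hypotheses (cq : continuous q) (q0 : forall x, 0 <= q x) (qN : forall x, q (- x) = q x)
  (qle : forall x, q x <= qb) (iq : mu.-integrable setT (EFin \o q)).
Hypothesis aV : admissible theta q V.
Local Notation jost := (jost m q).
Local Notation J := (jostC m q).
Local Notation rho := (2^-1 + theta).
Local Notation jmass := (jmass theta sigma).

Let aV' := admissible_reflect qN aV.

Lemma jost_pair zeta : half_disc zeta ->
  exists2 g, jost V zeta g & exists h, jost (reflect V) zeta h.
Proof.
move=> hz.
have Vq U : admissible theta q U -> forall y, mnorm (potmx U y) * (bweight y `^ (1 + theta)) ^+ 2 <= q y.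
  by move=> [_ _ Uq] y; rewrite mnorm_potmx.
have [_ cV1 _] := aV; have [_ cV2 _] := aV'.
have [g sg] := jost_exists m0 theta0 cq q0 iq (mcont_potmx cV1) (Vq _ aV) hz.
have [h sh] := jost_exists m0 theta0 cq q0 iq (mcont_potmx cV2) (Vq _ aV') hz.
by exists g => //; exists h.
Qed.

Section Sandwich.
Variables (zeta : C) (g h : R -> 'cV[C]_2) (c : R).
Hypotheses (hz : half_disc zeta) (sg : jost V zeta g) (sh : jost (reflect V) zeta h)
  (c0 : 0 < c) (cW : c <= cabs (det2 (g 0) (beta *m h 0))).
Local Notation G := (green m zeta g h).
Local Notation K := (c^-1 * J ^+ 2).

Let bound x := green_bound m0 theta0 x aV hz sg sh c0 cW.

Lemma green_weighted_integrable phi x : L2 phi ->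
  mu.-integrable setT (EFin \o (fun y => K * bprod x y `^ rho * mnorm (weight (- sigma) phi y))).
Proof.
move=> lphi; have := integrableZl measurableT K (bprod_weight_integrable theta0 ts x lphi).
by congr (integrable _ _ _); apply/funext => y /=; rewrite -EFinM mulrA.
Qed.

Lemma weight_mmeas phi : L2 phi -> mmeas setT (weight (- sigma) phi).
Proof. by move=> [mphi _]; apply/spinor_measurableE; exact: weight_measurable. Qed.

Lemma green_weighted_measurable phi : L2 phi -> spinor_measurable (G (weight (- sigma) phi)).
Proof.
move=> lphi; apply/spinor_measurableE; apply: mcont_meas => //.
have W0 : det2 (g 0) (beta *m h 0) != 0 by rewrite -cabs_gt0 (lt_le_trans c0).
apply: mprimitive_cont (green_primitive aV hz sg sh W0 bound (weight_mmeas lphi) _) => x.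
exact: green_weighted_integrable.
Qed.

Let K0 : 0 <= K.
Proof. by rewrite mulr_ge0 ?invr_ge0 ?exprn_ge0 ?(ltW c0) ?(ltW (jostC_gt0 m q)). Qed.

Lemma sandwich_green_sqint phi : L2 phi ->
  (sqint (sandwich sigma G phi) <= ((2 * K * jmass) ^+ 2)%:E * sqint phi)%E.
Proof.
move=> lphi; apply: sandwich_sqint => //; first exact: green_weighted_measurable.
move=> x; apply: (le_trans (splitop_le (bound x) (weight_mmeas lphi) (green_weighted_integrable x lphi))).
rewrite -RintegralZl//; last exact: bprod_weight_integrable.
by apply: eq_ler; apply: eq_Rintegral => y _; rewrite mulrA.
Qed.

Lemma sandwich_green_opnorm : (opnorm (sandwich sigma G) <= (2 * K * jmass)%:E)%E.
Proof.
apply: opnorm_le; last exact: sandwich_green_sqint.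
by rewrite !mulr_ge0 ?invr_ge0 ?exprn_ge0 ?(ltW c0) ?(ltW (jostC_gt0 m q)) ?jmass_ge0.
Qed.

Lemma sandwich_green_bounded : bounded_operator (sandwich sigma G).
Proof.
split.
- move=> phi lphi; apply/L2E; split.
    by apply: weight_measurable; exact: green_weighted_measurable.
  by apply: le_lt_trans (sandwich_green_sqint lphi) _; rewrite sqint_sqnorm// -EFinM ltry.
- move=> z f1 f2 l1 l2; apply: aeW => x _; rewrite /sandwich.
  have -> : weight (- sigma) (fun x => z *: f1 x + f2 x) =
      fun x => z *: weight (- sigma) f1 x + weight (- sigma) f2 x.
    by apply/funext => y; rewrite /weight scalerDr !scalerA mulrC.
  rewrite {1}/weight /green (splitop_linear z (bound x) (weight_mmeas l1) (weight_mmeas l2)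
    (green_weighted_integrable x l1) (green_weighted_integrable x l2)).
  by rewrite scalerDr /weight !scalerA mulrC.
- by apply: le_lt_trans sandwich_green_opnorm _; rewrite ltry.
Qed.

End Sandwich.

Lemma sandwich_diff_opnorm zeta zeta' g h g' h' (c K : R) :
  half_disc zeta -> jost V zeta g -> jost (reflect V) zeta h ->
  half_disc zeta' -> jost V zeta' g' -> jost (reflect V) zeta' h' ->
  0 < c -> c <= cabs (det2 (g 0) (beta *m h 0)) -> c <= cabs (det2 (g' 0) (beta *m h' 0)) ->
  0 <= K ->
  (forall x, split_bound (fun x y => lkernel m zeta g h x y - lkernel m zeta' g' h' x y)
    (fun x y => rkernel m zeta g h x y - rkernel m zeta' g' h' x y) x
    (fun y => K * bprod x y `^ rho)) ->
  (opnorm (sandwich sigma (fun f x => green m zeta g h f x - green m zeta' g' h' f x)%R) <=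
    (2 * K * jmass)%:E)%E.
Proof.
move=> hz sg sh hz' sg' sh' c0 cW cW' K0 HK; apply: opnorm_le.
  by rewrite !mulr_ge0 ?jmass_ge0.
move=> phi lphi; have mw := weight_mmeas lphi.
apply: sandwich_sqint => //.
  apply/spinor_measurableE; apply: mmeasB; apply/spinor_measurableE.
    exact: (green_weighted_measurable hz sg sh c0 cW lphi).
  exact: (green_weighted_measurable hz' sg' sh' c0 cW' lphi).
move=> x.
have iK : mu.-integrable setT (EFin \o (fun y => K * bprod x y `^ rho * mnorm (weight (- sigma) phi y))).
  have := integrableZl measurableT K (bprod_weight_integrable theta0 ts x lphi).
  by congr (integrable _ _ _); apply/funext => y /=; rewrite -EFinM mulrA.
rewrite /green (splitop_sub (green_bound m0 theta0 x aV hz sg sh c0 cW)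
  (green_bound m0 theta0 x aV hz' sg' sh' c0 cW') mw (green_weighted_integrable c x lphi)
  (green_weighted_integrable c x lphi)).
apply: (le_trans (splitop_le (HK x) mw iK)).
rewrite -RintegralZl//; last exact: bprod_weight_integrable.
by apply: eq_ler; apply: eq_Rintegral => y _; rewrite mulrA.
Qed.

(** The lower bound [c] is available for real [zeta] only. The parameters with energy lambda + i eps
    lie within a multiple of eps of the real parameter of [lambda], so for small eps they inherit
    the bound c/2, and Hoelder continuity of the kernel then gives convergence at rate eps^theta. *)
Lemma limiting_absorption (c lambda : R) : 0 < c ->
  (forall (a : R) g h, a != 0 -> `|a| < 1 -> jost V ((a%:C)%C) g ->
    jost (reflect V) ((a%:C)%C) h -> c <= cabs (det2 (g 0) (beta *m h 0))) ->
  m < `|lambda| ->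
  exists2 T : @operator R, is_limiting_resolvent m V sigma lambda T &
    (opnorm (sandwich sigma T) <= (2 * (c^-1 * J ^+ 2) * jmass)%:E)%E.
Proof.
move=> c0 Hc ml.
have [zeta0 [nz0 lt0 E0] [_ ImH]] : exists2 zeta, [/\ zeta != 0, cabs zeta < 1 &
    energy m zeta = ((lambda%:C)%C : C)] & (0 < Im ((lambda%:C)%C : C) -> Im zeta < 0) /\
    (Im ((lambda%:C)%C : C) = 0 -> Im zeta = 0).
  by apply: joukowski => //; right; rewrite cabs_real.
have I0 : Im zeta0 = 0 by exact: ImH.
have Z0 : zeta0 = ((Re zeta0)%:C)%C by apply: complexP => //=.
have hz0 : half_disc zeta0 by split; [|exact: ltW|rewrite I0].
have [g0 sg0 [h0 sh0]] := jost_pair hz0.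
have cW0 : c <= cabs (det2 (g0 0) (beta *m h0 0)).
  apply: (Hc (Re zeta0)); rewrite -?Z0//.
    by apply: contra_neq nz0 => R0; rewrite Z0 R0.
  by rewrite -cabs_real -Z0.
(* Chooses the parameter and both Jost solutions for every eps; the triple of zeros for eps <= 0 is
   a filler. *)
have /choice[d Hd] : forall eps : R, exists d : C * (R -> 'cV[C]_2) * (R -> 'cV[C]_2), 0 < eps ->
    [/\ half_disc d.1.1, Im d.1.1 < 0 /\ cabs d.1.1 < 1, energy m d.1.1 = (lambda +i* eps)%C,
        jost V d.1.1 d.1.2 & jost (reflect V) d.1.1 d.2].
  move=> eps; have [e0|e0] := ltP 0 eps; last by exists (0, fun=> 0, fun=> 0).
  have [zeta [nz lt E] [neg _]] : exists2 zeta, [/\ zeta != 0, cabs zeta < 1 &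
    energy m zeta = (lambda +i* eps)%C] & (0 < Im ((lambda +i* eps)%C : C) -> Im zeta < 0) /\
    (Im ((lambda +i* eps)%C : C) = 0 -> Im zeta = 0) by apply: joukowski => //; left.
  have {}neg := neg e0.
  have hz : half_disc zeta by split=> //; exact: ltW.
  have [g sg [h sh]] := jost_pair hz.
  by exists (zeta, g, h).
exists (green m zeta0 g0 h0); last exact: (sandwich_green_opnorm hz0 sg0 sh0 c0 cW0).
split; first exact: (sandwich_green_bounded hz0 sg0 sh0 c0 cW0).
exists (fun eps => green m (d eps).1.1 (d eps).1.2 (d eps).2); split.
  move=> eps e0; have [hz [neg lt] E sg sh] := Hd _ e0; rewrite -E.
  exact: (green_resolvent m0 theta0 cq q0 qN qle iq aV hz sg sh neg lt).
(* Half of [c] is given up when passing to complex parameters, and half of |zeta0| keeps them away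
   from 0. *)
have c20 : 0 < c / 2 by rewrite divr_gt0.
pose r := cabs zeta0 / 2; have r0 : 0 < r by rewrite divr_gt0 ?cabs_gt0.
have [Kw Kw0 Hw] := wronskian_holder m0 theta0 theta1 cq q0 qN iq aV r0.
have [K K0 HK] := green_holder m0 theta0 theta1 cq q0 qN iq aV r0 c20.
have [d1 d10 Hd1] := powR_small theta0 Kw0 c20.
(* The constant of [joukowski_lipschitz], which blows up as [lambda] approaches a threshold; it
   affects the rate of convergence but not the bound on the limit. *)
pose Cj := 2 / m / (1 - cabs zeta0).
have Cj0 : 0 <= Cj by rewrite !divr_ge0 ?(ltW m0) ?subr_ge0 ?(ltW lt0).
have dist eps : 0 < eps -> cabs (zeta0 - (d eps).1.1) <= Cj * eps.
  move=> e0; have [[nz _ _] [neg lt] E sg sh] := Hd _ e0.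
  rewrite cabs_distC /Cj mulrAC ler_pdivlMr ?subr_gt0//.
  have := joukowski_lipschitz m0 nz nz0 lt lt0; rewrite E E0.
  have -> : cabs ((lambda +i* eps)%C - (lambda%:C)%C) = eps.
    rewrite cabsE ReD ImD ReN ImN /= subrr oppr0 addr0 expr0n add0r sqrtr_sqr ger0_norm//.
    exact: ltW.
  by [].
have Cj1 : 0 < Cj + 1 by rewrite ltr_wpDl.
have dr0 : 0 < Num.min d1 r / (Cj + 1) by rewrite divr_gt0// lt_min d10 r0.
have bound : \forall eps \near 0^'+, (0%:E <= opnorm (sandwich sigma (fun f x => green m zeta0 g0 h0 f x -
    green m (d eps).1.1 (d eps).1.2 (d eps).2 f x)%R) <= (2 * K * jmass * (Cj * eps) `^ theta)%:E)%E.
  near=> eps.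
  have e0 : 0 < eps by near: eps; exact: nbhs_right_gt.
  have ed : Cj * eps <= Num.min d1 r.
    apply: (@le_trans _ _ ((Cj + 1) * eps)); first by apply: ler_wpM2r; [exact: ltW|lra].
    rewrite mulrC -ler_pdivlMr//; apply: ltW; near: eps; exact: nbhs_right_lt.
  have [hz _ _ sg sh] := Hd _ e0; have D := dist _ e0.
  move: ed; rewrite le_min => /andP[ed1 edr].
  have rz0 : r <= cabs zeta0 by rewrite /r; have := cabs_ge0 zeta0; lra.
  have rz : r <= cabs (d eps).1.1.
    have := cabsD (zeta0 - (d eps).1.1) (d eps).1.1; rewrite subrK => H.
    have := le_trans D edr; rewrite /r in H *; lra.
  have cW : c / 2 <= cabs (det2 ((d eps).1.2 0) (beta *m (d eps).2 0)).
    have H1 := Hw _ _ _ _ _ _ hz0 hz rz0 rz sg0 sh0 sg sh.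
    have H2 := Hd1 _ (cabs_ge0 _) (le_trans D ed1).
    have := cabsD (det2 (g0 0) (beta *m h0 0) - det2 ((d eps).1.2 0) (beta *m (d eps).2 0))
      (det2 ((d eps).1.2 0) (beta *m (d eps).2 0)).
    rewrite subrK => H3; have := le_trans H1 H2; have := le_trans cW0 H3; lra.
  have cW0' : c / 2 <= cabs (det2 (g0 0) (beta *m h0 0)) by have := cW0; have := c0; lra.
  rewrite opnorm_ge0 /=.
  apply: (@le_trans _ _ (2 * (K * cabs (zeta0 - (d eps).1.1) `^ theta) * jmass)%:E).
    apply: (sandwich_diff_opnorm hz0 sg0 sh0 hz sg sh c20 cW0' cW).
      by rewrite mulr_ge0 ?powR_ge0.
    by move=> x; exact: (HK _ _ _ _ _ _ x hz0 hz rz0 rz sg0 sh0 sg sh cW0' cW).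
  rewrite lee_fin.
  have P : cabs (zeta0 - (d eps).1.1) `^ theta <= (Cj * eps) `^ theta.
    by rewrite ge0_ler_powR ?nnegrE ?cabs_ge0 ?(ltW theta0)// mulr_ge0 ?(ltW e0).
  have := ler_wpM2l (mulr_ge0 (mulr_ge0 (ler0n R 2) K0) (jmass_ge0 theta sigma)) P.
  by apply: le_trans; apply: eq_ler; ring.
apply: (squeeze_cvge bound); first exact: cvg_cst.
apply: cvg_EFin; first exact: nearW.
apply/cvgrPdist_le => e e0.
have A0 : 0 <= 2 * K * jmass * Cj `^ theta by rewrite !mulr_ge0 ?powR_ge0 ?jmass_ge0.
have [d2 d20 Hd2] := powR_small theta0 A0 e0.
near=> eps; have ep : 0 <= eps by apply: ltW; near: eps; exact: nbhs_right_gt.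
have ed : eps <= d2 by apply: ltW; near: eps; exact: nbhs_right_lt.
rewrite sub0r normrN /= powRM// mulrA ger0_norm; first exact: Hd2.
by rewrite mulr_ge0 ?powR_ge0.
Unshelve. all: by end_near. Qed.

End LimitingAbsorption.

Theorem theorem1p3 (R : realType) (m : R) (V : R -> 'M[R[i]]_2) (sigma : R) :
  0 < m ->
  self_adjoint V -> continuous_entries V -> decay 3 V ->
  thresholds_regular m V ->
  1 < sigma ->
  exists T : R -> @operator R,
    (forall lambda, m < `|lambda| ->
       is_limiting_resolvent m V sigma lambda (T lambda)) /\
    (ereal_sup [set opnorm (sandwich sigma (T lambda))
               | lambda in [set lambda : R | (m < `|lambda|)%R]] < +oo)%E.
Proof.
move=> m0 sV cV dV regV s1.
have [theta [q [qb [[t0 t1 ts] [cq q0 qN qle] iq aV]]]] := admissible_exists sV cV dV s1.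
have [c c0 Hc] := wronskian_lower m0 t0 t1 cq q0 qN qle iq aV regV.
pose K := 2 * (c^-1 * jostC m q ^+ 2) * jmass theta sigma.
have /choice[T HT] : forall lambda : R, exists T : @operator R, m < `|lambda| ->
    is_limiting_resolvent m V sigma lambda T /\ (opnorm (sandwich sigma T) <= K%:E)%E.
  (* Where |lambda| <= m the operator is arbitrary, and the identity is taken. *)
  move=> lambda; have [ml|ml] := ltP m `|lambda|; last by exists (fun f => f).
  have [T HT KT] := limiting_absorption m0 t0 t1 ts cq q0 qN qle iq aV c0 Hc ml.
  by exists T.
exists T; split; first by move=> lambda /HT[].
apply: (@le_lt_trans _ _ K%:E); last by rewrite ltry.
by apply: ge_ereal_sup => _ [lambda /= /HT[_ HK] <-].
Qed.
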